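(* Let $R\in(0,\infty)$ and $k\in 2\mathbb{Z}\setminus\{0\}$. A map $Q\in H^1(B_R,\mathcal{S}_0)$ is $k$-fold $O(2)$-symmetric if and only if $$Q(x)=w_0(r)E_0+w_1(r)E_1+w_3(r)E_3\quad\text{for a.e. }x=(r\cos\varphi,r\sin\varphi)\in B_R,$$ where $w_0\in H^1((0,R);r\,dr)$ and $w_1,w_3\in H^1((0,R);r\,dr)\cap L^2((0,R);\frac1r\,dr)$.
   Context: $B_R\subset\mathbb{R}^2$ is the open disk of radius $R$ centered at $0$. $\mathcal{S}_0=\{Q\in\mathbb{R}^{3\times3}: Q=Q^t,\ \mathrm{tr}\,Q=0\}$. In polar coordinates $x=(r\cos\varphi,r\sin\varphi)$, $r>0$, $0\le\varphi<2\pi$, let $n(x)=(\cos\frac{k\varphi}{2},\sin\frac{k\varphi}{2},0)$. With $e_3=(0,0,1)$, $I_2=I_3-e_3\otimes e_3$: $E_0=\sqrt{\tfrac32}(e_3\otimes e_3-\tfrac13I_3)$, $E_1=\sqrt2(n\otimes n-\tfrac12I_2)$, $E_3=\tfrac1{\sqrt2}(n\otimes e_3+e_3\otimes n)$. The spaces $H^1((0,R);r\,dr)$ and $L^2((0,R);\frac1r dr)$ are the usual weighted Sobolev and Lebesgue spaces. Symmetry: let $L=\mathrm{diag}(1,-1,1)$, let $\mathcal{R}_k(\psi)$ be the $3\times3$ rotation about $e_3$ by angle $\frac k2\psi$ (so $\mathcal{R}_2(\psi)$ is the rotation about $e_3$ by angle $\psi$), $\tilde x=(x_1,x_2,0)$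 and $P_2(x_1,x_2,x_3)=(x_1,x_2)$. For $(\alpha,\psi)\in\{0,1\}\times[0,2\pi)$ set $Q_{\alpha,\psi}(x)=L^\alpha\mathcal{R}_k^t(\psi)\,Q\big(P_2(\mathcal{R}_2(\psi)L^\alpha\tilde x)\big)\,\mathcal{R}_k(\psi)L^\alpha$. A map $Q\in H^1(B_R,\mathcal{S}_0)$ is $k$-fold $O(2)$-symmetric if $Q=Q_{\alpha,\psi}$ a.e. in $B_R$ for every $(\alpha,\psi)\in\{0,1\}\times[0,2\pi)$. *)

(* Defs.v *)
From HB Require Import structures.
From mathcomp Require Import all_boot all_order all_algebra.
From mathcomp Require Import all_classical all_reals all_analysis.

Set Implicit Arguments.
Unset Strict Implicit.
Unset Printing Implicit Defensive.

Import Order.TTheory GRing.Theory Num.Theory.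
Import numFieldNormedType.Exports.

Local Open Scope classical_set_scope.
Local Open Scope ring_scope.

Section TestFunctions.
Context {R : realType} {V : normedModType R}.

(* D_{v_1} ... D_{v_n} f for s = [:: v_1; ...; v_n] *)
Definition iter_derive (s : seq V) (f : V -> R) : V -> R :=
  foldr (fun v g => fun x => 'D_v g x) f s.

(* For V finite-dimensional this is the usual C^oo: asking for the existence
   and continuity of the iterated derivatives along all vectors is the same as
   asking it along the vectors of a basis. *)
Definition smooth (f : V -> R) : Prop :=
  forall s : seq V, continuous (iter_derive s f) /\
    forall x v, derivable (iter_derive s f) x v.

(* C_c^oo(D), extended by 0 to V *)
Definition test_function (D : set V) (phi : V -> R) : Prop :=
  smooth phi /\
  exists K : set V,
    [/\ compact K, K `<=` D & forall x, ~ K x -> phi x = 0].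

End TestFunctions.

(* Membership of (the class of) f in L^2(D; rho dmu). On R and R * R, measurable
   means Borel; every Lebesgue class has a Borel representative. *)
Definition L2_weighted {R : realType} {d : measure_display}
    {T : measurableType d} (mu : {measure set T -> \bar R}) (D : set T)
    (rho f : T -> R) : Prop :=
  measurable_fun D f /\ (\int[mu]_(x in D) (f x ^+ 2 * rho x)%:E < +oo)%E.

Section SobolevSpaces.
Context {R : realType}.

Definition lebesgue1 : {measure set (measurableTypeR R) -> \bar R} :=
  @lebesgue_measure R.

Definition lebesgue2 :
    {measure set (measurableTypeR R * measurableTypeR R) -> \bar R} :=
  (@lebesgue_measure R \x @lebesgue_measure R)%E.

(* Distributional derivatives; they are only used below for f and g that are
   square integrable near every compact subset of D, so that both (real-valued)
   integrals are convergent. *)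
Definition weak_derivative1 (D : set R) (f g : R -> R) : Prop :=
  forall phi : R -> R, test_function D phi ->
    \int[lebesgue1]_(x in D) (f x * 'D_1 phi x) =
    - \int[lebesgue1]_(x in D) (g x * phi x).

Definition weak_derivative2 (D : set (R * R)) (v : R * R) (f g : R * R -> R) :
    Prop :=
  forall phi : R * R -> R, test_function D phi ->
    \int[lebesgue2]_(x in D) (f x * 'D_v phi x) =
    - \int[lebesgue2]_(x in D) (g x * phi x).

(* H^1(D; rho(r) dr): the weight enters the norms only, the derivative is the
   distributional one. *)
Definition H1_weighted (D : set R) (rho f : R -> R) : Prop :=
  L2_weighted lebesgue1 D rho f /\
  exists g : R -> R,
    L2_weighted lebesgue1 D rho g /\ weak_derivative1 D f g.

Definition H1 (D : set (R * R)) (f : R * R -> R) : Prop :=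
  let L2 := L2_weighted lebesgue2 D (fun=> 1) in
  [/\ L2 f,
      exists g, L2 g /\ weak_derivative2 D (1, 0) f g &
      exists g, L2 g /\ weak_derivative2 D (0, 1) f g].

End SobolevSpaces.

Section QTensors.
Context {R : realType}.

Definition disk (rho : R) : set (R * R) :=
  [set x | Num.sqrt (x.1 ^+ 2 + x.2 ^+ 2) < rho].

Definition S0 : set 'M[R]_3 := [set A | A = A^T /\ \tr A = 0].

Definition H1_S0 (D : set (R * R)) (Q : R * R -> 'M[R]_3) : Prop :=
  (forall i j : 'I_3, H1 D (fun x => Q x i j)) /\
  {ae lebesgue2, forall x, D x -> Q x \in S0}.

Definition vec3 (a b c : R) : 'cV[R]_3 := \col_(i < 3) [:: a; b; c]`_i.

Definition tens (u v : 'cV[R]_3) : 'M[R]_3 := u *m v^T.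

Definition e3 : 'cV[R]_3 := vec3 0 0 1.

Definition I2 : 'M[R]_3 := 1%:M - tens e3 e3.

(* n, E1 and E3 depend on x through its polar angle phi only. *)
Definition nvec (k : int) (phi : R) : 'cV[R]_3 :=
  vec3 (cos (k%:~R * phi / 2)) (sin (k%:~R * phi / 2)) 0.

Definition E0 : 'M[R]_3 :=
  Num.sqrt (3 / 2) *: (tens e3 e3 - (1 / 3) *: 1%:M).

Definition E1 (k : int) (phi : R) : 'M[R]_3 :=
  Num.sqrt 2 *: (tens (nvec k phi) (nvec k phi) - (1 / 2) *: I2).

Definition E3 (k : int) (phi : R) : 'M[R]_3 :=
  (1 / Num.sqrt 2) *: (tens (nvec k phi) e3 + tens e3 (nvec k phi)).

Definition Lmx : 'M[R]_3 := diag_mx (\row_(i < 3) [:: 1; -1; 1]`_i).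

Definition rot_e3 (theta : R) : 'M[R]_3 :=
  \matrix_(i < 3, j < 3)
    (nth [::] [:: [:: cos theta; - sin theta; 0];
                  [:: sin theta;   cos theta; 0];
                  [:: 0;           0;         1]] i)`_j.

Definition Rk (k : int) (psi : R) : 'M[R]_3 := rot_e3 (k%:~R / 2 * psi).

Definition lift3 (x : R * R) : 'cV[R]_3 := vec3 x.1 x.2 0.

Definition P2 (v : 'cV[R]_3) : R * R := (v 0 0, v 1 0).

Definition Qact (k : int) (alpha : 'I_2) (psi : R) (Q : R * R -> 'M[R]_3)
    (x : R * R) : 'M[R]_3 :=
  Lmx ^+ alpha *m (Rk k psi)^T
    *m Q (P2 (Rk 2 psi *m Lmx ^+ alpha *m lift3 x))
    *m Rk k psi *m Lmx ^+ alpha.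

Definition O2_symmetric (rho : R) (k : int) (Q : R * R -> 'M[R]_3) : Prop :=
  forall (alpha : 'I_2) (psi : R), 0 <= psi < 2 * pi ->
    {ae lebesgue2, forall x, disk rho x -> Q x = Qact k alpha psi Q x}.

End QTensors.

(* Main.v *)
(** If [Q] is symmetric, then in the frame rotating with the polar angle its
    entries are scalar functions invariant, up to a null set, under each rotation;
    by Fubini they are functions of [|x|], and the reflection leaves only the
    components along [E0], [E1], [E3].  For the regularity of the profiles, the
    entries of [Q] provide pairs [w(|x|) c_l], [w(|x|) s_l] in H^1, where
    [c_l + i s_l = ((x1 + i x2) / |x|) ^ l].  Testing their weak gradients against
    fields with radial profiles in the directions [x] and [x^perp], and adding the
    two identities, shows that [w'] is the circle average of
    [c_l d_r f1 + s_l d_r f2], and [l w / r] that of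
    [(c_l d_phi f2 - s_l d_phi f1) / r]; both averages are in [L^2(r dr)] by
    Cauchy-Schwarz.  Polar coordinates [x = s (1, t) / sqrt (1 + t ^ 2)] with a
    slope [t] and a signed radius [s] reduce all changes of variables to affine
    ones on the line.  Conversely, a tensor of the stated form is symmetric
    because [E0], [E1], [E3] are conjugated to each other by the frame rotation. *)

Require Import Defs.
From HB Require Import structures.
From mathcomp Require Import all_boot all_order all_algebra.
From mathcomp Require Import all_classical all_reals all_analysis.
From mathcomp Require Import measurable_realfun ring lra.

Set Implicit Arguments.
Unset Strict Implicit.
Unset Printing Implicit Defensive.

Import Order.TTheory GRing.Theory Num.Theory.
Import numFieldNormedType.Exports.

Local Open Scope classical_set_scope.
Local Open Scope ring_scope.

(** * Slope coordinates on the plane *)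

(** Each rotation comes with its own exceptional null set, and uncountably many null sets cannot
    simply be united. Fubini on the product of the plane with the line of slopes replaces them by a
    single slope along which almost every point is good; the profile is read off there. A slope
    needs no branch of the angle and involves only rational functions and one square root; it misses
    the vertical axis, a null set.

    Since [k] is even, [cos (k phi / 2)] and [sin (k phi / 2)] are polynomials in the coordinates
    divided by a power of [|x|], up to a sign. Up to constants and signs, the H^1 pairs are
    [(Q 2 2, 0)] with [l = 0] for [w0], [(Q 0 0 - Q 1 1, 2 Q 0 1)] with [l = |k|] for [w1], and
    [(Q 0 2, Q 1 2)] with [l = |k| / 2] for [w3]. The weight [1 / r] comes from [l > 0]. Adding the
    identities of the two members of a pair replaces the trigonometric factors by
    [c_l ^ 2 + s_l ^ 2 = 1], so that a function of the radius alone remains. Radial test profiles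
    vanish near 0, which makes negative powers of [|x|] harmless. *)

Section affine.
Context {R : realType}.
Local Notation mu := (@lebesgue_measure R).
Local Notation MR := (measurableTypeR R).

Lemma measurable_affine (a b : R) :
  measurable_fun setT (fun x : MR => (a * x + b)%R : MR).
Proof. by apply: measurable_funD => //; exact: measurable_funM. Qed.

(** Both sides are measures in [A], so by uniqueness it suffices to compare them on half-open
    intervals. *)
Lemma lebesgue_measure_affine (a b : R) (A : set MR) :
  a != 0 -> measurable A ->
  mu A = (`|a|%:E * mu ((fun x => a * x + b)%R @^-1` A))%E.
Proof.
move=> a0 mA; have a_ge0 : 0 <= `|a| by [].
pose nu : {measure set MR -> \bar R} :=
  mscale (NngNum a_ge0) (pushforward mu (fun x : MR => (a * x + b)%R : MR)).
rewrite (@lebesgue_measure_unique R (nu (@measurable_affine a b))) // => X [[l r] _ <-].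
rewrite /= /mscale /= /pushforward.
have [a_gt0|a_lt0] : 0 < a \/ a < 0 by move: a0; rewrite neq_lt => /orP[]; [right|left].
  rewrite [X in (_ * mu X)%E](_ : _ = `](l - b) / a, (r - b) / a]%classic); last first.
    apply/seteqP; split => x /=; rewrite !in_itv/= ltr_pdivrMr// ler_pdivlMr//;
      by move=> /andP[? ?]; apply/andP; split; lra.
  rewrite !lebesgue_measure_itv/= !lte_fin (ltr_pM2r (x := a^-1)) ?invr_gt0// ltrD2r.
  case: ifP => _; last by rewrite mule0.
  rewrite -!EFinD -EFinM gtr0_norm//; congr EFin; field; exact: a0.
(* A negative [a] reverses the interval, so its closed end moves to the left; the length does not
   see this. *)
rewrite [X in (_ * mu X)%E](_ : _ = `[(r - b) / a, (l - b) / a[%classic); last first.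
  apply/seteqP; split => x /=; rewrite !in_itv/= ltr_ndivlMr// ler_ndivrMr//;
    by move=> /andP[? ?]; apply/andP; split; lra.
rewrite !lebesgue_measure_itv/= !lte_fin (ltr_nM2r (x := a^-1)) ?invr_lt0// ltrD2r.
case: ifP => _; last by rewrite mule0.
rewrite -!EFinD -EFinM ltr0_norm//; congr EFin; field; exact: a0.
Qed.

Lemma ge0_integral_affine (a b : R) (f : MR -> \bar R) :
  a != 0 -> measurable_fun setT f -> (forall x, 0 <= f x)%E ->
  (\int[mu]_x f x = \int[mu]_x (f (a * x + b)%R * `|a|%:E))%E.
Proof.
move=> a0 mf f0; have mT := @measurable_affine a b.
have a_ge0 : 0 <= `|a| by [].
pose nu : {measure set MR -> \bar R} :=
  pushforward (mscale (NngNum a_ge0) mu) (fun x : MR => (a * x + b)%R : MR).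
rewrite (@eq_measure_integral _ _ _ _ (nu mT)); last first.
  by move=> A mA _; rewrite /= /pushforward /mscale /= (lebesgue_measure_affine b a0 mA).
rewrite ge0_integral_pushforward// preimage_setT ge0_integral_mscale//=.
- by rewrite muleC ge0_integralZr//; exact: measurableT_comp.
- exact: measurableT_comp.
Qed.

End affine.

(** Inversion sends 0 to 0 and is discontinuous there, hence the separate treatment of the point 0
    and of its open complement. *)
Lemma measurable_funV {R : realType} d (T : measurableType d) (D : set T) (f : T -> R) :
  measurable_fun D f -> measurable_fun D (fun x => (f x)^-1).
Proof.
move=> mf; suff mV : measurable_fun setT (@GRing.inv R) by exact: measurableT_comp.
rewrite -(setUv [set 0 : R]); apply/measurable_funU.
- exact: measurable_set1.
- by apply: measurableC; exact: measurable_set1.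
split; first exact: measurable_fun_set1.
apply: open_continuous_measurable_fun.
  by apply: closed_openC; exact: closed_eq.
move=> x /set_mem /eqP x0; exact: inv_continuous.
Qed.

Lemma measurable_sqrt {R : realType} d (T : measurableType d) (D : set T) (f : T -> R) :
  measurable_fun D f -> measurable_fun D (fun x => Num.sqrt (f x)).
Proof.
move=> mf; suff mV : measurable_fun setT (@Num.sqrt R) by exact: measurableT_comp.
exact: continuous_measurable_fun (@sqrt_continuous R).
Qed.

Ltac meas := repeat first
  [ assumption | exact: measurable_cst | exact: measurable_fst | exact: measurable_snd
  | exact: measurable_id
  | apply: measurable_fun_pair | apply: measurable_funD | apply: measurable_funN
  | apply: measurable_funM
  | apply: measurable_funX | apply: measurable_funV | apply: measurable_sqrt
  | (apply: measurableT_comp; [exact: normr_measurable|])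
  | apply: emeasurable_funM
  | apply/measurable_EFinP
  | (match goal with H : measurable_fun setT ?f |- _ => apply: (measurableT_comp H) end) ].

Section plane.
Context {R : realType}.
Local Notation mu := (@lebesgue_measure R).
Local Notation MR := (measurableTypeR R).
Implicit Types f : MR * MR -> \bar R.

Lemma ge0_integral_lebesgue2_12 f : measurable_fun setT f -> (forall x, 0 <= f x)%E ->
  (\int[lebesgue2]_x f x = \int[mu]_x \int[mu]_y f (x, y))%E.
Proof. by move=> mf f0; rewrite /lebesgue2 fubini_tonelli1. Qed.

Lemma ge0_integral_lebesgue2_21 f : measurable_fun setT f -> (forall x, 0 <= f x)%E ->
  (\int[lebesgue2]_x f x = \int[mu]_y \int[mu]_x f (x, y))%E.
Proof. by move=> mf f0; rewrite /lebesgue2 fubini_tonelli2. Qed.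

(* The point with signed polar coordinate [s] on the line of slope [t]. *)
Definition slope_pt (t s : R) : R * R :=
  (s / Num.sqrt (1 + t ^+ 2), s * t / Num.sqrt (1 + t ^+ 2)).

(** The Jacobian of [slope_pt]: with [t = tan phi], the polar element [|s| ds dphi] becomes
    [|s| / (1 + t ^ 2) ds dt]. *)
Definition slope_wt (t s : R) : R := `|s| / (1 + t ^+ 2).

Lemma slope_wt_ge0 t s : 0 <= slope_wt t s.
Proof. by rewrite /slope_wt divr_ge0// addr_ge0// sqr_ge0. Qed.

Lemma measurable_slope_pt : measurable_fun setT
  (fun p : MR * MR => slope_pt p.1 p.2 : MR * MR).
Proof. rewrite /slope_pt; meas. Qed.

Lemma measurable_slope_wt : measurable_fun setT
  (fun p : MR * MR => slope_wt p.1 p.2 : MR).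
Proof. rewrite /slope_wt; meas. Qed.

(** Two affine substitutions separated by Tonelli: [y = x * t] at fixed [x], then
    [x = s / sqrt (1 + t ^ 2)] at fixed [t]. *)
Lemma ge0_integral_slope f : measurable_fun setT f -> (forall x, 0 <= f x)%E ->
  (\int[lebesgue2]_x f x =
   \int[lebesgue2]_p (f (slope_pt p.1 p.2) * (slope_wt p.1 p.2)%:E))%E.
Proof.
move=> mf f0.
have ms := measurable_slope_pt; have mw := measurable_slope_wt.
rewrite ge0_integral_lebesgue2_12//.
transitivity (\int[mu]_x \int[mu]_t (f (x, x * t)%R * `|x|%:E))%E.
  have mfx : measurable_fun setT
      (fun p : MR * MR => (f (p.1, p.1 * p.2)%R * `|p.1|%:E))%E by meas.
  apply: ge0_ae_eq_integral => //.
  - exact: measurable_fun_fubini_tonelli_F.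
  - apply: (measurable_fun_fubini_tonelli_F
      (fun p : MR * MR => (f (p.1, p.1 * p.2)%R * `|p.1|%:E))%E) => //.
    by move=> x; exact: mule_ge0.
  - by move=> x _; exact: integral_ge0.
  - by move=> x _; apply: integral_ge0 => y _; exact: mule_ge0.
  (* On the vertical axis [x = 0] the substitution [y = x * t] degenerates; this axis is the null
     set left out. *)
  exists [set 0]; split; [exact: measurable_set1|exact: lebesgue_measure_set1|].
  move=> x /= /not_implyP[_ H]; apply: contrapT => /eqP x0; apply: H.
  rewrite (ge0_integral_affine 0 x0) //; last by meas.
  by apply: eq_integral => t _; rewrite addr0.
rewrite (fubini_tonelli (fun p : MR * MR => (f (p.1, p.1 * p.2)%R * `|p.1|%:E))%E)/=; last 2 first.
  by meas.
  by move=> x; exact: mule_ge0.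
rewrite ge0_integral_lebesgue2_12; last 2 first.
  by meas.
  by move=> x; rewrite mule_ge0// lee_fin slope_wt_ge0.
apply: eq_integral => t _ /=.
have q0 : 0 < 1 + t ^+ 2 by rewrite ltr_pwDl// sqr_ge0.
have q0' : 0 < Num.sqrt (1 + t ^+ 2) by rewrite sqrtr_gt0.
rewrite (@ge0_integral_affine _ (Num.sqrt (1 + t ^+ 2))^-1 0); last 3 first.
  by rewrite invr_eq0 gt_eqF.
  by meas.
  by move=> x; exact: mule_ge0.
apply: eq_integral => s _; rewrite addr0 /slope_pt /slope_wt -muleA -EFinM.
rewrite [_^-1 * s]mulrC [s / _ * t]mulrAC; congr (_ * _%:E)%E.
rewrite normrM -mulrA -expr2 real_normK ?num_real// exprVn sqr_sqrtr//.
exact: ltW.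
Qed.

End plane.

(** * Null sets of product measures and their sections *)

Section negligible_sections.
Context {R : realType} d1 d2 (T1 : measurableType d1) (T2 : measurableType d2).

Lemma aeP d (T : measurableType d) (m : {measure set T -> \bar R}) (A : set T) :
  measurable A -> {ae m, forall x, A x} <-> (m (~` A) = 0)%E.
Proof. by move=> mA; rewrite -negligibleP//; exact: measurableC. Qed.

Lemma ae_integralP d (T : measurableType d) (m : {measure set T -> \bar R})
    (f : T -> \bar R) : measurable_fun setT f -> (forall x, 0 <= f x)%E ->
  (\int[m]_x f x = 0)%E <-> {ae m, forall x, f x = 0%E}.
Proof.
move=> mf f0; have := ae_eq_integral_abs m measurableT mf.
rewrite (_ : (\int[m]_x `|f x|)%E = (\int[m]_x f x)%E); last first.
  by apply: eq_integral => x _; rewrite gee0_abs.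
move=> ->; split; apply: filterS => x; first by apply.
by move=> ->.
Qed.

Variables (m1 : {sigma_finite_measure set T1 -> \bar R})
          (m2 : {sigma_finite_measure set T2 -> \bar R}).

(** The product measure of a set is by definition the integral of the measures of its sections, so
    it vanishes exactly when almost every section is null. *)
Lemma ae_prod12 (A : set (T1 * T2)) : measurable A ->
  {ae (m1 \x m2)%E, forall p, A p} <->
  {ae m1, forall x, {ae m2, forall y, A (x, y)}}.
Proof.
move=> mA; rewrite aeP//.
have mB : measurable (~` A) by exact: measurableC.
change ((\int[m1]_x (m2 \o xsection (~` A)) x)%E = 0%E <->
  {ae m1, forall x, {ae m2, forall y, A (x, y)}}).
rewrite ae_integralP//; last exact: measurable_fun_xsection.
have E x : (m2 (xsection (~` A) x) = 0)%E <-> {ae m2, forall y, A (x, y)}.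
  rewrite -(negligibleP _ (measurable_xsection x mB)).
  rewrite (_ : xsection _ x = ~` [set y | A (x, y)])//.
  by apply/seteqP; split => y /=; rewrite /xsection /= ?inE.
by split; apply: filterS => x /E.
Qed.

Lemma ae_prod21 (A : set (T1 * T2)) : measurable A ->
  {ae (m1 \x m2)%E, forall p, A p} <->
  {ae m2, forall y, {ae m1, forall x, A (x, y)}}.
Proof.
move=> mA; rewrite aeP//.
have mB : measurable (~` A) by exact: measurableC.
(* The definition of the product slices along the first factor; uniqueness of the product measure
   allows slicing along the second. *)
have E0 : ((m1 \x m2) (~` A) = \int[m2]_y (m1 \o ysection (~` A)) y)%E.
  apply: (product_measure_unique (m' := (m1 \x^ m2)%E)) => // X Y mX mY.
  exact: product_measure2E.
rewrite [X in X = _ <-> _]E0.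
rewrite ae_integralP//; last exact: measurable_fun_ysection.
have E y : (m1 (ysection (~` A) y) = 0)%E <-> {ae m1, forall x, A (x, y)}.
  rewrite -(negligibleP _ (measurable_ysection y mB)).
  rewrite (_ : ysection _ y = ~` [set x | A (x, y)])//.
  by apply/seteqP; split => x /=; rewrite /ysection /= ?inE.
by split; apply: filterS => y /E.
Qed.

End negligible_sections.

(** * Rotations and the reflection preserve integrals and null sets *)

Section plane_isometries.
Context {R : realType}.
Local Notation mu := (@lebesgue_measure R).
Local Notation MR := (measurableTypeR R).
Implicit Types f : MR * MR -> \bar R.

(** The parameters are a cosine and a sine rather than an angle: a slope then gives a rotation
    algebraically, and measurability in the parameter is immediate. *)
Definition rot2 (c s : R) (x : R * R) : R * R :=
  (c * x.1 - s * x.2, s * x.1 + c * x.2).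

Lemma measurable_rot2 c s :
  measurable_fun setT (rot2 c s : MR * MR -> MR * MR).
Proof. rewrite /rot2; apply: measurable_fun_pair; meas. Qed.

Definition refl2 (x : R * R) : R * R := (x.1, - x.2).

Lemma measurable_refl2 : measurable_fun setT (refl2 : MR * MR -> MR * MR).
Proof. rewrite /refl2; meas. Qed.

Lemma ge0_integral_refl2 f : measurable_fun setT f -> (forall x, 0 <= f x)%E ->
  (\int[lebesgue2]_x f x = \int[lebesgue2]_x f (refl2 x))%E.
Proof.
move=> mf f0; have mr := measurable_refl2.
have mfr : measurable_fun setT (fun x : MR * MR => f (refl2 x)) by exact: (measurableT_comp mf).
rewrite (ge0_integral_lebesgue2_12 mf f0) (ge0_integral_lebesgue2_12 mfr (fun x => f0 (refl2 x))).
apply: eq_integral => x _; rewrite (@ge0_integral_affine _ (-1) 0)//; last by meas.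
by apply: eq_integral => y _; rewrite addr0 mulN1r normrN1 mule1.
Qed.

(** For [c != 0] the rotation splits into the affine maps [y := (s * x + y) / c] at fixed [x] and
    [x := c * x - s * y] at fixed [y], whose Jacobians [1 / |c|] and [|c|] cancel. For [c = 0] it
    exchanges the axes up to signs. *)
Lemma ge0_integral_rot2 (c s : R) f : c ^+ 2 + s ^+ 2 = 1 ->
  measurable_fun setT f -> (forall x, 0 <= f x)%E ->
  (\int[lebesgue2]_x f x = \int[lebesgue2]_x f (rot2 c s x))%E.
Proof.
move=> cs1 mf f0; have mr := measurable_rot2 c s.
have mfr : measurable_fun setT (fun x : MR * MR => f (rot2 c s x)) by exact: (measurableT_comp mf).
rewrite [RHS](ge0_integral_lebesgue2_21 mfr (fun x => f0 (rot2 c s x))).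
have [c0|c0] := eqVneq c 0.
  have s1 : `|s| = 1 by rewrite -sqrtr_sqr -[RHS]sqrtr1 -cs1 c0 expr0n add0r.
  have s0 : s != 0 by rewrite -normr_eq0 s1 oner_eq0.
  rewrite [LHS](ge0_integral_lebesgue2_12 mf f0).
  rewrite (@ge0_integral_affine _ (- s) 0)//; last 3 first.
  - by rewrite oppr_eq0.
  - exact: measurable_fun_fubini_tonelli_F.
  - by move=> x; exact: integral_ge0.
  apply: eq_integral => y _; rewrite addr0 normrN s1 mule1.
  rewrite (@ge0_integral_affine _ s 0)//; last by meas.
  apply: eq_integral => x _.
  by rewrite s1 mule1 addr0 /rot2 c0 !mul0r/= add0r addr0 mulNr.
transitivity (\int[mu]_y \int[mu]_x (f (x, (s * x + y) / c)%R * `|c^-1|%:E))%E.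
  rewrite [LHS](ge0_integral_lebesgue2_12 mf f0).
  rewrite -(fubini_tonelli (fun p : MR * MR => (f (p.1, (s * p.1 + p.2) / c)%R * `|c^-1|%:E))%E)/=; last 2 first.
  - by meas.
  - by move=> x; exact: mule_ge0.
  apply: eq_integral => x _.
  rewrite (@ge0_integral_affine _ c^-1 (s * x / c))//; last 2 first.
  - by rewrite invr_eq0.
  - by meas.
  by apply: eq_integral => y _; rewrite mulrDl addrC [c^-1 * y]mulrC.
apply: eq_integral => y _.
rewrite (@ge0_integral_affine _ c (- s * y))//; last first.
- by move=> x; exact: mule_ge0.
- by meas.
apply: eq_integral => x _.
rewrite -muleA -EFinM -normrM mulVf// normr1 mule1 /rot2 mulNr /=.
congr (f (_, _)).
have -> : s * (c * x - s * y) + y = c * s * x + (1 - s ^+ 2) * y by ring.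
by rewrite -cs1; field.
Qed.

#[export] Instance ae_lebesgue2_filter : Filter (almost_everywhere (@lebesgue2 R)).
Proof. exact: ae_filter_ringOfSetsType. Qed.

Lemma ae_preimage (T : MR * MR -> MR * MR) (P : set (MR * MR)) :
  measurable_fun setT T ->
  (forall f, measurable_fun setT f -> (forall x, 0 <= f x)%E ->
    (\int[lebesgue2]_x f x = \int[lebesgue2]_x f (T x))%E) ->
  {ae @lebesgue2 R, forall x, P x} -> {ae @lebesgue2 R, forall x, P (T x)}.
Proof.
move=> mT H [N [mN N0 PN]]; exists (T @^-1` N); split.
- by rewrite -[_ @^-1` _]setTI; exact: mT.
- have mi : measurable_fun setT (fun x : MR * MR => (\1_N x)%:E : \bar R) by apply/measurable_EFinP.
  have := H _ mi; rewrite integral_indic// setIT N0.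
  rewrite (_ : (fun x => (\1_N (T x))%:E) = (fun x => (\1_(T @^-1` N) x)%:E : \bar R)).
    rewrite integral_indic//; last by rewrite -[_ @^-1` _]setTI; exact: mT.
    by rewrite setIT => -> // x; rewrite lee_fin.
  by apply/funext => x; rewrite !indicE.
- by move=> x /= nP; exact: PN.
Qed.

Lemma ae_rot2 (c s : R) (P : set (MR * MR)) : c ^+ 2 + s ^+ 2 = 1 ->
  {ae @lebesgue2 R, forall x, P x} -> {ae @lebesgue2 R, forall x, P (rot2 c s x)}.
Proof.
move=> cs1; apply: ae_preimage; first exact: measurable_rot2.
by move=> f mf f0; exact: ge0_integral_rot2.
Qed.

Lemma ae_refl2 (P : set (MR * MR)) :
  {ae @lebesgue2 R, forall x, P x} -> {ae @lebesgue2 R, forall x, P (refl2 x)}.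
Proof.
by apply: ae_preimage; [exact: measurable_refl2|exact: ge0_integral_refl2].
Qed.

(** The weight is positive off the null line [s = 0], so the integral of the weighted indicator
    vanishes only if the indicator does almost everywhere. *)
Lemma ae_slope (A : set (MR * MR)) : measurable A ->
  {ae @lebesgue2 R, forall x, A x} <->
  {ae @lebesgue2 R, forall p : R * R, A (slope_pt p.1 p.2)}.
Proof.
move=> mA; rewrite aeP//.
have mB : measurable (~` A) by exact: measurableC.
have ms := @measurable_slope_pt R; have mw := @measurable_slope_wt R.
have mi : measurable_fun setT (fun x : MR * MR => (\1_(~` A) x)%:E : \bar R).
  by apply/measurable_EFinP.
rewrite -(setIT (~` A)) -integral_indic// ge0_integral_slope//.
rewrite ae_integralP; last 2 first.
- apply: emeasurable_funM; last by apply/measurable_EFinP.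
  exact: (measurableT_comp mi).
- by move=> x; rewrite -EFinM lee_fin mulr_ge0// slope_wt_ge0.
have s0 : {ae @lebesgue2 R, forall p : R * R, p.2 != 0}.
  apply/(@ae_prod12 R _ _ MR MR mu mu [set p | p.2 != 0]).
    have m0 : measurable [set x : MR | x != 0].
      rewrite (_ : [set _ | _] = ~` [set 0]); first by apply: measurableC; exact: measurable_set1.
      by apply/seteqP; split => x /=; [move/eqP|move=> ?; apply/eqP].
    by have := @measurable_snd _ _ MR MR measurableT _ m0; rewrite setTI.
  apply: aeW => x /=; exists [set 0]; split.
  - exact: measurable_set1.
  - exact: lebesgue_measure_set1.
  - by move=> y /= /negP/negPn/eqP.
split; last first.
  by apply: filterS => p Ap; rewrite indicE memNset ?mul0e// => /(_ Ap).
move=> H; move: H s0; apply: filterS2 => p + p2.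
rewrite -EFinM => -[] /eqP; rewrite mulf_eq0 => /orP[|] /eqP.
  rewrite indicE; case: (boolP (_ \in _)) => //= [_ /eqP|]; first by rewrite oner_eq0.
  by rewrite notin_setE /= => /contrapT.
rewrite /slope_wt => /eqP; rewrite mulf_eq0 normr_eq0 invr_eq0 => /orP[p0|]; first by rewrite p0 in p2.
by rewrite gt_eqF// ltr_pwDl// sqr_ge0.
Qed.

End plane_isometries.

(** * Rotation-invariant functions *)

Section radial_profile.
Context {R : realType}.
Local Notation mu := (@lebesgue_measure R).
Local Notation MR := (measurableTypeR R).

Definition enorm (x : R * R) : R := Num.sqrt (x.1 ^+ 2 + x.2 ^+ 2).

Lemma measurable_enorm : measurable_fun setT (enorm : MR * MR -> MR).
Proof. rewrite /enorm; meas. Qed.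

Lemma enorm_ge0 x : 0 <= enorm x. Proof. exact: sqrtr_ge0. Qed.

Lemma enorm_sqr x : enorm x ^+ 2 = x.1 ^+ 2 + x.2 ^+ 2.
Proof. by rewrite sqr_sqrtr// addr_ge0// sqr_ge0. Qed.

Lemma enorm_eq0 x : enorm x = 0 -> x = (0, 0).
Proof.
move=> x0; have := enorm_sqr x; rewrite x0 expr0n => /esym/eqP.
rewrite paddr_eq0 ?sqr_ge0// !sqrf_eq0 => /andP[/eqP + /eqP].
by case: x {x0} => a b /= -> ->.
Qed.

Lemma enorm_rot2 c s x : c ^+ 2 + s ^+ 2 = 1 -> enorm (rot2 c s x) = enorm x.
Proof.
move=> cs; rewrite /enorm /rot2 /=; congr Num.sqrt.
rewrite -[RHS]mul1r -cs; ring.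
Qed.

Lemma enorm_refl2 x : enorm (refl2 x) = enorm x.
Proof. by rewrite /enorm /refl2 /= sqrrN. Qed.

Lemma slope_root_gt0 (t : R) : 0 < Num.sqrt (1 + t ^+ 2).
Proof. by rewrite sqrtr_gt0 ltr_pwDl// sqr_ge0. Qed.

Lemma slope_root_sqr (t : R) : Num.sqrt (1 + t ^+ 2) ^+ 2 = 1 + t ^+ 2.
Proof. by rewrite sqr_sqrtr// addr_ge0// sqr_ge0. Qed.

Lemma enorm_slope_pt (t s : R) : enorm (slope_pt t s) = `|s|.
Proof.
rewrite /enorm /slope_pt /= -(sqrtr_sqr s); congr Num.sqrt.
have := slope_root_sqr t; have := slope_root_gt0 t.
set q := Num.sqrt _ => q0 qE.
rewrite !expr_div_n qE; have : 1 + t ^+ 2 != 0 by rewrite gt_eqF// ltr_pwDl// sqr_ge0.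
by move=> ?; field.
Qed.

(** This cosine is positive, so slopes reach only the rotations of an open half circle; the
    half-turn [rot2 (-1) 0] is treated beside them. *)
Definition slope_cos (t : R) : R := (Num.sqrt (1 + t ^+ 2))^-1.
Definition slope_sin (t : R) : R := t / Num.sqrt (1 + t ^+ 2).

Lemma slope_cos2Dsin2 (t : R) : slope_cos t ^+ 2 + slope_sin t ^+ 2 = 1.
Proof.
rewrite /slope_cos /slope_sin.
have := slope_root_sqr t; have := slope_root_gt0 t.
set q := Num.sqrt _ => q0 qE; rewrite expr_div_n exprVn qE.
by field; rewrite gt_eqF// ltr_pwDl// sqr_ge0.
Qed.

(** Both sides have signed radius [s] and the sum of the two angles. The exchange lets a frozen
    slope trade places with the variable slope of a rotation. *)
Lemma rot2_slope_pt (t p s : R) : rot2 (slope_cos p) (slope_sin p) (slope_pt t s) =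
  rot2 (slope_cos t) (slope_sin t) (slope_pt p s).
Proof.
rewrite /rot2 /slope_cos /slope_sin /slope_pt /=.
by congr pair; [ring|field; rewrite !gt_eqF ?slope_root_gt0].
Qed.

Lemma slope_ptN (t s : R) : slope_pt t (- s) = rot2 (-1) 0 (slope_pt t s).
Proof. by rewrite /slope_pt /rot2 /=; congr pair; ring. Qed.

Lemma ae_slope_pt (P : set (MR * MR)) : {ae @lebesgue2 R, forall x, P x} ->
  {ae @lebesgue2 R, forall p : R * R, P (slope_pt p.1 p.2)}.
Proof.
move=> [N [mN N0 PN]].
have /(ae_slope (measurableC mN)) : {ae @lebesgue2 R, forall x, (~` N) x}.
  by rewrite aeP; [rewrite setCK|exact: measurableC].
apply: filterS => p /= nN; apply: contrapT => nP; apply: nN; exact: PN.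
Qed.

Lemma ae_prod_ae12 d1 d2 (T1 : measurableType d1) (T2 : measurableType d2)
    (m1 : {sigma_finite_measure set T1 -> \bar R})
    (m2 : {sigma_finite_measure set T2 -> \bar R}) (P : set (T1 * T2)) :
  {ae (m1 \x m2)%E, forall p, P p} ->
  {ae m1, forall x, {ae m2, forall y, P (x, y)}}.
Proof.
move=> [N [mN N0 PN]].
have : {ae (m1 \x m2)%E, forall x, (~` N) x}.
  by rewrite aeP; [rewrite setCK|exact: measurableC].
move/(ae_prod12 m1 m2 (measurableC mN)).
have F1 := ae_filter_ringOfSetsType m1; have F2 := ae_filter_ringOfSetsType m2.
apply: filterS => x; apply: filterS => y /= nN.
by apply: contrapT => nP; apply: nN; exact: PN.
Qed.

Lemma measurable_eqr_set d (T : measurableType d) (f g : T -> R) :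
  measurable_fun setT f -> measurable_fun setT g ->
  measurable [set x | f x = g x].
Proof.
move=> mf mg; rewrite (_ : mkset _ = setT `&` (fun x => f x == g x) @^-1` [set true]).
  by apply: measurable_fun_eqr.
by rewrite setTI; apply/seteqP; split => x /= /eqP.
Qed.

Lemma ae_lebesgue_ex (P : set MR) : {ae mu, forall x, P x} -> exists x, P x.
Proof.
move=> H; apply: contrapT => nP; move: H => [N [mN N0 PN]].
have NT : N = setT.
  by apply/seteqP; split => // x _; apply: PN => /= Px; apply: nP; exists x.
have : (mu (`[0%R, 1%R]%classic : set R) <= mu N)%E.
  by apply: le_measure; rewrite ?inE// NT.
by rewrite N0 lebesgue_measure_itv/= lte_fin ltr01 oppr0 adde0 lee_fin ler10.
Qed.

(* [lebesgue2] has no canonical sigma-finite structure, which Fubini requires. *)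
Definition plane_measure : set (MR * MR)%type -> \bar R := (mu \x mu)%E.
HB.instance Definition _ := Measure.copy plane_measure (@lebesgue2 R).
Lemma plane_measure_sigma_finite : sigma_finite setT plane_measure.
Proof.
pose I n : set R := `[- n%:R, n%:R]%classic.
exists (fun n => I n `*` I n) => [|n].
  apply/esym/seteqP; split => // -[x y] _.
  pose n := Num.truncn (Num.max `|x| `|y|); exists n.+1 => //.
  have : Num.max `|x| `|y| <= n.+1%:R by exact/ltW/truncnS_gt.
  by rewrite ge_max => /andP[xn yn]; split; rewrite /I /= in_itv /= -ler_norml.
have mI : measurable (I n : set MR) by exact: measurable_itv.
split; first exact: (measurableX mI mI).
have Ifin : (mu (I n) < +oo)%E.
  by rewrite /I lebesgue_measure_itv/=; case: ifP => _; rewrite ?ltry// -EFinD ltry.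
rewrite [X in (X < _)%E](product_measure1E mu mu mI mI).
by apply: lte_mul_pinfty => //; rewrite ge0_fin_numE.
Qed.
HB.instance Definition _ := Measure_isSigmaFinite.Build _ _ _ plane_measure
  plane_measure_sigma_finite.

Lemma radial_profile (g : MR * MR -> MR) : measurable_fun setT g ->
  (forall c s, c ^+ 2 + s ^+ 2 = 1 ->
    {ae @lebesgue2 R, forall x : R * R, g (rot2 c s x) = g x}) ->
  exists w : MR -> MR, measurable_fun setT w /\
    {ae @lebesgue2 R, forall x : R * R, g x = w (enorm x)}.
Proof.
move=> mg gE.
pose A := [set z : (MR * MR) * MR |
  g (rot2 (slope_cos z.2) (slope_sin z.2) z.1) = g z.1 /\
  g (rot2 (-1) 0 z.1) = g z.1].
have mrot : measurable_fun setT (fun z : (MR * MR) * MR =>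
    rot2 (slope_cos z.2) (slope_sin z.2) z.1 : MR * MR).
  have m11 : measurable_fun setT (fun z : (MR * MR) * MR => z.1.1).
    exact: measurableT_comp.
  have m12 : measurable_fun setT (fun z : (MR * MR) * MR => z.1.2).
    exact: measurableT_comp.
  by rewrite /rot2 /slope_cos /slope_sin; apply: measurable_fun_pair;
    [apply: measurable_funB|apply: measurable_funD]; meas.
have mA : measurable A.
  apply: measurableI; apply: measurable_eqr_set.
  - exact: (measurableT_comp mg mrot).
  - exact: measurableT_comp.
  - have mr1 : measurable_fun setT (fun z : (MR * MR) * MR =>
        rot2 (-1) 0 z.1 : MR * MR).
      by apply: (@measurableT_comp _ _ _ _ _ _ (rot2 (-1) 0)) => //; exact: measurable_rot2.
    exact: (measurableT_comp mg mr1).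
  - exact: measurableT_comp.
pose lam : {sigma_finite_measure set (MR * MR)%type -> \bar R} := plane_measure.
(* Fubini swaps the quantifiers: from a null set of points for each rotation to a null set of
   rotations for almost every point. *)
have H0 : {ae (lam \x mu)%E, forall z, A z}.
  apply/(ae_prod21 lam mu mA); apply: aeW => p.
  have := gE (-1) 0; rewrite sqrrN expr1n expr0n addr0 => /(_ erefl).
  move: (gE _ _ (slope_cos2Dsin2 p)).
  have F : Filter (almost_everywhere lam) := ae_filter_ringOfSetsType _.
  exact: filterS2.
have H1 : {ae lam, forall x, {ae mu, forall p, A (x, p)}} := ae_prod_ae12 H0.
pose B : set (MR * MR) := [set x | {ae mu, forall p, A (x, p)}].
have H2 : {ae @lebesgue2 R, forall p, B (slope_pt p.1 p.2)} := ae_slope_pt H1.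
pose B' : set (MR * MR) := [set p | B (slope_pt p.1 p.2)].
have H3 := @ae_prod_ae12 _ _ MR MR mu mu B' H2.
(* On the line of slope [t0] almost every point is good, that is, [g] keeps its value there under
   almost every rotation; [w] is [g] along this line. *)
have [t0] := ae_lebesgue_ex H3.
move=> H; pose w (r : MR) : MR := g (slope_pt t0 r).
have mt0 : measurable_fun setT (fun s : MR => slope_pt t0 s : MR * MR).
  by rewrite /slope_pt; apply: measurable_fun_pair; meas.
have mw : measurable_fun setT w by exact: (measurableT_comp mg mt0).
exists w; split => //.
(* The rotation by the slope [t0] is built into [C] so that [rot2_slope_pt] turns the point of slope
   [p] into a rotation of the point of slope [t0]; the invariance of [g] removes it afterwards. *)
pose C := [set y : MR * MR | g (rot2 (slope_cos t0) (slope_sin t0) y) = w (enorm y)].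
have mC : measurable C.
  apply: measurable_eqr_set.
  - exact: (measurableT_comp mg (measurable_rot2 _ _)).
  - exact: (measurableT_comp mw measurable_enorm).
suff : {ae @lebesgue2 R, forall y, C y}.
  move=> HC; have := gE _ _ (slope_cos2Dsin2 t0).
  by move: HC; apply: filterS2 => y /= -> ->.
apply/(ae_slope mC).
apply/(@ae_prod21 R _ _ MR MR mu mu [set p | C (slope_pt p.1 p.2)]).
  by rewrite -[X in measurable X]setTI; exact: measurable_slope_pt.
move: H; have F := ae_filter_ringOfSetsType mu; apply: filterS => s.
apply: filterS => p [/= Hr Hn].
rewrite /C /= -rot2_slope_pt Hr enorm_slope_pt /w.
(* For [s < 0] the half-turn leads from signed radius [s] to [- s = |s|]. *)
by have [//|s0] := ger0P s; rewrite -Hn -slope_ptN.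
Qed.

End radial_profile.

(** * Test functions *)

Section spans.
Context {R : realType} {V : normedModType R}.

(** Combinations of base functions with polynomial coefficients in linear forms [L]. As a linear
    form has the constant derivative [l v], the class is closed under differentiation as soon as
    derivatives of base functions lie in it, and smoothness follows by iteration. *)
Inductive poly_span (L B : set (V -> R)) : (V -> R) -> Prop :=
| span_base b : B b -> poly_span L B b
| span_mul l f : L l -> poly_span L B f -> poly_span L B (fun x => l x * f x)
| span_add f g : poly_span L B f -> poly_span L B g ->
    poly_span L B (fun x => f x + g x)
| span_scale k f : poly_span L B f -> poly_span L B (fun x => k * f x).

Variables L B : set (V -> R).
Hypothesis LP : forall l, L l -> continuous l /\ forall x v, is_derive x v l (l v).
Hypothesis BP : forall b, B b -> continuous b /\
  forall v, exists2 b', poly_span L B b' & forall x, is_derive x v b (b' x).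

Lemma span_derive f : poly_span L B f -> continuous f /\
  forall v, exists2 f', poly_span L B f' & forall x, is_derive x v f (f' x).
Proof.
elim=> [b /BP //|l {}f Ll sf [cf df]|{}f g sf [cf df] sg [cg dg]|k {}f sf [cf df]].
- have [cl dl] := LP Ll; split=> [x|v]; first exact: (continuousM (cl x) (cf x)).
  have [f' sf' df'] := df v.
  exists (fun x => l x * f' x + l v * f x).
    apply: (span_add (f := fun x => l x * f' x)); [exact: span_mul|exact: span_scale].
  move=> x; have H1 := dl x v; have H2 := df' x.
  rewrite (_ : _ + _ = l x *: f' x + f x *: l v); first exact: is_deriveM.
  by congr (_ + _); exact: mulrC.
- split=> [x|v]; first exact: (continuousD (cf x) (cg x)).
  have [f' sf' df'] := df v; have [g' sg' dg'] := dg v.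
  exists (fun x => f' x + g' x); first exact: span_add.
  by move=> x; exact: is_deriveD (df' x) (dg' x).
- split=> [x|v]; first by apply: (@continuousM _ _ (cst k)) (cf x); exact: cst_continuous.
  have [f' sf' df'] := df v; exists (fun x => k * f' x); first exact: span_scale.
  by move=> x; exact: is_deriveZ (df' x).
Qed.

Lemma span_smooth f : poly_span L B f -> smooth f.
Proof.
move=> sf s; suff : poly_span L B (iter_derive s f).
  move=> /span_derive[cg dg]; split => // x v.
  by have [g' _ /(_ x)[]] := dg v.
elim: s => //= v s /span_derive[_ /(_ v)[g' sg' dg']].
rewrite (_ : (fun x => _) = g')//.
by apply/funext => x; have [_ ->] := dg' x.
Qed.

Lemma span_support (Z : set V) : (forall b, B b -> forall x, Z x -> b x = 0) ->
  forall f, poly_span L B f -> forall x, Z x -> f x = 0.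
Proof.
move=> BZ f; elim=> [b /BZ //|l {}f _ _ IH|{}f g _ IHf _ IHg|k {}f _ IH] x Zx.
- by rewrite IH// mulr0.
- by rewrite IHf// IHg// addr0.
- by rewrite IH// mulr0.
Qed.

End spans.

Section derive_tools.
Context {R : realType}.

(** Directional derivatives become derivatives in one real variable, where the chain rule for
    [sqrt], powers and inverses applies. *)
Lemma is_derive_line {V : normedModType R} (f : V -> R) (x v : V) (d : R) :
  is_derive (0 : R) 1 (fun h : R => f (h *: v + x)) d -> is_derive x v f d.
Proof.
have E : (fun h : R => h^-1 *: (((fun h : R => f (h *: v + x)) \o shift 0) (h *: 1) - f (0 *: v + x)))
  = (fun h : R => h^-1 *: ((f \o shift x) (h *: v) - f x)).
  by apply/funext => h /=; rewrite /shift /= addr0 scale0r add0r [h *: 1]mulr1.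
by move=> [d1 d2]; split; [move: d1; rewrite /derivable E|move: d2; rewrite /derive E].
Qed.

Lemma is_derive1_scale (f : R -> R) (x v d : R) :
  is_derive x 1 f d -> is_derive x v f (v * d).
Proof.
move=> [/derivable1_diffP fx dE]; split; first exact: diff_derivable.
rewrite deriveE// -(mulr1 v) -[v * 1]/(v *: 1) linearZ /= -deriveE// dE.
by rewrite [_ *: 1]mulr1.
Qed.

Lemma is_derive1_continuous (f : R -> R) (x d : R) :
  is_derive x 1 f d -> {for x, continuous f}.
Proof. by move=> [/derivable1_diffP /differentiable_continuous]. Qed.

Lemma is_derive_sqr_bound (f : R -> R) (M x : R) : 0 <= M ->
  (forall y, `|f y| <= M * (y - x) ^+ 2) -> is_derive x 1 f 0.
Proof.
move=> M0 H; apply/is_derive1_caratheodory; exists (fun z => f z / (z - x)); split.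
- move=> z; have fx : f x = 0.
    by apply/eqP; rewrite -normr_le0 (le_trans (H x))// subrr expr0n mulr0.
  rewrite fx subr0; have [->|zx] := eqVneq z x; first by rewrite subrr mulr0.
  by rewrite divfK// subr_eq0.
- apply/cvgrPdist_le => e e0; rewrite subrr invr0 mulr0.
  near=> z; rewrite sub0r normrN normrM normfV.
  have [->|zx] := eqVneq z x; first by rewrite subrr normr0 invr0 mulr0 ltW.
  rewrite ler_pdivrMr ?normr_gt0 ?subr_eq0//.
  rewrite (le_trans (H z))// -real_normK ?num_real// expr2 mulrA ler_wpM2r//.
  have : `|z - x| <= e / (M + 1).
    by rewrite distrC; near: z; apply: cvgr_dist_le => //; rewrite divr_gt0// ltr_wpDl.
  rewrite ler_pdivlMr ?ltr_wpDl// mulrDr mulr1 => h; apply: le_trans h.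
  by rewrite mulrC lerDl.
- by rewrite subrr invr0 mulr0.
Unshelve. all: by end_near. Qed.

End derive_tools.

(** * Smooth bumps with support in an interval *)

Section bump.
Context {R : realType}.
Variables (a b c : R).
Hypothesis (c_gt0 : 0 < c).

Let d (x : R) : R := (x - a) * (b - x).

(** The powers of [1 / d] are included because differentiating [exp (- c / d)] produces them: the
    family is closed under derivation up to polynomial factors. As [c] tends to 0, the case [n = 0]
    tends to the indicator of the interval. *)
Definition bump_pow (n : nat) (x : R) : R :=
  if (a < x) && (x < b) then expR (- c * (d x)^-1) * (d x)^-1 ^+ n else 0.

Let d_gt0 x : a < x < b -> 0 < d x.
Proof. by move=> /andP[ax xb]; rewrite mulr_gt0// subr_gt0. Qed.

(** From [exp (- y) <= 1 / y] at [y = c / (m * d x)], raised to the power [m = n + 2]: two powers of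
    [d x] survive the division by [d x ^+ n]. *)
Lemma bump_pow_le n x : a < x < b ->
  `|bump_pow n x| <= (n.+2%:R / c) ^+ n.+2 * d x ^+ 2.
Proof.
move=> axb; rewrite /bump_pow axb; have dx := d_gt0 axb.
set m := n.+2; have m0 : 0 < m%:R :> R by rewrite ltr0n.
rewrite ger0_norm; last by rewrite mulr_ge0 ?expR_ge0// exprn_ge0// invr_ge0 ltW.
have -> : - c * (d x)^-1 = m%:R * - (c / (m%:R * d x)).
  by field; rewrite !gt_eqF.
rewrite expRM_natl expRN.
have y0 : 0 < c / (m%:R * d x) by rewrite divr_gt0// mulr_gt0.
have : (expR (c / (m%:R * d x)))^-1 ^+ m <= (m%:R / c * d x) ^+ m.
  have my0 : 0 < m%:R / c * d x by rewrite mulr_gt0// divr_gt0.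
  rewrite ler_pXn2r ?nnegrE ?invr_ge0 ?expR_ge0// ?(ltW my0)//.
  rewrite -[leRHS]invrK lef_pV2 ?posrE ?expR_gt0 ?invr_gt0//.
  rewrite (_ : _^-1 = c / (m%:R * d x)); last by field; rewrite !gt_eqF.
  by rewrite ltW// (lt_le_trans _ (expR_ge1Dx _))// ltrDr.
have dn0 : 0 <= (d x)^-1 ^+ n by rewrite exprn_ge0// invr_ge0 ltW.
move=> /(ler_wpM2r dn0) H. apply: (le_trans H).
rewrite exprMn -mulrA; apply: ler_wpM2l; first by rewrite exprn_ge0// divr_ge0// ltW.
by rewrite /m -addn2 exprD mulrAC -exprMn divff ?gt_eqF// expr1n mul1r.
Qed.

(** If [x] is outside and [y] inside the interval, one factor of [d y] is at most [|y - x|] and the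
    other at most [b - a]; the previous bound is then quadratic in [y - x]. *)
Lemma is_derive_bump_pow_out n x : ~~ (a < x < b) -> is_derive x 1 (bump_pow n) 0.
Proof.
move=> xab; pose M := (n.+2%:R / c) ^+ n.+2 * (b - a) ^+ 2.
apply: (@is_derive_sqr_bound _ _ M).
  by rewrite mulr_ge0 ?sqr_ge0// exprn_ge0// divr_ge0// ltW.
move=> y; have [yab|yab] := boolP (a < y < b); last first.
  rewrite /bump_pow (negbTE yab) normr0 mulr_ge0 ?sqr_ge0//.
  by rewrite mulr_ge0 ?sqr_ge0// exprn_ge0// divr_ge0// ltW.
apply: (le_trans (bump_pow_le n yab)); rewrite /M -[leRHS]mulrA; apply: ler_wpM2l.
  by rewrite exprn_ge0// divr_ge0// ltW.
have dy := ltW (d_gt0 yab); move/andP: yab => [ay yb]; rewrite -exprMn.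
have sqr_le (u v : R) : 0 <= u -> u <= v -> u ^+ 2 <= v ^+ 2.
  by move=> u0 uv; rewrite ler_pXn2r ?nnegrE// (le_trans u0).
move: xab; rewrite negb_and -!leNgt => /orP[xa|bx].
- apply: sqr_le => //; rewrite /d [leRHS]mulrC.
  by apply: ler_pM; lra.
- rewrite -(sqrrN ((b - a) * _)); apply: sqr_le => //; rewrite /d -mulrN.
  by apply: ler_pM; lra.
Qed.

Lemma is_derive_bump_pow_in n x : a < x < b -> is_derive x 1 (bump_pow n)
  ((a + b - 2 * x) * (c * bump_pow n.+2 x - n%:R * bump_pow n.+1 x)).
Proof.
move=> xab; have dx := d_gt0 xab.
have dd : is_derive x 1 d (a + b - 2 * x).
  have H := is_deriveM (is_deriveB (is_derive_id x 1) (is_derive_cst a x 1))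
    (is_deriveB (is_derive_cst b x 1) (is_derive_id x (1 : R))).
  apply: (is_derive_eq H).
  by rewrite !fctE /GRing.scale /=; ring.
have dV := is_deriveV (lt0r_neq0 dx) dd.
have dE : is_derive x 1 (fun y => expR (- c * (d y)^-1))
    (expR (- c * (d x)^-1) * (- c * (- (d x) ^- 2 * (a + b - 2 * x)))).
  have dcV := is_deriveZ (- c) dV.
  exact: (is_derive1_comp (is_derive_expR _) dcV).
have H := is_deriveM dE (is_deriveX n dV).
apply: (@near_eq_is_derive _ _ _
  (fun y => expR (- c * (d y)^-1) * (d y)^-1 ^+ n)); last first.
  rewrite [X in is_derive _ _ X _](_ : _ = (fun y => expR (- c * (d y)^-1)) *
      (fun y => (d y)^-1) ^+ n); last by apply/funext => y; rewrite !fctE.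
  apply: (is_derive_eq H); rewrite /bump_pow xab /GRing.scale /=.
  have dx0 : d x != 0 by rewrite gt_eqF.
  case: n {H} => [|n] /=; first by rewrite !fctE; field.
  by rewrite !fctE !exprS; field.
move/andP: xab => [ax xb]; near=> y.
rewrite /bump_pow ifT//; apply/andP; split.
- by near: y; exact: lt_nbhsr.
- by near: y; exact: lt_nbhsl.
Unshelve. all: by end_near. Qed.

Lemma is_derive_bump_pow (n : nat) (x : R) : is_derive x 1 (bump_pow n)
  ((a + b - 2 * x) * (c * bump_pow n.+2 x - n%:R * bump_pow n.+1 x)).
Proof.
have [/is_derive_bump_pow_in//|xab] := boolP (a < x < b).
apply: (is_derive_eq (is_derive_bump_pow_out n xab)).
by rewrite /bump_pow (negbTE xab) !mulr0 subrr mulr0.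
Qed.

Lemma smooth_bump_pow n : smooth (bump_pow n).
Proof.
pose L : set (R -> R) := [set id]; pose B : set (R -> R) := range bump_pow.
apply: (@span_smooth _ _ L B); last by apply: span_base; exists n.
  move=> _ ->; split => [x|x v]; first exact: cvg_id.
  by change (is_derive x v (id : R -> R) v); exact: is_derive_id.
move=> _ [m _ <-]; split.
  by move=> x; exact: is_derive1_continuous (is_derive_bump_pow m x).
move=> v; have Bm i : B (bump_pow i) by exists i.
exists (fun x => v * ((a + b) * (c * bump_pow m.+2 x + (- m%:R) * bump_pow m.+1 x)
   + (- 2) * (x * (c * bump_pow m.+2 x + (- m%:R) * bump_pow m.+1 x)))).
  have S : poly_span L B (fun x => c * bump_pow m.+2 x + (- m%:R) * bump_pow m.+1 x).
    by apply: span_add; apply: span_scale; apply: span_base.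
  apply: span_scale; apply: span_add; apply: span_scale => //.
  exact: (span_mul (l := id)).
move=> x; apply: (is_derive_eq (is_derive1_scale v (is_derive_bump_pow m x))).
by ring.
Qed.

Lemma bump_pow0_itv x : 0 <= bump_pow 0 x <= 1.
Proof.
rewrite /bump_pow; case: ifPn => xab; last by rewrite lexx ler01.
rewrite expr0 mulr1 expR_ge0 /= -expR0 ler_expR mulNr oppr_le0.
by rewrite mulr_ge0// ?invr_ge0 ?ltW// d_gt0.
Qed.

End bump.

(** * The fundamental lemma of the calculus of variations *)

Section fundamental_lemma.
Context {R : realType}.
Local Notation mu := (@lebesgue_measure R).
Local Notation MR := (measurableTypeR R).

Lemma bump_test_function (rho a b c : R) : 0 < c -> 0 < a -> b < rho ->
  test_function `]0, rho[ (bump_pow a b c 0).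
Proof.
move=> c0 a0 brho; split; first exact: smooth_bump_pow.
exists `[a, b]%classic; split; first exact: segment_compact.
- move=> x /=; rewrite !in_itv/= => /andP[ax xb].
  by rewrite (lt_le_trans a0 ax) (le_lt_trans xb brho).
- move=> x /=; rewrite in_itv/= /bump_pow => /negP xab; rewrite ifF//.
  by apply: contraNF xab => /andP[/ltW -> /ltW ->].
Qed.

Lemma continuous_test_function (D : set R) (phi : R -> R) :
  test_function D phi -> continuous phi.
Proof. by move=> [/(_ [::])[]]. Qed.

Lemma bump_cvg (a b x : R) :
  bump_pow a b n.+1%:R^-1 0 x @[n --> \oo] --> ((\1_`]a, b[ x) : R).
Proof.
rewrite indicE mem_setE in_itv/= /bump_pow.
have [xab|xab] := boolP ((a < x) && (x < b)); last exact: cvg_cst.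
rewrite -[X in _ --> X]expR0 (_ : (fun n => _) =
    (fun n : nat => expR (- (n.+1%:R^-1 * ((x - a) * (b - x))^-1)) : R)); last first.
  by apply/funext => n; rewrite expr0 mulr1 mulNr.
apply: continuous_cvg; first exact: continuous_expR.
rewrite -[X in _ --> X]oppr0; apply: cvgN.
rewrite -[X in _ --> X](mul0r ((x - a) * (b - x))^-1); apply: cvgMr_tmp.
exact: cvg_harmonic.
Qed.

(** Bumps converging to indicators make the integral of [h] vanish over every interval inside; a
    primitive is then constant, and Lebesgue differentiation gives [h = 0] almost everywhere. *)
Lemma test_orthogonal_ae0 (rho : R) (h : MR -> MR) :
  mu.-integrable `]0, rho[ (EFin \o h) ->
  (forall phi : R -> R, test_function `]0, rho[ phi ->
    \int[mu]_(x in `]0, rho[) (h x * phi x) = 0) ->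
  {ae mu, forall x : R, x \in `]0, rho[ -> h x = 0}.
Proof.
move=> ih h0; have mD : measurable (`]0, rho[%classic : set MR) by exact: measurable_itv.
have mh : measurable_fun `]0, rho[ h by move/integrableP: ih => [/measurable_EFinP].
have E0 (a b : R) : 0 < a -> b < rho -> (\int[mu]_(x in `]a, b[) (h x)%:E = 0)%E.
  move=> a0 brho; pose phi n := bump_pow a b (n.+1%:R^-1 : R) 0.
  have phiT n : test_function `]0, rho[ (phi n).
    by apply: bump_test_function => //; rewrite invr_gt0.
  have mphi n : measurable_fun `]0, rho[ (phi n : MR -> MR).
    apply: measurable_funTS; apply: continuous_measurable_fun.
    exact: continuous_test_function (phiT n).
  have phi01 n x : 0 <= phi n x <= 1 by apply: bump_pow0_itv; rewrite invr_gt0.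
  have dom n x : (`|(h x * phi n x)%:E| <= `|(h x)%:E|)%E.
    have /andP[p0 p1] := phi01 n x.
    by rewrite !abse_EFin lee_fin normrM (ger0_norm p0) ler_piMr.
  have m_n n : measurable_fun `]0, rho[ (fun x => (h x * phi n x)%:E).
    by apply/measurable_EFinP; exact: (measurable_funM mh (mphi n)).
  have mI : measurable_fun `]0, rho[ (fun x => (h x * \1_`]a, b[ x)%:E).
    by apply/measurable_EFinP; apply: (measurable_funM mh); exact: measurable_indic.
  have int0 n : (\int[mu]_(x in `]0%R, rho[) (h x * phi n x)%:E = 0)%E.
    have := h0 _ (phiT n); rewrite /Rintegral => /eqP.
    rewrite fine_eq0; first by move/eqP.
    apply: integrable_fin_num => //; apply: (le_integrable mD (m_n n) _ ih).
    by move=> x Dx; exact: dom.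
  have ff : {ae mu, forall x, (`]0, rho[%classic : set MR) x ->
      (fun n => (h x * phi n x)%:E) @ \oo --> (h x * \1_`]a, b[ x)%:E}.
    apply: aeW => x Dx; apply: cvg_EFin; first by apply: nearW.
    by apply: cvgMl_tmp; exact: bump_cvg.
  have fg : {ae mu, forall x (n : nat), (`]0, rho[%classic : set MR) x ->
      (`|(h x * phi n x)%:E| <= `|(h x)%:E|)%E}.
    by apply: aeW => x n _; exact: dom.
  have [Y1 Y2 HH] := dominated_convergence mD m_n mI ff (integrable_abse ih) fg.
  move: HH; rewrite (_ : (fun n => _) = cst 0%E); last by apply/funext => n; exact: int0.
  move=> /(cvg_lim (@ereal_hausdorff _)); rewrite lim_cst// => E0.
  have DE : (`]0, rho[%classic : set MR) `&` `]a, b[%classic = `]a, b[%classic.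
    apply/setIidPr => x /=; rewrite !in_itv/= => /andP[ax xb].
    by rewrite (lt_trans a0 ax) (lt_trans xb brho).
  rewrite [RHS]E0 -DE integral_mkcondr DE; apply: eq_integral => x _.
  by rewrite patchE indicE; case: (x \in _); rewrite /= ?mulr1 ?mulr0.
(* Extension by 0 makes the primitive [F] start at minus infinity, as the differentiation theorem
   requires. *)
pose H : MR -> MR := h \_ `]0, rho[.
have iH : mu.-integrable setT (EFin \o H).
  have -> : EFin \o H = ((EFin \o h) \_ (`]0, rho[%classic : set MR) : MR -> \bar R).
    by apply/funext => x; rewrite /H /= !patchE; case: ifP.
  by apply/integrable_restrict; rewrite ?setTI.
have locH : locally_integrable setT H by exact: integrable_locally.
pose F y := \int[mu]_(t in `]-oo, y]) (H t).
have Fcst y z : 0 < y -> y < z -> z < rho -> F z = F y.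
  move=> y0 yz zrho; apply/eqP; rewrite -subr_eq0; apply/eqP.
  rewrite /F Rintegral_itvB//; last by rewrite bnd_simp ltW.
    rewrite -Rintegral_itv_bndo_bndc; last first.
      exact: integrableS iH.
    rewrite /Rintegral (eq_integral (fun t => (h t)%:E)) ?E0//.
    move=> t; rewrite inE/= in_itv/= => /andP[yt tz].
    by rewrite /H patchE mem_set//= in_itv/= (lt_trans y0 yt) (lt_trans tz zrho).
  exact: integrableS iH.
have : {ae mu, forall x, derivable F x 1 /\ derive1 F x = H x}.
  by apply: FTC1Ny => // y; exact: integrableS iH.
have FF := ae_filter_ringOfSetsType mu; apply: filterS => x [_ FH] x0rho.
have -> : h x = H x by rewrite /H patchE mem_set.
rewrite -FH derive1E (near_eq_derive _ (g := cst (F x))) ?derive_cst//.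
move: x0rho; rewrite in_itv/= => /andP[x0 xrho].
near=> y; have y0 : 0 < y by near: y; exact: lt_nbhsr.
have yrho : y < rho by near: y; exact: lt_nbhsl.
have [yx|xy|->//] := ltgtP y x; rewrite /=; last exact: Fcst.
by apply/esym; exact: Fcst.
Unshelve. all: by end_near. Qed.

End fundamental_lemma.

(** * Test functions on the disk with radial factors *)

Section radial_test_functions.
Context {R : realType}.

Lemma continuous_fst2 : continuous (fst : R * R -> R).
Proof. by move=> x; apply: cvg_fst. Qed.

Lemma continuous_snd2 : continuous (snd : R * R -> R).
Proof. by move=> x; apply: cvg_snd. Qed.

Lemma continuous_enorm : continuous (@enorm R).
Proof.
have sqc (f : R * R -> R) : continuous f -> continuous (fun x => f x ^+ 2).
  by move=> cf x; exact: (continuousM (cf x) (cf x)).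
have sc : continuous (fun x : R * R => x.1 ^+ 2 + x.2 ^+ 2).
  by move=> x; exact: (continuousD (sqc _ continuous_fst2 x) (sqc _ continuous_snd2 x)).
by move=> x; exact: (continuous_comp (sc x) (@sqrt_continuous R _)).
Qed.

Lemma is_derive_enorm (x v : R * R) : 0 < enorm x ->
  is_derive (0 : R) 1 (fun h : R => enorm (h *: v + x))
    ((x.1 * v.1 + x.2 * v.2) / enorm x).
Proof.
move=> x0.
have lin (a b : R) : is_derive (0 : R) 1 (fun h : R => (h * a + b) ^+ 2) (2 * b * a).
  have H1 : is_derive (0 : R) 1 (fun h : R => h * a + b) (a : R).
    apply: (is_derive_eq (is_deriveD (is_deriveM (is_derive_id (0 : R) (1 : R))
      (is_derive_cst a (0 : R) (1 : R))) (is_derive_cst b (0 : R) (1 : R)))).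
    by rewrite /GRing.scale /= mul0r mulr1 add0r addr0.
  apply: (is_derive_eq (is_deriveM H1 H1)).
  by rewrite /GRing.scale /= mul0r add0r; ring.
have q : is_derive (0 : R) 1
    (fun h : R => (h * v.1 + x.1) ^+ 2 + (h * v.2 + x.2) ^+ 2)
    (2 * x.1 * v.1 + 2 * x.2 * v.2).
  exact: is_deriveD (lin _ _) (lin _ _).
set g := (fun h : R => _) in q.
have g0 : g 0 = enorm x ^+ 2 by rewrite /g !mul0r !add0r enorm_sqr.
have q0 : 0 < g 0 by rewrite g0 exprn_gt0.
have H := is_derive1_comp (is_derive1_sqrt q0) q.
rewrite [X in is_derive _ _ X _](_ : _ = Num.sqrt \o g)//.
apply: (is_derive_eq H); rewrite g0 sqrtr_sqr gtr0_norm//.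
by field; rewrite gt_eqF.
Qed.

Section test1.
Variables (rho : R) (phi : R -> R).
Hypothesis phiT : test_function `]0, rho[ phi.

Lemma test_derive1 (r : R) : is_derive r 1 phi ('D_1 phi r).
Proof. by have [/(_ [::])[_ /(_ r 1)/derivableP]] := phiT. Qed.

Lemma test_near0 : \forall r \near (0 : R), phi r = 0.
Proof.
have [_ [K [cK KD phi0]]] := phiT.
have : nbhs (0 : R) (~` K).
  apply: open_nbhs_nbhs; split; first exact: (closed_openC (compact_closed (@Rhausdorff R) cK)).
  by move=> /KD /=; rewrite in_itv/= ltxx.
by apply: filterS => r /phi0.
Qed.

Lemma test_at0 : phi 0 = 0.
Proof. exact: nbhs_singleton test_near0. Qed.

Lemma test_function_derive : test_function `]0, rho[ ('D_1 phi).
Proof.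
have [sphi [K [cK KD phi0]]] := phiT; split.
  move=> s; have := sphi (rcons s 1).
  by rewrite /iter_derive -cats1 foldr_cat.
exists K; split => // r nK; rewrite -(derive_cst (0 : R) r (1 : R)).
apply: near_eq_derive.
have : nbhs r (~` K) by apply: open_nbhs_nbhs; split => //; exact: (closed_openC (compact_closed (@Rhausdorff R) cK)).
by apply: filterS => y /phi0.
Qed.

End test1.

(** The powers of [1 / |x|] make the family stable: the gradient is [x] times
    [rad phi' n.+1 - n * rad phi n.+2]. There is no singularity at the origin, since [phi] vanishes
    near 0. *)
Definition rad (phi : R -> R) (n : nat) (x : R * R) : R :=
  phi (enorm x) / enorm x ^+ n.

Variable rho : R.

Definition coords : set (R * R -> R) := [set l | l = fst \/ l = snd].

Definition rads : set (R * R -> R) :=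
  [set b | exists phi n, test_function `]0, rho[ phi /\ b = rad phi n].

Lemma rad_near0 phi n : test_function `]0, rho[ phi ->
  \forall x \near ((0, 0) : R * R), rad phi n x = 0.
Proof.
move=> phiT; have e0 : @enorm R (0, 0) = 0 by rewrite /enorm expr0n addr0 sqrtr0.
have : \forall x \near ((0, 0) : R * R), phi (enorm x) = 0.
  have H : @enorm R @ ((0, 0) : R * R) --> (0 : R).
    by have := @continuous_enorm ((0, 0) : R * R); rewrite /continuous_at e0.
  exact: (H _ (test_near0 phiT)).
by apply: filterS => x; rewrite /rad => ->; rewrite mul0r.
Qed.

Lemma continuous_rad phi n : test_function `]0, rho[ phi -> continuous (rad phi n).
Proof.
move=> phiT x; have [/enorm_eq0 ->|x0] := eqVneq (enorm x) 0.
  have H := rad_near0 n phiT; rewrite /continuous_at (nbhs_singleton H).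
  by apply: cvg_near_cst.
have c1 := continuous_comp (@continuous_enorm x) (continuous_test_function phiT (x := _)).
have c2 := continuous_comp (@continuous_enorm x) (@exprn_continuous R n _).
by apply: (cvgM c1); apply: (cvgV _ c2); rewrite expf_neq0.
Qed.

Lemma is_derive_rad phi n (x v : R * R) : test_function `]0, rho[ phi ->
  is_derive x v (rad phi n) ((x.1 * v.1 + x.2 * v.2) *
    (rad ('D_1 phi) n.+1 x - n%:R * rad phi n.+2 x)).
Proof.
move=> phiT; have [e0|x0] := eqVneq (enorm x) 0.
  have xE := enorm_eq0 e0; rewrite /rad e0 (test_at0 phiT) (test_at0 (test_function_derive phiT)).
  rewrite !mul0r mulr0 subr0 mulr0 xE.
  apply: (near_eq_is_derive (f := cst 0)).
  by apply: filterS (rad_near0 n phiT) => y; rewrite /rad => ->.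
have {}x0 : 0 < enorm x by rewrite lt_def x0 enorm_ge0.
apply: is_derive_line.
have dE := is_derive_enorm v x0.
have E0 : enorm (0 *: v + x) = enorm x by rewrite scale0r add0r.
have d1 : is_derive (0 : R) 1 (fun h : R => phi (enorm (h *: v + x))) _ :=
  is_derive1_comp (test_derive1 phiT _) dE.
have nz : enorm (0 *: v + x) != 0 by rewrite E0 gt_eqF.
have d2 := is_deriveX n (is_deriveV (f := fun h : R => enorm (h *: v + x)) nz dE).
rewrite [X in is_derive _ _ X _](_ : _ = (fun h : R => phi (enorm (h *: v + x))) *
    (fun h : R => (enorm (h *: v + x))^-1) ^+ n); last first.
  by apply/funext => h; rewrite /rad !fctE exprVn.
apply: (is_derive_eq (is_deriveM d1 d2)); rewrite !fctE E0 /rad /GRing.scale /=.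
have nz' : enorm x != 0 by rewrite gt_eqF.
by case: n {d2} => [|n] /=; rewrite ?exprVn ?exprS; field; rewrite ?expf_neq0.
Qed.

Lemma coordsP l : coords l -> continuous l /\ forall x v, is_derive x v l (l v).
Proof.
have H (l' : R * R -> R) (y w : R * R) : (forall h : R, l' (h *: w + y) = h * l' w + l' y) ->
    is_derive y w l' (l' w).
  move=> lE; apply: is_derive_line; rewrite (_ : (fun h => _) = (fun h => h * l' w + l' y)).
    apply: (is_derive_eq (is_deriveD (is_deriveM (is_derive_id (0 : R) (1 : R))
      (is_derive_cst (l' w) (0 : R) (1 : R))) (is_derive_cst (l' y) (0 : R) (1 : R)))).
    by rewrite /GRing.scale /= mul0r mulr1 add0r addr0.
  by apply/funext.
by move=> [->|->]; split; [exact: continuous_fst2| |exact: continuous_snd2|] => x v; apply: H.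
Qed.

Lemma radsP b : rads b -> continuous b /\
  forall v, exists2 b', poly_span coords rads b' & forall x, is_derive x v b (b' x).
Proof.
move=> [phi [n [phiT ->]]]; split; first exact: continuous_rad.
move=> v; pose g x := rad ('D_1 phi) n.+1 x + (- n%:R) * rad phi n.+2 x.
have sg : poly_span coords rads g.
  apply: (span_add (f := rad ('D_1 phi) n.+1)).
    apply: span_base; exists ('D_1 phi), n.+1; split => //; exact: test_function_derive.
  by apply: span_scale; apply: span_base; exists phi, n.+2.
exists (fun x => v.1 * (x.1 * g x) + v.2 * (x.2 * g x)).
  apply: (@span_add _ _ _ _ (fun x : R * R => v.1 * (x.1 * g x))
    (fun x : R * R => v.2 * (x.2 * g x))); apply: span_scale.
    by apply: (span_mul (l := fst)) => //; left.
  by apply: (span_mul (l := snd)) => //; right.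
move=> x; apply: (is_derive_eq (is_derive_rad n x v phiT)).
by rewrite /g; ring.
Qed.

Lemma compact_enorm_preimage (K : set R) : compact K -> K `<=` `]0, rho[ ->
  compact (@enorm R @^-1` K).
Proof.
move=> cK KD; apply: (@subclosed_compact _ _ (`[- rho, rho]%classic `*` `[- rho, rho]%classic)).
- apply: preimage_closed; first by move=> x _; exact: continuous_enorm.
  exact: (compact_closed (@Rhausdorff R) cK).
- by apply: compact_setX; exact: segment_compact.
- move=> x /KD /=; rewrite in_itv/= => /andP[x0 xrho].
  have le (y : R) : y ^+ 2 <= x.1 ^+ 2 + x.2 ^+ 2 -> - rho <= y <= rho.
    move=> H; rewrite -ler_norml -sqrtr_sqr; apply: le_trans (ltW xrho).
    exact: ler_wsqrtr.
  by split; rewrite /= in_itv/=; apply: le; rewrite ?lerDl ?lerDr sqr_ge0.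
Qed.

Lemma enorm_disk x : disk rho x = (enorm x < rho) :> Prop.
Proof. by []. Qed.

(** All base functions share one [phi], so one compact set carries the support of the whole
    combination. Smoothness uses the larger class [rads], which also contains the derivatives of
    [phi]. *)
Lemma span_test f (phi : R -> R) : test_function `]0, rho[ phi ->
  poly_span coords (fun b => exists n, b = rad phi n) f ->
  test_function (disk rho) f.
Proof.
move=> phiT sf; have [_ [K [cK KD phi0]]] := phiT; split.
  apply: (span_smooth coordsP radsP).
  elim: sf => [b [n ->]|l {}f Ll _ IH|{}f g _ IHf _ IHg|k {}f _ IH].
  - by apply: span_base; exists phi, n.
  - exact: span_mul.
  - exact: span_add.
  - exact: span_scale.
exists (@enorm R @^-1` K); split; first exact: compact_enorm_preimage.
  by move=> x /KD /=; rewrite in_itv/= enorm_disk => /andP[].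
apply: (span_support (B := fun b => exists n, b = rad phi n) (L := coords)) => //.
by move=> b [n ->] x nK; rewrite /rad phi0// mul0r.
Qed.

End radial_test_functions.

(** * Circle integrals *)

Section polar.
Context {R : realType}.
Local Notation mu := (@lebesgue_measure R).
Local Notation MR := (measurableTypeR R).
Implicit Types (h : MR * MR -> MR) (w phi : MR -> MR).

(* The integrand of [h] in signed polar coordinates, folded onto [r > 0]:
   its integral over the slope [t] is [r] times the integral of [h] over
   the circle of radius [r]. *)
Definition polar_pull h (p : MR * MR) : MR :=
  (h (slope_pt p.2 p.1) + h (slope_pt p.2 (- p.1))) *
    (slope_wt p.2 p.1 * (0 < p.1)%R%:R).

Definition circle_int h (r : MR) : MR := \int[mu]_t polar_pull h (r, t).

Lemma measurable_gt0 : measurable_fun setT (fun p : MR => (0 < p)%R%:R : MR).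
Proof.
rewrite (_ : (fun _ => _) = \1_(`]0, +oo[%classic : set MR)); first exact: measurable_indic.
by apply/funext => x; rewrite indicE mem_setE in_itv/= andbT.
Qed.

Lemma measurable_slope_pt_swap :
  measurable_fun setT (fun p : MR * MR => slope_pt p.2 p.1 : MR * MR).
Proof. rewrite /slope_pt; meas. Qed.

Lemma measurable_slope_pt_swapN :
  measurable_fun setT (fun p : MR * MR => slope_pt p.2 (- p.1) : MR * MR).
Proof. rewrite /slope_pt; meas. Qed.

Lemma measurable_polar_pull h : measurable_fun setT h ->
  measurable_fun setT (polar_pull h).
Proof.
move=> mh; rewrite /polar_pull; apply: measurable_funM.
  apply: measurable_funD.
    exact: (measurableT_comp mh measurable_slope_pt_swap).
  exact: (measurableT_comp mh measurable_slope_pt_swapN).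
apply: measurable_funM; first by rewrite /slope_wt; meas.
exact: (measurableT_comp measurable_gt0 (@measurable_fst _ _ MR MR)).
Qed.

Lemma polar_pull_ge0 h p : (forall x, 0 <= h x) -> 0 <= polar_pull h p.
Proof.
by move=> h0; rewrite /polar_pull mulr_ge0 ?addr_ge0 ?h0// mulr_ge0 ?slope_wt_ge0.
Qed.

Lemma slope_wtN (t s : R) : slope_wt t (- s) = slope_wt t s.
Proof. by rewrite /slope_wt normrN. Qed.

(** The signed radius is folded: the substitution [s := - s] brings the half-line [s < 0] onto
    [s > 0]. *)
Lemma ge0_integral_polar_pull h : measurable_fun setT h -> (forall x, 0 <= h x) ->
  (\int[lebesgue2]_x (h x)%:E = \int[(mu \x mu)%E]_p (polar_pull h p)%:E)%E.
Proof.
move=> mh h0; have mp := measurable_polar_pull mh.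
have mhE : measurable_fun setT (fun x => (h x)%:E) by exact/measurable_EFinP.
have mg : measurable_fun setT (fun p : MR * MR =>
    (h (slope_pt p.1 p.2) * slope_wt p.1 p.2)%:E).
  apply/measurable_EFinP; apply: measurable_funM; last exact: measurable_slope_wt.
  exact: (measurableT_comp mh (@measurable_slope_pt R)).
have g0 p : (0 <= (h (slope_pt p.1 p.2) * slope_wt p.1 p.2)%:E :> \bar R)%E.
  by rewrite lee_fin mulr_ge0// slope_wt_ge0.
rewrite (ge0_integral_slope mhE); last by move=> x; rewrite lee_fin.
rewrite (ge0_integral_lebesgue2_21 mg g0).
rewrite (fubini_tonelli1 (fun p => (polar_pull h p)%:E)); last 2 first.
- exact/measurable_EFinP.
- by move=> p; rewrite lee_fin polar_pull_ge0.
rewrite /fubini_F /=.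
pose G (s : MR) : \bar R := (\int[mu]_t (h (slope_pt t s) * slope_wt t s)%:E)%E.
have mG : measurable_fun setT G.
  exact: (measurable_fun_fubini_tonelli_G (fun p : MR * MR => (h (slope_pt p.1 p.2) * slope_wt p.1 p.2)%:E)).
have G0 s : (0 <= G s)%E by apply: integral_ge0 => t _; exact: (g0 (t, s)).
have GN : measurable_fun setT (fun s : MR => G (- s)).
  by apply: (measurableT_comp mG); exact: measurable_funN.
have mlt0 : measurable_fun setT (fun s : MR => ((s < 0)%R%:R)%:E : \bar R).
  apply/measurable_EFinP.
  rewrite (_ : (fun _ => _) = (fun p : MR => (0 < p)%R%:R) \o (fun s : MR => - s : MR)).
    by apply: (measurableT_comp measurable_gt0); exact: measurable_funN.
  by apply/funext => s /=; rewrite oppr_gt0.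
have mgt0 : measurable_fun setT (fun s : MR => ((0 < s)%R%:R)%:E : \bar R).
  by apply/measurable_EFinP; exact: measurable_gt0.
(* At [s = 0] neither indicator is 1, but the weight [|s|] makes [G] vanish there. *)
have Gs s : (G s = G s * ((0 < s)%R%:R)%:E + G s * ((s < 0)%R%:R)%:E)%E.
  have [s0|s0|->] := ltrgtP s 0; rewrite ?mule1 ?mule0 ?adde0 ?add0e//.
  rewrite /G; apply: integral0_eq => t _.
  by rewrite /slope_wt normr0 mul0r mulr0.
transitivity (\int[mu]_s G s)%E; first by [].
rewrite (eq_integral _ _ (fun s _ => Gs s)).
rewrite ge0_integralD//; last 4 first.
- by move=> s _; rewrite mule_ge0// lee_fin.
- exact: emeasurable_funM.
- by move=> s _; rewrite mule_ge0// lee_fin.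
- exact: emeasurable_funM.
rewrite [X in (_ + X)%E](@ge0_integral_affine _ (-1) 0); last 3 first.
- by rewrite oppr_eq0 oner_eq0.
- exact: emeasurable_funM.
- by move=> s; rewrite mule_ge0// lee_fin.
rewrite -ge0_integralD//; last 4 first.
- by move=> s _; rewrite mule_ge0// lee_fin.
- exact: emeasurable_funM.
- by move=> s _; rewrite !mule_ge0// lee_fin.
- apply: emeasurable_funM => //.
  exact: (measurableT_comp (emeasurable_funM mG mlt0) (@measurable_affine R (-1) 0)).
apply: eq_integral => s _; rewrite mulN1r addr0 normrN1 mule1 oppr_lt0.
have mGs : measurable_fun setT (fun t : MR => (h (slope_pt t s) * slope_wt t s)%:E).
  exact: (measurableT_comp mg (measurable_fun_pair (@measurable_id _ MR _) (measurable_cst s))).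
have mGNs : measurable_fun setT (fun t : MR => (h (slope_pt t (- s)) * slope_wt t (- s))%:E).
  exact: (measurableT_comp mg (measurable_fun_pair (@measurable_id _ MR _) (measurable_cst (- s : MR)))).
rewrite -ge0_muleDl ?G0// /G -ge0_integralD//; last 2 first.
- by move=> t _; exact: (g0 (t, s)).
- by move=> t _; exact: (g0 (t, - s)).
rewrite -ge0_integralZr//; last 2 first.
- exact: emeasurable_funD.
- by move=> t _; rewrite adde_ge0//; [exact: (g0 (t, s))|exact: (g0 (t, - s))].
apply: eq_integral => t _; rewrite /polar_pull /= -EFinD -EFinM slope_wtN; congr _%:E.
by rewrite -mulrDl mulrA.
Qed.

End polar.

Section circle_integrals.
Context {R : realType}.
Local Notation mu := (@lebesgue_measure R).
Local Notation MR := (measurableTypeR R).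
Implicit Types (h : MR * MR -> MR) (w phi : MR -> MR).

Lemma polar_pullB h1 h2 p :
  polar_pull (fun x => h1 x - h2 x) p = polar_pull h1 p - polar_pull h2 p.
Proof. by rewrite /polar_pull; ring. Qed.

Lemma polar_pull_norm h p : `|polar_pull h p| <= polar_pull (fun x => `|h x|) p.
Proof.
have wt0 : 0 <= slope_wt p.2 p.1 * (0 < p.1)%R%:R by rewrite mulr_ge0 ?slope_wt_ge0.
by rewrite /polar_pull normrM (ger0_norm wt0); apply: (ler_wpM2r wt0); exact: ler_normD.
Qed.

Lemma integrable_polar_pull h : measurable_fun setT h ->
  (@lebesgue2 R).-integrable setT (EFin \o h) ->
  (mu \x mu)%E.-integrable setT (EFin \o polar_pull h).
Proof.
move=> mh /integrableP[_ fin]; have mp := measurable_polar_pull mh.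
have mn : measurable_fun setT (fun x => `|h x| : MR).
  exact: (measurableT_comp (@normr_measurable R setT) mh).
apply/integrableP; split; first exact/measurable_EFinP.
apply: le_lt_trans fin.
rewrite [leRHS](_ : _ = \int[(mu \x mu)%E]_p (polar_pull (fun x => `|h x|) p)%:E)%E; last first.
  by rewrite -ge0_integral_polar_pull.
apply: ge0_le_integral => //.
- apply/measurable_EFinP; exact: (measurableT_comp (@normr_measurable R setT) mp).
- by apply/measurable_EFinP; exact: measurable_polar_pull.
- by move=> p _; rewrite lee_fin polar_pull_norm.
Qed.

Lemma integral_polar_pull h : measurable_fun setT h ->
  (@lebesgue2 R).-integrable setT (EFin \o h) ->
  (\int[lebesgue2]_x (h x)%:E = \int[(mu \x mu)%E]_p (polar_pull h p)%:E)%E.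
Proof.
move=> mh ih.
pose hp : MR * MR -> MR := h^\+; pose hn : MR * MR -> MR := h^\-.
have mhp : measurable_fun setT hp by exact: measurable_funrpos.
have mhn : measurable_fun setT hn by exact: measurable_funrneg.
have ip : (@lebesgue2 R).-integrable setT (EFin \o hp) by exact: integrable_funrpos.
have im : (@lebesgue2 R).-integrable setT (EFin \o hn) by exact: integrable_funrneg.
have hE x : h x = hp x - hn x.
  by rewrite /hp /hn /funrpos /funrneg /= /Num.max; do 2 case: ifP => ?; lra.
have Ep := ge0_integral_polar_pull mhp (funrpos_ge0 h).
have En := ge0_integral_polar_pull mhn (funrneg_ge0 h).
transitivity (\int[@lebesgue2 R]_(x in setT) ((EFin \o hp) x - (EFin \o hn) x))%E.
  by apply: eq_integral => x _; rewrite /= -EFinB -hE.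
rewrite (integralB measurableT ip im) [X in (X - _)%E]Ep [X in (_ - X)%E]En.
have ipp := integrable_polar_pull mhp ip; have ipn := integrable_polar_pull mhn im.
rewrite -[LHS](integralB measurableT ipp ipn).
apply: eq_integral => p _; rewrite /= -EFinB -polar_pullB; congr _%:E.
by congr polar_pull; apply/funext => x; rewrite -hE.
Qed.

Lemma ae_integrable_polar_pull h : measurable_fun setT h ->
  (@lebesgue2 R).-integrable setT (EFin \o h) ->
  {ae mu, forall r : MR, mu.-integrable setT (fun t => (polar_pull h (r, t))%:E)}.
Proof.
by move=> mh ih; exact: (ae_integrable1 (integrable_polar_pull mh ih)).
Qed.

Lemma measurable_circle_int h : measurable_fun setT h ->
  (@lebesgue2 R).-integrable setT (EFin \o h) ->
  measurable_fun setT (circle_int h).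
Proof.
move=> mh ih; have := measurable_fubini_F (integrable_polar_pull mh ih).
by move=> H; exact: (measurableT_comp (fine_measurable measurableT) H).
Qed.

Lemma integral_circle_int h : measurable_fun setT h ->
  (@lebesgue2 R).-integrable setT (EFin \o h) ->
  mu.-integrable setT (EFin \o circle_int h) /\
  \int[lebesgue2]_x h x = \int[mu]_r circle_int h r.
Proof.
move=> mh ih; have ip := integrable_polar_pull mh ih.
have iF := integrable_fubini_F ip; have mc := measurable_circle_int mh ih.
have mcE : measurable_fun setT (EFin \o circle_int h) by exact/measurable_EFinP.
(* [circle_int] is real-valued and reads 0 where the inner integral is infinite; integrability
   confines this to a null set of radii. *)
have ae : {ae mu, forall r, setT r -> (circle_int h r)%:E = fubini_F mu (EFin \o polar_pull h) r}.
  have := integrable_ae measurableT iF.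
  have FF := ae_filter_ringOfSetsType mu; apply: filterS => r /(_ I) fr _.
  by rewrite /circle_int /Rintegral fineK.
split.
  apply: le_integrable iF => // r _.
  have le_fine (x : \bar R) : (`|(fine x)%:E| <= `|x|)%E.
    by case: x => [z| |] //=; rewrite normr0 leey.
  exact: le_fine.
rewrite /Rintegral integral_polar_pull// -(integral12_prod_meas1 ip).
have mF : measurable_fun setT (fubini_F mu (EFin \o polar_pull h)).
  exact: (measurable_fubini_F ip).
congr fine; apply/esym; apply: ae_eq_integral; [exact: measurableT|exact: mcE|exact: mF|exact: ae].
Qed.

(** The length of the unit circle; the factor 2 counts the two half circles above the line of
    slopes. *)
Definition circle_len : R := \int[mu]_t (2 / (1 + t ^+ 2)).

Lemma slope_density_integral :
  mu.-integrable setT (fun t : MR => (2 / (1 + t ^+ 2))%:E) /\ 0 < circle_len.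
Proof.
have E : (\int[mu]_t (2 / (1 + t ^+ 2))%:E = (2 * pi)%:E)%E.
  under eq_integral do rewrite EFinM.
  have mo : measurable_fun setT (fun t : MR => (oneDsqr t)^-1 : MR).
    by apply: continuous_measurable_fun; exact: continuous_oneDsqrV.
  rewrite ge0_integralZl//; last 2 first.
  - exact/measurable_EFinP.
  - by move=> x _; rewrite lee_fin invr_ge0 addr_ge0// sqr_ge0.
  rewrite (@ge0_symfun_integralT R (fun t => (oneDsqr t)^-1)); last 3 first.
  - by move=> x; rewrite invr_ge0 /oneDsqr addr_ge0// sqr_ge0.
  - exact: continuous_oneDsqrV.
  - by move=> x /=; rewrite /oneDsqr sqrrN.
  have -> : [set x : R | 0 <= x] = `[0, +oo[%classic by rewrite set_itvcy.
  by rewrite integral0y_oneDsqr -!EFinM; congr EFin; field.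
have m : measurable_fun setT (fun t : MR => 2 / (1 + t ^+ 2) : MR) by meas.
split; last by rewrite /circle_len /Rintegral E /= mulr_gt0// pi_gt0.
apply/integrableP; split; first exact/measurable_EFinP.
under eq_integral do rewrite abse_EFin ger0_norm ?divr_ge0 ?addr_ge0 ?sqr_ge0//.
by rewrite E ltry.
Qed.

Lemma polar_pull_radial h w r t :
  polar_pull (fun x => h x * w (enorm x)) (r, t) = polar_pull h (r, t) * w r.
Proof.
rewrite /polar_pull /=; have [r0|_] := boolP (0 < r); last by rewrite !mulr0 mul0r.
by rewrite !enorm_slope_pt normrN gtr0_norm//; ring.
Qed.

Lemma circle_int_radial h w : measurable_fun setT h ->
  (@lebesgue2 R).-integrable setT (EFin \o h) ->
  {ae mu, forall r, circle_int (fun x => h x * w (enorm x)) r = circle_int h r * w r}.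
Proof.
move=> mh ih; have := ae_integrable_polar_pull mh ih.
have FF := ae_filter_ringOfSetsType mu; apply: filterS => r ir.
rewrite /circle_int; under eq_Rintegral do rewrite polar_pull_radial.
by rewrite RintegralZr.
Qed.

Lemma circle_int_enorm w (r : R) : 0 < r ->
  circle_int (fun x => w (enorm x)) r = circle_len * (r * w r).
Proof.
move=> r0; have [il _] := slope_density_integral.
rewrite /circle_int /circle_len -RintegralZr//.
apply: eq_Rintegral => t _; rewrite /polar_pull /= r0 !enorm_slope_pt normrN gtr0_norm//.
by rewrite /slope_wt gtr0_norm// mulr1; ring.
Qed.

(* Cauchy-Schwarz, from the nonnegativity of the circle integral of [(h - l) ^ 2]
   at the minimizing [l]. *)
Lemma circle_int_sqr h : measurable_fun setT h ->
  (@lebesgue2 R).-integrable setT (EFin \o h) ->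
  (@lebesgue2 R).-integrable setT (EFin \o (fun x => h x ^+ 2)) ->
  {ae mu, forall r : R, 0 < r ->
    circle_int h r ^+ 2 <= circle_len * r * circle_int (fun x => h x ^+ 2) r}.
Proof.
move=> mh ih ih2; have mh2 : measurable_fun setT (fun x => h x ^+ 2 : MR).
  exact: measurable_funX.
have := ae_integrable_polar_pull mh2 ih2; have := ae_integrable_polar_pull mh ih.
have FF := ae_filter_ringOfSetsType mu; apply: filterS2 => r ir ir2 r0.
have [il c0] := slope_density_integral.
set a := circle_int h r; set b := circle_int _ r; set c := circle_len.
have key (l : R) : 0 <= b - 2 * l * a + l ^+ 2 * (c * r).
  have -> : b - 2 * l * a + l ^+ 2 * (c * r) =
      \int[mu]_t (polar_pull (fun x => h x ^+ 2) (r, t) - 2 * l * polar_pull h (r, t)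
        + l ^+ 2 * r * (2 / (1 + t ^+ 2))).
    have i2 : mu.-integrable setT (EFin \o (fun t => 2 * l * polar_pull h (r, t))).
      exact: (integrableZl measurableT (2 * l) ir).
    have i3 : mu.-integrable setT (EFin \o (fun t : MR => l ^+ 2 * r * (2 / (1 + t ^+ 2)))).
      exact: (integrableZl measurableT (l ^+ 2 * r) il).
    have i1 : mu.-integrable setT (EFin \o (fun t => polar_pull (fun x => h x ^+ 2) (r, t)
        - 2 * l * polar_pull h (r, t))).
      exact: (integrableB measurableT ir2 i2).
    rewrite RintegralD// RintegralB// (RintegralZl _ measurableT ir) (RintegralZl _ measurableT il).
    by rewrite /a /b /c /circle_int /circle_len; ring.
  apply: Rintegral_ge0 => t _; rewrite /polar_pull /= r0 /slope_wt gtr0_norm// mulr1.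
  set h1 := h _; set h2 := h _.
  have q0 : 0 < 1 + t ^+ 2 by rewrite ltr_pwDl// sqr_ge0.
  rewrite [X in _ <= X](_ : _ = ((h1 - l) ^+ 2 + (h2 - l) ^+ 2) * (r / (1 + t ^+ 2))).
    by rewrite mulr_ge0 ?addr_ge0 ?sqr_ge0// ltW// divr_gt0.
  by field; rewrite gt_eqF.
have cr0 : 0 < c * r by rewrite mulr_gt0.
have := key (a / (c * r)).
rewrite (_ : _ + _ = (c * r * b - a ^+ 2) / (c * r)).
  by rewrite pmulr_lge0 ?invr_gt0// subr_ge0.
by field; rewrite !gt_eqF.
Qed.

End circle_integrals.

(** * Multipole components *)

Section pairing.
Context {R : realType}.
Local Notation mu := (@lebesgue_measure R).
Local Notation MR := (measurableTypeR R).
Local Notation lam := (@lebesgue2 R).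
Variable rho : R.

Lemma span_measurable f : poly_span (@coords R) (rads rho) f ->
  measurable_fun setT (f : MR * MR -> MR).
Proof.
elim=> [b [phi [n [phiT ->]]]|l {}f [->|->] _ IH|{}f g _ IHf _ IHg|k {}f _ IH].
- have mphi : measurable_fun setT (phi : MR -> MR).
    by apply: continuous_measurable_fun; exact: continuous_test_function phiT.
  apply: measurable_funM; first exact: (measurableT_comp mphi (@measurable_enorm R)).
  by apply: measurable_funV; apply: measurable_funX; exact: measurable_enorm.
- exact: (measurable_funM (@measurable_fst _ _ MR MR) IH).
- exact: (measurable_funM (@measurable_snd _ _ MR MR) IH).
- exact: (measurable_funD IHf IHg).
- exact: (measurable_funM (measurable_cst k) IH).
Qed.

Lemma norm_fst_le (x : R * R) : `|x.1| <= enorm x.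
Proof. by rewrite -sqrtr_sqr; apply: ler_wsqrtr; rewrite lerDl sqr_ge0. Qed.

Lemma norm_snd_le (x : R * R) : `|x.2| <= enorm x.
Proof. by rewrite -sqrtr_sqr; apply: ler_wsqrtr; rewrite lerDr sqr_ge0. Qed.

Lemma rad_bounded phi n : test_function `]0, rho[ phi ->
  exists M, forall x, `|rad phi n x| <= M.
Proof.
move=> phiT; have [_ [K [cK KD phi0]]] := phiT.
have cK' := compact_enorm_preimage cK KD.
have /compact_bounded[M [_ HM]] : compact (rad phi n @` (@enorm R @^-1` K)).
  apply: continuous_compact cK'; apply: continuous_subspaceT.
  exact: continuous_rad phiT.
exists (Num.max 0 (M + 1)) => x; have [Kx|nKx] := pselect (K (enorm x)).
  rewrite le_max; apply/orP; right; apply: HM; first by rewrite ltrDl.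
  by exists x.
by rewrite /rad phi0// mul0r normr0 le_max lexx.
Qed.

(** Coordinates are unbounded, but every element of the span vanishes off the disk, where they are
    at most [|rho|]. *)
Lemma span_bounded f : poly_span (@coords R) (rads rho) f ->
  exists M, forall x, `|f x| <= M.
Proof.
have supp g : poly_span (@coords R) (rads rho) g -> forall x, ~ disk rho x -> g x = 0.
  move=> sg x; apply: (span_support (B := rads rho) (L := @coords R) (Z := ~` disk rho)) => //.
  move=> b [phi [n [[_ [K [_ KD phi0]]] ->]]] y Dy; rewrite /rad phi0 ?mul0r//.
  by move=> /KD /=; rewrite in_itv/= => /andP[_ ?]; apply: Dy.
elim=> [b [phi [n [phiT ->]]]|l {}f Ll sf [M IH]|{}f g _ [M IHf] _ [N IHg]|k {}f _ [M IH]].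
- exact: rad_bounded phiT.
- exists (`|rho| * M) => x; have M0 : 0 <= M by exact: le_trans (IH x).
  have [Dx|nDx] := pselect (disk rho x); last first.
    by rewrite (supp _ (span_mul Ll sf) x nDx) normr0 mulr_ge0.
  rewrite normrM ler_pM//; apply: le_trans (le_trans (ltW Dx) (ler_norm _)).
  by case: Ll => ->; [exact: norm_fst_le|exact: norm_snd_le].
- by exists (M + N) => x; rewrite (le_trans (ler_normD _ _))// lerD.
- by exists (`|k| * M) => x; rewrite normrM ler_wpM2l.
Qed.

Fixpoint cpow (l : nat) (x : R * R) : R * R :=
  if l is l'.+1 then let z := cpow l' x in
    (x.1 * z.1 - x.2 * z.2, x.1 * z.2 + x.2 * z.1)
  else (1, 0).

(* Real and imaginary parts of [(x.1 + i x.2) ^ l]. *)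
Definition reP l x := (cpow l x).1.
Definition imP l x := (cpow l x).2.

Lemma reImP_sqr l x : reP l x ^+ 2 + imP l x ^+ 2 = (enorm x ^+ l) ^+ 2.
Proof.
elim: l => [|l IH]; first by rewrite /reP /imP /= !expr1n expr0n addr0.
rewrite [enorm x ^+ _]exprS exprMn -IH enorm_sqr /reP /imP /=; ring.
Qed.

Lemma is_derive_mul (f g : R * R -> R) (x v : R * R) (df dg : R) :
  is_derive x v f df -> is_derive x v g dg ->
  is_derive x v (fun y => f y * g y) (df * g x + f x * dg).
Proof.
move=> Hf Hg; apply: (is_derive_eq (is_deriveM Hf Hg)).
by rewrite /GRing.scale /= addrC [g x * _]mulrC.
Qed.

Lemma is_derive_fst (x v : R * R) : is_derive x v (fst : R * R -> R) v.1.
Proof. by have [] := @coordsP R fst (or_introl erefl). Qed.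

Lemma is_derive_snd (x v : R * R) : is_derive x v (snd : R * R -> R) v.2.
Proof. by have [] := @coordsP R snd (or_intror erefl). Qed.

(** These are the real and imaginary parts of [l z ^ (l - 1) v]. At [l = 0] the factor [l%:R] makes
    the truncated predecessor harmless. *)
Lemma is_derive_reImP l (x v : R * R) :
  is_derive x v (reP l) (l%:R * (reP l.-1 x * v.1 - imP l.-1 x * v.2)) /\
  is_derive x v (imP l) (l%:R * (imP l.-1 x * v.1 + reP l.-1 x * v.2)).
Proof.
elim: l => [|l [IHr IHi]].
  by rewrite !mul0r; split; exact: is_derive_cst.
have d1 := is_derive_fst x v; have d2 := is_derive_snd x v.
split.
- apply: (is_derive_eq (is_deriveB (is_derive_mul d1 IHr) (is_derive_mul d2 IHi))).
  case: l {IHr IHi} => [|l]; rewrite /reP /imP /=; first by ring.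
  by rewrite -(natr1 l.+1); ring.
- apply: (is_derive_eq (is_deriveD (is_derive_mul d1 IHi) (is_derive_mul d2 IHr))).
  case: l {IHr IHi} => [|l]; rewrite /reP /imP /=; first by ring.
  by rewrite -(natr1 l.+1); ring.
Qed.

(** Euler's relation for a homogeneous polynomial, with the factor [l] kept on both sides so that it
    holds at [l = 0]. *)
Lemma euler_reP l (x : R * R) :
  l%:R * (x.1 * reP l.-1 x - x.2 * imP l.-1 x) = l%:R * reP l x.
Proof. by case: l => [|l]; rewrite ?mul0r. Qed.

Lemma euler_imP l (x : R * R) :
  l%:R * (x.1 * imP l.-1 x + x.2 * reP l.-1 x) = l%:R * imP l x.
Proof. by case: l => [|l]; rewrite ?mul0r. Qed.

Lemma span_reImP (B : set (R * R -> R)) l f : poly_span (@coords R) B f ->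
  poly_span (@coords R) B (fun x => reP l x * f x) /\
  poly_span (@coords R) B (fun x => imP l x * f x).
Proof.
move=> sf; elim: l => [|l [IHr IHi]].
  rewrite (_ : (fun x => reP 0 x * f x) = (fun x => 1 * f x))//.
  rewrite (_ : (fun x => imP 0 x * f x) = (fun x => 0 * f x))//.
  by split; exact: span_scale.
have c1 : coords (fst : R * R -> R) by left.
have c2 : coords (snd : R * R -> R) by right.
split.
- rewrite (_ : (fun x => _) = (fun x => x.1 * (reP l x * f x) + (-1) * (x.2 * (imP l x * f x)))).
    exact: (span_add (span_mul c1 IHr) (span_scale (-1) (span_mul c2 IHi))).
  by apply/funext => x; rewrite /reP /imP /=; ring.
- rewrite (_ : (fun x => _) = (fun x => x.1 * (imP l x * f x) + x.2 * (reP l x * f x))).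
    exact: (span_add (span_mul c1 IHi) (span_mul c2 IHr)).
  by apply/funext => x; rewrite /reP /imP /=; ring.
Qed.

Lemma rad_sqr phi n x : test_function `]0, rho[ phi ->
  rad phi n.+2 x * enorm x ^+ 2 = rad phi n x.
Proof.
move=> phiT; rewrite /rad; have [->|x0] := eqVneq (enorm x) 0.
  by rewrite (test_at0 phiT) !mul0r.
by rewrite !exprS; field; rewrite expf_neq0.
Qed.

End pairing.

(** * Extension by zero and weak derivatives against radial tests *)

Section extension.
Context {R : realType}.
Local Notation mu := (@lebesgue_measure R).
Local Notation MR := (measurableTypeR R).
Local Notation lam := (@lebesgue2 R).
Variable rho : R.

Lemma measurable_disk : measurable (disk rho : set (MR * MR)).
Proof.
rewrite (_ : disk rho = setT `&` @enorm R @^-1` `]-oo, rho[%classic); last first.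
  by rewrite setTI; apply/seteqP; split => x /=; rewrite in_itv/=.
exact: (@measurable_enorm R).
Qed.

Lemma disk_fin : (lam (disk rho) < +oo)%E.
Proof.
pose I : set MR := `[- rho, rho]%classic.
have mI : measurable I by exact: measurable_itv.
have mD := measurable_disk.
have DI : (disk rho : set (MR * MR)) `<=` I `*` I.
  move=> x Dx; have lt := ltW Dx.
  by split; rewrite /I /= in_itv/= -ler_norml; apply: le_trans lt;
    [exact: norm_fst_le|exact: norm_snd_le].
apply: (@le_lt_trans _ _ (lam (I `*` I))).
  by apply: le_measure => //; rewrite inE; [exact: mD|exact: measurableX].
have Ifin : (mu I < +oo)%E.
  by rewrite /I lebesgue_measure_itv/=; case: ifP => _; rewrite ?ltry// -EFinD ltry.
rewrite [X in (X < _)%E](product_measure1E mu mu mI mI).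
by apply: lte_mul_pinfty => //; rewrite ge0_fin_numE.
Qed.

(** Slope coordinates and circle integrals live on the whole plane, hence the passage from the disk
    by extension with 0. *)
Definition ext (f : MR * MR -> MR) : MR * MR -> MR := f \_ (disk rho).

Lemma ext_in f x : disk rho x -> ext f x = f x.
Proof. by move=> Dx; rewrite /ext patchE mem_set. Qed.

Lemma ext_out f x : ~ disk rho x -> ext f x = 0.
Proof. by move=> Dx; rewrite /ext patchE memNset. Qed.

Lemma integrable_mul_bounded (f b : MR * MR -> MR) (M : R) :
  measurable_fun setT f -> measurable_fun setT b ->
  lam.-integrable setT (EFin \o f) -> (forall x, `|b x| <= M) ->
  lam.-integrable setT (EFin \o (fun x => f x * b x)).
Proof.
move=> mf mb itf bM; have := integrableZl measurableT M itf.
apply: le_integrable => //.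
  by apply/measurable_EFinP; exact: measurable_funM.
move=> x _; rewrite /= lee_fin !normrM mulrC ler_wpM2r//.
by rewrite (le_trans (bM x))// ler_norm.
Qed.

(** Integrability comes from [|f| <= 1 + f ^ 2] on a disk of finite measure. *)
Lemma L2_ext f : L2_weighted lam (disk rho) (fun=> 1) f ->
  [/\ measurable_fun setT (ext f), lam.-integrable setT (EFin \o ext f) &
      lam.-integrable setT (EFin \o (fun x => ext f x ^+ 2))].
Proof.
move=> [mf f2]; have mD := measurable_disk.
have me : measurable_fun setT (ext f) by exact/(measurable_restrictT _ mD).
have me2 : measurable_fun setT (fun x => ext f x ^+ 2 : MR) by exact: measurable_funX.
have ie2 : lam.-integrable setT (EFin \o (fun x => ext f x ^+ 2)).
  apply/integrableP; split; first exact/measurable_EFinP.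
  move: f2; rewrite integral_mkcond; congr (_ < _)%E.
  apply: eq_integral => x _; rewrite patchE /= /ext patchE.
  by case: ifP => _; rewrite /= ?mulr1 ?expr0n ger0_norm// sqr_ge0.
split => //.
have i1 : lam.-integrable setT (EFin \o \1_(disk rho : set (MR * MR))).
  apply/integrableP; split.
    by apply/measurable_EFinP; exact: measurable_indic.
  rewrite [ltLHS](_ : _ = \int[lam]_x (\1_(disk rho : set (MR * MR)) x)%:E)%E.
    by rewrite integral_indic// setIT disk_fin.
  by apply: eq_integral => x _; rewrite /= ger0_norm.
have i12 := integrableD measurableT i1 ie2.
apply: le_integrable i12 => //; first exact/measurable_EFinP.
move=> x _; rewrite /= lee_fin indicE /ext patchE.
case: ifP => xD; last by rewrite normr0.
rewrite [leRHS]ger0_norm ?addr_ge0 ?sqr_ge0//= -(real_normK (num_real (f x))).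
have : 0 <= (1 - `|f x|) ^+ 2 by exact: sqr_ge0.
have : 0 <= `|f x| by [].
by rewrite sqrrB expr1n mul1r mulr2n; lra.
Qed.

Lemma span_rads phi f : test_function `]0, rho[ phi ->
  poly_span (@coords R) (fun b => exists n, b = rad phi n) f ->
  poly_span (@coords R) (rads rho) f.
Proof.
move=> phiT; elim=> [b [n ->]|l {}f Ll _ IH|{}f g _ IHf _ IHg|k {}f _ IH].
- by apply: span_base; exists phi, n.
- exact: span_mul.
- exact: span_add.
- exact: span_scale.
Qed.

(* Testing only against polynomials times radial functions is all that is needed,
   and spares measurability and bounds for arbitrary test functions. *)
Definition weak_derivative_rad (v : R * R) (f g : R * R -> R) : Prop :=
  forall phi X d, test_function `]0, rho[ phi ->
  poly_span (@coords R) (fun b => exists n, b = rad phi n) X ->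
  (forall x : R * R, is_derive x v X (d x)) ->
  \int[lam]_x (ext f x * d x) = - \int[lam]_x (ext g x * X x).

Lemma weak_derivative2_rad v f g : weak_derivative2 (disk rho) v f g ->
  weak_derivative_rad v f g.
Proof.
move=> fg phi X d phiT sX dX.
have := fg X (span_test phiT sX); rewrite Rintegral_mkcond [in X in _ = - X -> _]Rintegral_mkcond.
move=> H; transitivity (\int[lam]_x ((fun x => f x * 'D_v X x) \_ (disk rho)) x).
  apply: eq_Rintegral => x _; rewrite !patchE /ext patchE; case: ifP => _; last by rewrite mul0r.
  by have [_ ->] := dX x.
rewrite H; congr (- _); apply: eq_Rintegral => x _.
by rewrite !patchE /ext patchE; case: ifP => _; rewrite ?mul0r.
Qed.

(** By uniqueness of derivatives [d] lies in the span too, so both [X] and [d] are bounded. *)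
Lemma integrable_pairing phi v f g X d : test_function `]0, rho[ phi ->
  L2_weighted lam (disk rho) (fun=> 1) f -> L2_weighted lam (disk rho) (fun=> 1) g ->
  poly_span (@coords R) (fun b => exists n, b = rad phi n) X ->
  (forall x : R * R, is_derive x v X (d x)) ->
  lam.-integrable setT (EFin \o (fun x => ext f x * d x)) /\
  lam.-integrable setT (EFin \o (fun x => ext g x * X x)).
Proof.
move=> phiT L2f L2g sX dX; have [mf itf _] := L2_ext L2f; have [mg itg _] := L2_ext L2g.
have sX' := span_rads phiT sX.
have sd : poly_span (@coords R) (rads rho) d.
  have [_ /(_ v)[d' sd' dd']] := span_derive (@coordsP R) (@radsP R rho) sX'.
  rewrite (_ : d = d')//; apply/funext => x.
  by have [_ <-] := dX x; have [_ <-] := dd' x.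
have [M XM] := span_bounded sX'; have [N dN] := span_bounded sd.
split.
- exact: (integrable_mul_bounded mf (span_measurable sd) itf dN).
- exact: (integrable_mul_bounded mg (span_measurable sX') itg XM).
Qed.

Lemma weak_derivative_radD v (f1 f2 g1 g2 : R * R -> R) (a b : R) :
  L2_weighted lam (disk rho) (fun=> 1) f1 -> L2_weighted lam (disk rho) (fun=> 1) g1 ->
  L2_weighted lam (disk rho) (fun=> 1) f2 -> L2_weighted lam (disk rho) (fun=> 1) g2 ->
  weak_derivative_rad v f1 g1 -> weak_derivative_rad v f2 g2 ->
  weak_derivative_rad v (fun x => a * f1 x + b * f2 x) (fun x => a * g1 x + b * g2 x).
Proof.
move=> L2f1 L2g1 L2f2 L2g2 fg1 fg2 phi X d phiT sX dX.
have [i1 j1] := integrable_pairing phiT L2f1 L2g1 sX dX.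
have [i2 j2] := integrable_pairing phiT L2f2 L2g2 sX dX.
have extD (u1 u2 e : R * R -> R) x : ext (fun y => a * u1 y + b * u2 y) x * e x =
    a * (ext u1 x * e x) + b * (ext u2 x * e x).
  by rewrite /ext !patchE; case: ifP => _; [rewrite mulrDl !mulrA|rewrite !mul0r !mulr0 addr0].
have int (u1 u2 e : R * R -> R) : lam.-integrable setT (EFin \o (fun x => ext u1 x * e x)) ->
    lam.-integrable setT (EFin \o (fun x => ext u2 x * e x)) ->
    \int[lam]_x (ext (fun y => a * u1 y + b * u2 y) x * e x) =
    a * \int[lam]_x (ext u1 x * e x) + b * \int[lam]_x (ext u2 x * e x).
  move=> k1 k2; under eq_Rintegral do rewrite extD.
  have z1 := integrableZl measurableT a k1; have z2 := integrableZl measurableT b k2.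
  by rewrite RintegralD// (RintegralZl _ measurableT k1) (RintegralZl _ measurableT k2).
rewrite int// int// (fg1 _ _ _ phiT sX dX) (fg2 _ _ _ phiT sX dX).
by ring.
Qed.

End extension.

(** * Reduction of plane integrals to integrals over the radius *)

Section radial_integrals.
Context {R : realType}.
Local Notation mu := (@lebesgue_measure R).
Local Notation MR := (measurableTypeR R).
Local Notation lam := (@lebesgue2 R).

Lemma ae_eq_integrable d (T : measurableType d) (m : {measure set T -> \bar R})
    (f g : T -> R) : measurable_fun setT f -> measurable_fun setT g ->
  {ae m, forall x, f x = g x} ->
  m.-integrable setT (EFin \o f) -> m.-integrable setT (EFin \o g).
Proof.
move=> mf mg fg /integrableP[_ fin]; apply/integrableP; split; first exact/measurable_EFinP.
apply: le_lt_trans fin; rewrite le_eqVlt; apply/orP; left; apply/eqP.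
have FF := ae_filter_ringOfSetsType m.
apply: ge0_ae_eq_integral => //.
- by apply/measurable_EFinP; exact: (measurableT_comp (@normr_measurable R setT) mg).
- by apply/measurable_EFinP; exact: (measurableT_comp (@normr_measurable R setT) mf).
- by apply: filterS fg => x /= -> _.
Qed.

Lemma ae_eq_Rintegral d (T : measurableType d) (m : {measure set T -> \bar R})
    (f g : T -> R) : measurable_fun setT f -> measurable_fun setT g ->
  {ae m, forall x, f x = g x} -> \int[m]_x f x = \int[m]_x g x.
Proof.
move=> mf mg fg; have FF := ae_filter_ringOfSetsType m; congr fine.
apply: ae_eq_integral => //; [exact/measurable_EFinP|exact/measurable_EFinP|].
by apply: filterS fg => x /= -> _.
Qed.

Lemma ae_enorm_neq0 : {ae lam, forall x : R * R, enorm x != 0}.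
Proof.
have m0 : measurable [set 0 : MR] by exact: measurable_set1.
exists ([set 0 : MR] `*` [set 0 : MR]); split.
- exact: measurableX.
- rewrite [LHS](product_measure1E mu mu m0 m0) [X in (X * _)%E]lebesgue_measure_set1.
  by rewrite mul0e.
- by move=> x /= /negP/negPn/eqP/enorm_eq0 ->.
Qed.

Variable rho : R.
Local Notation I := (`]0, rho[%classic : set MR).

Let mI : measurable I. Proof. exact: measurable_itv. Qed.

Lemma Rintegral_support (f : MR -> MR) : (forall r, r \notin `]0, rho[ -> f r = 0) ->
  \int[mu]_r f r = \int[mu]_(r in I) f r.
Proof.
move=> f0; rewrite [RHS]Rintegral_mkcond; apply: eq_Rintegral => r _.
rewrite patchE; case: ifPn => //; rewrite notin_setE /= => /negP rI.
exact: f0.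
Qed.

Lemma circle_int_enormE (u : MR -> MR) r :
  circle_int (fun x => u (enorm x)) r = circle_len * (r * u r) * (0 < r)%R%:R.
Proof.
have [r0|nr] := boolP (0 < r); first by rewrite mulr1 circle_int_enorm.
rewrite mulr0 /circle_int /Rintegral (eq_integral (fun=> 0%E)) ?integral0// => t _.
by rewrite /polar_pull /= (negbTE nr) !mulr0.
Qed.

Lemma radial_integral (F : MR * MR -> MR) (u : MR -> MR) :
  measurable_fun setT F -> lam.-integrable setT (EFin \o F) -> measurable_fun setT u ->
  {ae lam, forall x, F x = u (enorm x)} -> (forall r, rho <= r -> u r = 0) ->
  mu.-integrable I (EFin \o (fun r => r * u r)) /\
  \int[lam]_x F x = circle_len * \int[mu]_(r in I) (r * u r).
Proof.
move=> mF iF mu' Fu u0; have c0 := (@slope_density_integral R).2.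
have mue : measurable_fun setT (fun x => u (enorm x) : MR).
  exact: (measurableT_comp mu' (@measurable_enorm R)).
have iue := ae_eq_integrable mF mue Fu iF.
have [ici E] := integral_circle_int mue iue.
have ru : mu.-integrable I (EFin \o (fun r => r * u r)).
  have := integrableZl mI circle_len^-1 (integrableS measurableT mI (@subsetT _ _) ici).
  apply: eq_integrable => // r; rewrite inE /= in_itv/= => /andP[r0 _].
  rewrite -EFinM circle_int_enormE r0 mulr1; congr EFin; field.
  by rewrite gt_eqF.
split => //; rewrite (ae_eq_Rintegral mF mue Fu) E -RintegralZl//.
rewrite Rintegral_support; last first.
  move=> r; rewrite in_itv/= negb_and -!leNgt => rI; rewrite circle_int_enormE.
  case/orP: rI => [r0|rr]; first by rewrite ltNge r0 mulr0.
  by rewrite u0// !mulr0 mul0r.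
apply: eq_Rintegral => r; rewrite inE /= in_itv/= => /andP[r0 _].
by rewrite circle_int_enormE r0 mulr1.
Qed.

Lemma weighted_circle_integral (h : MR * MR -> MR) (v : MR -> MR) :
  measurable_fun setT h -> lam.-integrable setT (EFin \o h) -> measurable_fun setT v ->
  lam.-integrable setT (EFin \o (fun x => h x * v (enorm x))) ->
  (forall r, r \notin `]0, rho[ -> v r = 0) ->
  mu.-integrable I (EFin \o (fun r => circle_int h r * v r)) /\
  \int[lam]_x (h x * v (enorm x)) = \int[mu]_(r in I) (circle_int h r * v r).
Proof.
move=> mh ih mv ihv v0.
have mhv : measurable_fun setT (fun x => h x * v (enorm x) : MR).
  by apply: measurable_funM => //; exact: (measurableT_comp mv (@measurable_enorm R)).
have [ici E] := integral_circle_int mhv ihv.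
have mc := measurable_circle_int mh ih; have mchv := measurable_circle_int mhv ihv.
have mcv : measurable_fun setT (fun r => circle_int h r * v r : MR) by exact: measurable_funM.
have ae := circle_int_radial v mh ih.
split; first exact: integrableS measurableT mI (@subsetT _ _) (ae_eq_integrable mchv mcv ae ici).
rewrite E (ae_eq_Rintegral mchv mcv ae) Rintegral_support// => r rI.
by rewrite v0// mulr0.
Qed.

(** Cauchy-Schwarz on the circle of radius [r] costs a factor [r], which the weight [1 / r]
    absorbs. *)
Lemma L2_circle_int (h : MR * MR -> MR) : measurable_fun setT h ->
  lam.-integrable setT (EFin \o h) -> lam.-integrable setT (EFin \o (fun x => h x ^+ 2)) ->
  L2_weighted (@lebesgue1 R) `]0, rho[ (fun r => r^-1) (circle_int h).
Proof.
move=> mh ih ih2; have mc := measurable_circle_int mh ih.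
have mh2 : measurable_fun setT (fun x => h x ^+ 2 : MR) by exact: measurable_funX.
have [ic2 _] := integral_circle_int mh2 ih2.
have c0 := (@slope_density_integral R).2.
split; first exact: measurable_funTS.
have := integrableZl mI (@circle_len R) (integrableS measurableT mI (@subsetT _ _) ic2).
move=> /integrableP[mC]; apply: le_lt_trans.
have FF := ae_filter_ringOfSetsType mu.
apply: ae_ge0_le_integral => //.
- move=> r; rewrite /= in_itv/= => /andP[r0 _].
  by rewrite lee_fin mulr_ge0 ?sqr_ge0// invr_ge0 ltW.
- apply/measurable_EFinP; apply: measurable_funTS; apply: measurable_funM.
    exact: measurable_funX.
  by apply: measurable_funV; exact: measurable_id.
- exact: measurableT_comp.
- have := circle_int_sqr mh ih ih2; apply: filterS => r H; rewrite /= in_itv/= => /andP[r0 _].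
  rewrite lee_fin ler_pdivrMr// (le_trans (H r0))// -mulrA [r * _]mulrC mulrA.
  by apply: ler_wpM2r; [exact: ltW|exact: ler_norm].
Qed.

End radial_integrals.

(** * Weak gradients tested against multipole vector fields *)

Section multipole_pairing.
Context {R : realType}.
Local Notation MR := (measurableTypeR R).
Local Notation lam := (@lebesgue2 R).
Variables (rho : R) (l : nat) (T a b f g1 g2 : R * R -> R).
Hypothesis dT : forall x v : R * R, is_derive x v T (l%:R * (a x * v.1 + b x * v.2)).
Hypothesis spanT : forall (B : set (R * R -> R)) X,
  poly_span (@coords R) B X -> poly_span (@coords R) B (fun x => T x * X x).
Hypotheses (L2f : L2_weighted lam (disk rho) (fun=> 1) f)
  (L2g1 : L2_weighted lam (disk rho) (fun=> 1) g1)
  (L2g2 : L2_weighted lam (disk rho) (fun=> 1) g2).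
Hypotheses (fg1 : weak_derivative_rad rho (1, 0) f g1)
  (fg2 : weak_derivative_rad rho (0, 1) f g2).
Variable phi : R -> R.
Hypothesis phiT : test_function `]0, rho[ phi.

Local Notation sp := (poly_span (@coords R) (fun b => exists n, b = rad phi n)).

(** Integration by parts against the field [(X1, X2)] of divergence [d1 + d2]. Here [T] stands for
    [reP l] or [imP l], handled together through the gradient [l (a, b)]. *)
Lemma field_pairing (X1 X2 d1 d2 : R * R -> R) :
  sp X1 -> (forall x : R * R, is_derive x (1, 0) X1 (d1 x)) ->
  sp X2 -> (forall x : R * R, is_derive x (0, 1) X2 (d2 x)) ->
  [/\ lam.-integrable setT (EFin \o (fun x => ext rho f x * (d1 x + d2 x))),
      lam.-integrable setT (EFin \o (fun x => ext rho g1 x * X1 x + ext rho g2 x * X2 x)) &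
      \int[lam]_x (ext rho f x * (d1 x + d2 x)) =
      - \int[lam]_x (ext rho g1 x * X1 x + ext rho g2 x * X2 x)].
Proof.
move=> s1 D1 s2 D2.
have [i1 j1] := integrable_pairing phiT L2f L2g1 s1 D1.
have [i2 j2] := integrable_pairing phiT L2f L2g2 s2 D2.
have E1 := fg1 phiT s1 D1; have E2 := fg2 phiT s2 D2.
have fE : (fun x => ext rho f x * (d1 x + d2 x)) =
    (fun x => ext rho f x * d1 x + ext rho f x * d2 x).
  by apply/funext => x; rewrite mulrDr.
rewrite fE; split; [exact: (integrableD measurableT i1 i2)|exact: (integrableD measurableT j1 j2)|].
by rewrite !RintegralD// E1 E2 opprD.
Qed.

Let c1 : coords (fst : R * R -> R). Proof. by left. Qed.
Let c2 : coords (snd : R * R -> R). Proof. by right. Qed.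

(* The field [T x phi(|x|) / |x| ^ (l + 2)] has divergence
   [T phi'(|x|) / |x| ^ (l + 1)]. *)
Lemma radial_pairing : (forall x, l%:R * (x.1 * a x + x.2 * b x) = l%:R * T x) ->
  [/\ lam.-integrable setT (EFin \o (fun x => ext rho f x * (T x * rad ('D_1 phi) l.+1 x))),
      lam.-integrable setT (EFin \o (fun x =>
        (ext rho g1 x * x.1 + ext rho g2 x * x.2) * T x * rad phi l.+2 x)) &
      \int[lam]_x (ext rho f x * (T x * rad ('D_1 phi) l.+1 x)) =
      - \int[lam]_x ((ext rho g1 x * x.1 + ext rho g2 x * x.2) * T x * rad phi l.+2 x)].
Proof.
move=> euler.
have sr : sp (rad phi l.+2) by apply: span_base; exists l.+2.
have s1 := spanT (span_mul c1 sr); have s2 := spanT (span_mul c2 sr).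
have D1 (x : R * R) := is_derive_mul (dT x (1, 0)) (is_derive_mul (is_derive_fst x (1, 0))
  (is_derive_rad l.+2 x (1, 0) phiT)).
have D2 (x : R * R) := is_derive_mul (dT x (0, 1)) (is_derive_mul (is_derive_snd x (0, 1))
  (is_derive_rad l.+2 x (0, 1) phiT)).
have [i j E] := field_pairing s1 D1 s2 D2.
move: i j E; set F := (fun x => ext rho f x * _); set G := (fun x => ext rho g1 x * _ + _).
have -> : F = (fun x => ext rho f x * (T x * rad ('D_1 phi) l.+1 x)).
  apply/funext => x; rewrite /F /=; congr (_ * _).
  (* The exponent [l + 2] is chosen to cancel the undifferentiated term: Euler's relation
     contributes [l], the divergence of [x] contributes 2, and the power of [|x|] contributes
     [- (l + 2)]. *)
  have E1 := rad_sqr l.+2 x phiT; have E2 := rad_sqr l.+1 x (test_function_derive phiT).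
  have H := euler x; rewrite enorm_sqr in E1 E2.
  transitivity (l%:R * (x.1 * a x + x.2 * b x) * rad phi l.+2 x + T x * (2 * rad phi l.+2 x
     + rad ('D_1 phi) l.+3 x * (x.1 ^+ 2 + x.2 ^+ 2)
     - l.+2%:R * (rad phi l.+4 x * (x.1 ^+ 2 + x.2 ^+ 2)))); first by ring.
  by rewrite H E1 E2 -(natr1 l.+1) -(natr1 l); ring.
have -> // : G = (fun x => (ext rho g1 x * x.1 + ext rho g2 x * x.2) * T x * rad phi l.+2 x).
by apply/funext => x; rewrite /G; ring.
Qed.

(* The field [T x^perp phi(|x|) / |x| ^ l] has divergence
   [- l T' phi(|x|) / |x| ^ l], where [l T'] is the angular derivative of [T]. *)
Lemma angular_pairing (T' : R * R -> R) :
  (forall x, l%:R * (- x.2 * a x + x.1 * b x) = l%:R * T' x) ->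
  [/\ lam.-integrable setT (EFin \o (fun x => ext rho f x * (l%:R * T' x * rad phi l x))),
      lam.-integrable setT (EFin \o (fun x =>
        (x.1 * ext rho g2 x - x.2 * ext rho g1 x) * T x * rad phi l x)) &
      \int[lam]_x (ext rho f x * (l%:R * T' x * rad phi l x)) =
      - \int[lam]_x ((x.1 * ext rho g2 x - x.2 * ext rho g1 x) * T x * rad phi l x)].
Proof.
move=> angular.
have sr : sp (rad phi l) by apply: span_base; exists l.
have s1 := spanT (span_scale (-1) (span_mul c2 sr)); have s2 := spanT (span_mul c1 sr).
have D1 (x : R * R) := is_derive_mul (dT x (1, 0)) (is_derive_mul (is_derive_cst (-1 : R) x ((1, 0) : R * R))
  (is_derive_mul (is_derive_snd x (1, 0)) (is_derive_rad l x (1, 0) phiT))).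
have D2 (x : R * R) := is_derive_mul (dT x (0, 1)) (is_derive_mul (is_derive_fst x (0, 1))
  (is_derive_rad l x (0, 1) phiT)).
have [i j E] := field_pairing s1 D1 s2 D2.
move: i j E; set F := (fun x => ext rho f x * _); set G := (fun x => ext rho g1 x * _ + _).
have -> : F = (fun x => ext rho f x * (l%:R * T' x * rad phi l x)).
  (* The derivatives of the radial factor cancel, its gradient being orthogonal to [x^perp]. *)
  by apply/funext => x; rewrite /F /= -angular; congr (_ * _); ring.
have -> // : G = (fun x => (x.1 * ext rho g2 x - x.2 * ext rho g1 x) * T x * rad phi l x).
by apply/funext => x; rewrite /G; ring.
Qed.

End multipole_pairing.

(** * Regularity of the profile of a multipole pair *)

Section multipole.
Context {R : realType}.
Local Notation mu := (@lebesgue_measure R).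
Local Notation MR := (measurableTypeR R).
Local Notation lam := (@lebesgue2 R).

Definition L2_plane (h : MR * MR -> MR) :=
  [/\ measurable_fun setT h, lam.-integrable setT (EFin \o h) &
      lam.-integrable setT (EFin \o (fun x => h x ^+ 2))].

Lemma L2_planeM (h b : MR * MR -> MR) : L2_plane h -> measurable_fun setT b ->
  (forall x, `|b x| <= 1) -> L2_plane (fun x => h x * b x).
Proof.
move=> [mh ih ih2] mb b1; have mhb : measurable_fun setT (fun x => h x * b x : MR).
  exact: measurable_funM.
split => //; first exact: (integrable_mul_bounded mh mb ih b1).
have -> : (fun x => (h x * b x) ^+ 2) = (fun x => h x ^+ 2 * b x ^+ 2).
  by apply/funext => x; rewrite exprMn.
apply: (@integrable_mul_bounded _ _ _ 1) => //; [exact: measurable_funX|exact: measurable_funX|].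
by move=> x; rewrite normrX expr_le1.
Qed.

Lemma L2_planeD (h k : MR * MR -> MR) : L2_plane h -> L2_plane k ->
  L2_plane (fun x => h x + k x).
Proof.
move=> [mh ih ih2] [mk ik ik2]; have mhk : measurable_fun setT (fun x => h x + k x : MR).
  exact: measurable_funD.
split => //; first exact: (integrableD measurableT ih ik).
have := integrableZl measurableT 2 (integrableD measurableT ih2 ik2).
apply: le_integrable => //; first by apply/measurable_EFinP; exact: measurable_funX.
move=> x _; rewrite /= lee_fin ger0_norm ?sqr_ge0// ger0_norm; last first.
  by rewrite mulr_ge0// addr_ge0 ?sqr_ge0.
have : 0 <= (h x - k x) ^+ 2 by exact: sqr_ge0.
by rewrite sqrrB sqrrD !mulr2n; lra.
Qed.

Variable rho : R.
Local Notation I := (`]0, rho[%classic : set MR).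

Let mI : measurable I. Proof. exact: measurable_itv. Qed.

Variables (l : nat) (w : MR -> MR) (f1 f2 g11 g12 g21 g22 : R * R -> R).
Hypotheses (mw : measurable_fun setT w).
Hypotheses (L2f1 : L2_weighted lam (disk rho) (fun=> 1) f1)
  (L2g11 : L2_weighted lam (disk rho) (fun=> 1) g11)
  (L2g12 : L2_weighted lam (disk rho) (fun=> 1) g12)
  (fg11 : weak_derivative_rad rho (1, 0) f1 g11)
  (fg12 : weak_derivative_rad rho (0, 1) f1 g12).
Hypotheses (L2f2 : L2_weighted lam (disk rho) (fun=> 1) f2)
  (L2g21 : L2_weighted lam (disk rho) (fun=> 1) g21)
  (L2g22 : L2_weighted lam (disk rho) (fun=> 1) g22)
  (fg21 : weak_derivative_rad rho (1, 0) f2 g21)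
  (fg22 : weak_derivative_rad rho (0, 1) f2 g22).
Hypothesis fw : {ae lam, forall x, disk rho x ->
  f1 x = w (enorm x) * (reP l x / enorm x ^+ l) /\
  f2 x = w (enorm x) * (imP l x / enorm x ^+ l)}.

(** The cut at [rho] matches the extension of [f1] and [f2] by 0 off the disk. *)
Let wc (r : MR) : MR := if r < rho then w r else 0.

Let mwc : measurable_fun setT wc.
Proof.
apply: measurable_fun_ifT => //.
by apply: measurable_fun_ltr; [exact: measurable_id|exact: measurable_cst].
Qed.

Let wcI r : r \in `]0, rho[ -> wc r = w r.
Proof. by rewrite in_itv/= /wc => /andP[_ ->]. Qed.

Let wc_out r : rho <= r -> wc r = 0.
Proof. by rewrite /wc ltNge => ->. Qed.

Let c0 : 0 < @circle_len R := (@slope_density_integral R).2.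

Let aeF : {ae lam, forall x, enorm x != 0 /\
  (ext rho f1 x = wc (enorm x) * (reP l x / enorm x ^+ l) /\
  ext rho f2 x = wc (enorm x) * (imP l x / enorm x ^+ l))}.
Proof.
move: fw (@ae_enorm_neq0 R); apply: filterS2 => x H x0; split=> //.
have [Dx|nDx] := pselect (disk rho x).
  rewrite !ext_in//; have -> : wc (enorm x) = w (enorm x) by rewrite /wc ifT.
  exact: H.
rewrite !ext_out//; have -> : wc (enorm x) = 0 by rewrite /wc ifF//; apply/negP.
by rewrite !mul0r.
Qed.

Lemma measurable_reImP n : measurable_fun setT (reP n : MR * MR -> MR) /\
  measurable_fun setT (imP n : MR * MR -> MR).
Proof.
have m1 := @measurable_fst _ _ MR MR; have m2 := @measurable_snd _ _ MR MR.
elim: n => [|n [mr mi]]; first by split; exact: measurable_cst.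
split.
- exact: (measurable_funB (measurable_funM m1 mr) (measurable_funM m2 mi)).
- exact: (measurable_funD (measurable_funM m1 mi) (measurable_funM m2 mr)).
Qed.

Lemma norm_reP_le n (x : R * R) : `|reP n x| <= enorm x ^+ n.
Proof.
have e0 : 0 <= enorm x ^+ n by rewrite exprn_ge0// enorm_ge0.
rewrite -(ger0_norm e0) -!sqrtr_sqr; apply: ler_wsqrtr.
by rewrite -reImP_sqr lerDl sqr_ge0.
Qed.

Lemma norm_imP_le n (x : R * R) : `|imP n x| <= enorm x ^+ n.
Proof.
have e0 : 0 <= enorm x ^+ n by rewrite exprn_ge0// enorm_ge0.
rewrite -(ger0_norm e0) -!sqrtr_sqr; apply: ler_wsqrtr.
by rewrite -reImP_sqr lerDr sqr_ge0.
Qed.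

Lemma L2_plane_angular (g c T : R * R -> R) :
  L2_weighted lam (disk rho) (fun=> 1) g ->
  measurable_fun setT (c : MR * MR -> MR) -> (forall x, `|c x| <= enorm x) ->
  measurable_fun setT (T : MR * MR -> MR) -> (forall x, `|T x| <= enorm x ^+ l) ->
  L2_plane (fun x => ext rho g x * (c x * T x / enorm x ^+ l.+1)).
Proof.
move=> L2g mc cle mT Tle; apply: L2_planeM; first exact: (L2_ext L2g).
  apply: measurable_funM; first exact: measurable_funM.
  by apply: measurable_funV; apply: measurable_funX; exact: measurable_enorm.
move=> x; rewrite normrM normfV (ger0_norm (exprn_ge0 _ (enorm_ge0 x))).
(* At the origin the quotient is 0, because the inverse of 0 is 0. *)
have [->|x0] := eqVneq (enorm x) 0; first by rewrite expr0n invr0 mulr0.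
have e0 : 0 < enorm x by rewrite lt_def x0 enorm_ge0.
by rewrite ler_pdivrMr ?exprn_gt0// mul1r normrM exprS ler_pM.
Qed.

Let m1 := @measurable_fst _ _ MR MR.
Let m2 := @measurable_snd _ _ MR MR.
Let mr := (measurable_reImP l).1.
Let mi := (measurable_reImP l).2.

Let F x := ext rho f1 x * (reP l x / enorm x ^+ l) + ext rho f2 x * (imP l x / enorm x ^+ l).

(** [f1 ^ 2 + f2 ^ 2] is the radial function [w ^ 2], and the area element supplies the weight
    [r]. *)
Lemma multipole_L2 : L2_weighted (@lebesgue1 R) `]0, rho[ id w.
Proof.
split; first exact: measurable_funTS.
have [mf1 _ i1] := L2_ext L2f1; have [mf2 _ i2] := L2_ext L2f2.
pose S x : MR := ext rho f1 x ^+ 2 + ext rho f2 x ^+ 2.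
have mS : measurable_fun setT S by apply: measurable_funD; exact: measurable_funX.
have iS : lam.-integrable setT (EFin \o S) := integrableD measurableT i1 i2.
have mu2 : measurable_fun setT (fun r => wc r ^+ 2 : MR) by exact: measurable_funX.
have Su : {ae lam, forall x, S x = (fun r => wc r ^+ 2) (enorm x)}.
  apply: filterS aeF => x [x0 [E1 E2]]; rewrite /S E1 E2 !exprMn -mulrDr -mulrDl.
  by rewrite reImP_sqr -exprMn divff ?expr1n ?mulr1// expf_neq0.
have [ir _] := radial_integral mS iS mu2 Su (fun r rr => etrans (congr1 (fun y => y ^+ 2) (wc_out rr)) (expr0n _ _)).
move/integrableP: ir => [_]; apply: le_lt_trans.
rewrite le_eqVlt; apply/orP; left; apply/eqP; apply: eq_integral => r /set_mem rI.
rewrite /= wcI// mulrC ger0_norm//.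
move: rI; rewrite /= in_itv/= => /andP[r0 _].
by rewrite mulr_ge0 ?sqr_ge0// ltW.
Qed.

(* the radial derivative [c_l d_r f1 + s_l d_r f2] *)
Let H x := ext rho g11 x * (x.1 * reP l x / enorm x ^+ l.+1) +
  ext rho g12 x * (x.2 * reP l x / enorm x ^+ l.+1) +
  (ext rho g21 x * (x.1 * imP l x / enorm x ^+ l.+1) +
  ext rho g22 x * (x.2 * imP l x / enorm x ^+ l.+1)).

(* the angular derivative [(c_l d_phi f2 - s_l d_phi f1) / r] *)
Let K x := ext rho g11 x * (x.2 * imP l x / enorm x ^+ l.+1) +
  ext rho g22 x * (x.1 * reP l x / enorm x ^+ l.+1) +
  (ext rho g12 x * (- x.1 * imP l x / enorm x ^+ l.+1) +
  ext rho g21 x * (- x.2 * reP l x / enorm x ^+ l.+1)).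

Let L2H : L2_plane H.
Proof.
by apply: L2_planeD; apply: L2_planeD; apply: L2_plane_angular => //;
  first [exact: norm_fst_le|exact: norm_snd_le|exact: norm_reP_le|exact: norm_imP_le].
Qed.

Let L2K : L2_plane K.
Proof.
have n1 (x : R * R) : `|- x.1| <= enorm x by rewrite normrN norm_fst_le.
have n2 (x : R * R) : `|- x.2| <= enorm x by rewrite normrN norm_snd_le.
have mN1 : measurable_fun setT (fun x : MR * MR => - x.1 : MR) by exact: measurable_funN.
have mN2 : measurable_fun setT (fun x : MR * MR => - x.2 : MR) by exact: measurable_funN.
by apply: L2_planeD; apply: L2_planeD; apply: L2_plane_angular => //;
  first [exact: norm_fst_le|exact: norm_snd_le|exact: norm_reP_le|exact: norm_imP_le].
Qed.

Let test_out phi r : test_function `]0, rho[ phi -> r \notin `]0, rho[ -> phi r = 0.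
Proof.
move=> [_ [X [_ XI phi0]]] rI; apply: phi0 => /XI /= rI'.
by move: rI; rewrite rI'.
Qed.

Let measurable_test phi : test_function `]0, rho[ phi -> measurable_fun setT (phi : MR -> MR).
Proof.
by move=> phiT; apply: continuous_measurable_fun; exact: continuous_test_function phiT.
Qed.

(** In the sum of the two radial pairings [c_l ^ 2 + s_l ^ 2 = 1] leaves [w phi' / r]; the area
    element cancels the [1 / r], which yields the unweighted pairing that defines the distributional
    derivative. *)
Lemma multipole_radial_identity phi : test_function `]0, rho[ phi ->
  mu.-integrable I (EFin \o (fun r => circle_int H r * (phi r / r))) /\
  circle_len * \int[mu]_(r in I) (w r * 'D_1 phi r) =
  - \int[mu]_(r in I) (circle_int H r * (phi r / r)).
Proof.
move=> phiT; have DphiT := test_function_derive phiT.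
have er x : l%:R * (x.1 * reP l.-1 x + x.2 * - imP l.-1 x) = l%:R * reP l x :> R.
  by rewrite mulrN euler_reP.
have dr (x v : R * R) : is_derive x v (reP l) (l%:R * (reP l.-1 x * v.1 + - imP l.-1 x * v.2)).
  by rewrite mulNr; exact: (is_derive_reImP l x v).1.
have di (x v : R * R) := (is_derive_reImP l x v).2.
have [i1 j1 E1] := radial_pairing (T := reP l) dr (fun B X s => (span_reImP l s).1)
  L2f1 L2g11 L2g12 fg11 fg12 phiT er.
have [i2 j2 E2] := radial_pairing (T := imP l) di (fun B X s => (span_reImP l s).2)
  L2f2 L2g21 L2g22 fg21 fg22 phiT (@euler_imP R l).
pose u r : MR := wc r * 'D_1 phi r / r.
have mu1 : measurable_fun setT u.
  apply: measurable_funM; last by apply: measurable_funV; exact: measurable_id.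
  by apply: measurable_funM => //; exact: measurable_test DphiT.
pose S x : MR := ext rho f1 x * (reP l x * rad ('D_1 phi) l.+1 x) +
  ext rho f2 x * (imP l x * rad ('D_1 phi) l.+1 x).
have [mf1 _ _] := L2_ext L2f1; have [mf2 _ _] := L2_ext L2f2.
have iS : lam.-integrable setT (EFin \o S) := integrableD measurableT i1 i2.
have mS : measurable_fun setT S by have /integrableP[/measurable_EFinP] := iS.
have Su : {ae lam, forall x, S x = u (enorm x)}.
  apply: filterS aeF => x [x0 [F1 F2]]; rewrite /S F1 F2 /u /rad.
  have e2 := reImP_sqr l x; transitivity
    (wc (enorm x) * 'D_1 phi (enorm x) / (enorm x ^+ l * enorm x ^+ l.+1) *
      (reP l x ^+ 2 + imP l x ^+ 2)).
    by field; rewrite !expf_neq0.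
  by rewrite e2 exprS; field; rewrite x0 expf_neq0.
have [_ ES] := radial_integral mS iS mu1 Su (fun r rr => etrans (congr1 (fun y => y * 'D_1 phi r / r) (wc_out rr))
  (etrans (congr1 (fun y => y / r) (mul0r _)) (mul0r _))).
pose v r : MR := phi r / r.
have mv : measurable_fun setT v.
  apply: measurable_funM; last by apply: measurable_funV; exact: measurable_id.
  exact: measurable_test phiT.
have [mH iH iH2] := L2H.
have HE : (fun x => H x * v (enorm x)) = (fun x =>
  (ext rho g11 x * x.1 + ext rho g12 x * x.2) * reP l x * rad phi l.+2 x +
  (ext rho g21 x * x.1 + ext rho g22 x * x.2) * imP l x * rad phi l.+2 x).
  apply/funext => x; rewrite /H /v /rad; have [->|x0] := eqVneq (enorm x) 0.
    by rewrite (test_at0 phiT) !mul0r !mulr0 addr0.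
  by rewrite !exprS; field; rewrite x0 expf_neq0.
have iHv : lam.-integrable setT (EFin \o (fun x => H x * v (enorm x))).
  by rewrite HE; exact: (integrableD measurableT j1 j2).
have v0 r : r \notin `]0, rho[ -> v r = 0.
  by move=> rI; rewrite /v (test_out phiT rI) mul0r.
have [iA EA] := weighted_circle_integral mH iH mv iHv v0.
split => //; rewrite -[X in _ = - X]EA HE RintegralD// opprD -E1 -E2 -RintegralD//.
rewrite ES; congr (_ * _); apply: eq_Rintegral => r /set_mem rI.
rewrite /u wcI//; move: rI; rewrite /= in_itv/= => /andP[r0 _].
by field; rewrite gt_eqF.
Qed.

Lemma multipole_H1 : H1_weighted `]0, rho[ id w.
Proof.
split; first exact: multipole_L2.
have [mH iH iH2] := L2H; have mA := measurable_circle_int mH iH.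
(* [circle_int] contains the length element [r], so this quotient is the average of [H] over the
   circle; [g ^ 2 * r] is then a constant times [circle_int H r ^ 2 / r]. *)
pose g r : MR := circle_int H r / (circle_len * r).
have mg : measurable_fun setT g.
  by apply: measurable_funM => //; apply: measurable_funV; exact: measurable_funM.
exists g; split.
  split; first exact: measurable_funTS.
  have [_ fin] := L2_circle_int rho mH iH iH2.
  have cc : (0 <= ((@circle_len R) ^- 2)%:E)%E by rewrite lee_fin invr_ge0 sqr_ge0.
  have : (((@circle_len R) ^- 2)%:E * \int[lebesgue1]_(r in I) (circle_int H r ^+ 2 * r^-1)%:E < +oo)%E.
    by rewrite lte_mul_pinfty.
  rewrite -ge0_integralZl//; last 2 first.
  - apply/measurable_EFinP; apply: measurable_funTS; apply: measurable_funM.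
      exact: measurable_funX.
    by apply: measurable_funV; exact: measurable_id.
  - move=> r; rewrite /= in_itv/= => /andP[r0 _].
    by rewrite lee_fin mulr_ge0 ?sqr_ge0// invr_ge0 ltW.
  apply: le_lt_trans; rewrite le_eqVlt; apply/orP; left; apply/eqP.
  apply: eq_integral => r /set_mem; rewrite /= in_itv/= => /andP[r0 _].
  by rewrite -EFinM /g; congr EFin; field; rewrite !gt_eqF.
move=> phi phiT; have [iA EA] := multipole_radial_identity phiT.
have -> : \int[lebesgue1]_(x in I) (g x * phi x) =
    circle_len^-1 * \int[mu]_(r in I) (circle_int H r * (phi r / r)).
  rewrite -RintegralZl//; apply: eq_Rintegral => r /set_mem; rewrite /= in_itv/= => /andP[r0 _].
  by rewrite /g; field; rewrite !gt_eqF.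
by rewrite -mulrN -EA mulKf// gt_eqF.
Qed.

(** The tests are crossed, [f1] with [imP l] and [f2] with [reP l], because the angular derivative
    exchanges these two up to sign. The difference of the pairings contains
    [l (c_l ^ 2 + s_l ^ 2) w = l w]. *)
Lemma multipole_angular_identity phi : test_function `]0, rho[ phi ->
  [/\ mu.-integrable I (EFin \o (fun r => circle_int K r * (r * phi r))),
    mu.-integrable I (EFin \o (fun r => l%:R * circle_len * r * w r * phi r)) &
  \int[mu]_(r in I) (l%:R * circle_len * r * w r * phi r) =
  \int[mu]_(r in I) (circle_int K r * (r * phi r))].
Proof.
move=> phiT.
have ar x : l%:R * (- x.2 * reP l.-1 x + x.1 * - imP l.-1 x) = l%:R * - imP l x :> R.
  by rewrite [RHS]mulrN -euler_imP; ring.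
have ai x : l%:R * (- x.2 * imP l.-1 x + x.1 * reP l.-1 x) = l%:R * reP l x :> R.
  by rewrite -euler_reP; ring.
have dr (x v : R * R) : is_derive x v (reP l) (l%:R * (reP l.-1 x * v.1 + - imP l.-1 x * v.2)).
  by rewrite mulNr; exact: (is_derive_reImP l x v).1.
have di (x v : R * R) := (is_derive_reImP l x v).2.
have [i1 j1 E1] := angular_pairing (T := imP l) di (fun B X s => (span_reImP l s).2)
  L2f1 L2g11 L2g12 fg11 fg12 phiT (T' := reP l) ai.
have [i2 j2 E2] := angular_pairing (T := reP l) dr (fun B X s => (span_reImP l s).1)
  L2f2 L2g21 L2g22 fg21 fg22 phiT (T' := fun x => - imP l x) ar.
pose u r : MR := l%:R * (wc r * phi r).
have mu1 : measurable_fun setT u.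
  apply: measurable_funM; first exact: measurable_cst.
  by apply: measurable_funM => //; exact: measurable_test phiT.
pose S x : MR := ext rho f1 x * (l%:R * reP l x * rad phi l x) -
  ext rho f2 x * (l%:R * - imP l x * rad phi l x).
have iS : lam.-integrable setT (EFin \o S) := integrableB measurableT i1 i2.
have mS : measurable_fun setT S by have /integrableP[/measurable_EFinP] := iS.
have Su : {ae lam, forall x, S x = u (enorm x)}.
  apply: filterS aeF => x [x0 [F1 F2]]; rewrite /S F1 F2 /u /rad.
  have e2 := reImP_sqr l x; transitivity
    (l%:R * wc (enorm x) * phi (enorm x) / (enorm x ^+ l * enorm x ^+ l) *
      (reP l x ^+ 2 + imP l x ^+ 2)).
    by field; rewrite !expf_neq0.
  by rewrite e2; field; rewrite expf_neq0.
have u0 r : rho <= r -> u r = 0 by move=> rr; rewrite /u wc_out// mul0r mulr0.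
have [ir ES] := radial_integral mS iS mu1 Su u0.
pose v r : MR := r * phi r.
have mv : measurable_fun setT v.
  by apply: measurable_funM; [exact: measurable_id|exact: measurable_test phiT].
have [mK iK iK2] := L2K.
have KE : (fun x => K x * v (enorm x)) = (fun x =>
  (x.1 * ext rho g22 x - x.2 * ext rho g21 x) * reP l x * rad phi l x -
  (x.1 * ext rho g12 x - x.2 * ext rho g11 x) * imP l x * rad phi l x).
  apply/funext => x; rewrite /K /v /rad; have [->|x0] := eqVneq (enorm x) 0.
    by rewrite (test_at0 phiT) !mul0r !mulr0 subr0.
  by rewrite !exprS; field; rewrite x0 expf_neq0.
have iKv : lam.-integrable setT (EFin \o (fun x => K x * v (enorm x))).
  by rewrite KE; exact: (integrableB measurableT j2 j1).
have v0 r : r \notin `]0, rho[ -> v r = 0.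
  by move=> rI; rewrite /v (test_out phiT rI) mulr0.
have [iA EA] := weighted_circle_integral mK iK mv iKv v0.
have uE r : r \in `]0, rho[ ->
    l%:R * circle_len * r * w r * phi r = circle_len * (r * u r) :> R.
  by move=> rI; rewrite /u wcI//; ring.
split => //.
  apply: (eq_integrable mI (EFin \o (fun r => circle_len * (r * u r)))).
    by move=> r /set_mem rI; rewrite /= uE.
  exact: (integrableZl mI circle_len ir).
rewrite -[RHS]EA KE RintegralB// -[X in _ = X - _]opprK -E2 -[X in _ = _ - X]opprK -E1.
rewrite opprK addrC -RintegralB// ES -RintegralZl//.
by apply: eq_Rintegral => r /set_mem rI; rewrite uE.
Qed.

(** The angular identity for all test functions gives [l w / r] as the average of [K] for almost
    every [r]; division by [l > 0] then transfers the bound on circle integrals to [w]. *)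
Lemma multipole_inv_L2 : (0 < l)%N ->
  L2_weighted (@lebesgue1 R) `]0, rho[ (fun r => r^-1) w.
Proof.
move=> l0; have lR : 0 < l%:R :> R by rewrite ltr0n.
have [mK iK iK2] := L2K; have mA := measurable_circle_int mK iK.
have [iA _] := integral_circle_int mK iK.
pose h r : MR := l%:R * circle_len * (r * w r) - circle_int K r * r.
have mr1 : measurable_fun setT (fun r : MR => r) by exact: measurable_id.
(* The fundamental lemma needs an integrable [h]; here [r |w| <= r (1 + w ^ 2)] is used on the
   bounded interval. *)
have irw : mu.-integrable I (EFin \o (fun r => r * w r)).
  have [_ fin] := multipole_L2.
  have iw2 : mu.-integrable I (EFin \o (fun r => w r ^+ 2 * r)).
    apply/integrableP; split.
      apply/measurable_EFinP; apply: measurable_funTS; apply: measurable_funM => //.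
      exact: measurable_funX.
    apply: le_lt_trans fin; rewrite le_eqVlt; apply/orP; left; apply/eqP.
    apply: eq_integral => r /set_mem; rewrite /= in_itv/= => /andP[r0 _].
    by rewrite /= ger0_norm// mulr_ge0 ?sqr_ge0// ltW.
  have irho : mu.-integrable I (EFin \o (cst rho : MR -> MR)).
    apply: measurable_bounded_integrable => //.
    - rewrite [ltLHS](_ : _ = @lebesgue_measure R `]0, rho[)// lebesgue_measure_itv/=.
      by case: ifP => _; rewrite ?ltry// -EFinD ltry.
    - by exists `|rho|; split=> // M rM x _; exact: ltW.
  have := integrableD mI irho iw2; apply: le_integrable => //.
    by apply/measurable_EFinP; apply: measurable_funTS; exact: measurable_funM.
  move=> r; rewrite /= in_itv/= => /andP[r0 rrho]; rewrite lee_fin.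
  have ge0 : 0 <= rho + w r ^+ 2 * r.
    have rho0 := ltW (lt_trans r0 rrho).
    by apply: addr_ge0 => //; apply: mulr_ge0; [exact: sqr_ge0|exact: ltW].
  rewrite /cst (ger0_norm ge0) normrM (gtr0_norm r0) -(real_normK (num_real (w r))).
  have := normr_ge0 (w r); set a := `|w r| => a0.
  have : 0 <= r * (1 - a) ^+ 2 by rewrite mulr_ge0 ?sqr_ge0// ltW.
  have : 0 <= r * a by rewrite mulr_ge0// ltW.
  rewrite (_ : r * (1 - a) ^+ 2 = r - 2 * (r * a) + a ^+ 2 * r); last by ring.
  by lra.
have iAr : mu.-integrable I (EFin \o (fun r => circle_int K r * r)).
  have := integrableZl mI rho (integrableS measurableT mI (@subsetT _ _) iA).
  apply: le_integrable => //.
    by apply/measurable_EFinP; apply: measurable_funTS; exact: measurable_funM.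
  move=> r; rewrite /= in_itv/= => /andP[r0 rrho]; rewrite lee_fin !normrM mulrC.
  by rewrite ler_wpM2r// !gtr0_norm// ?(lt_trans r0 rrho)// ltW.
have ih : mu.-integrable I (EFin \o h).
  exact: (integrableB mI (integrableZl mI (l%:R * circle_len) irw) iAr).
have h0 : {ae mu, forall r : R, r \in `]0, rho[ -> h r = 0}.
  apply: (test_orthogonal_ae0 ih) => phi phiT.
  have [j1 j2 E] := multipole_angular_identity phiT.
  have -> : \int[mu]_(r in I) (h r * phi r) = \int[mu]_(r in I)
      (l%:R * circle_len * r * w r * phi r - circle_int K r * (r * phi r)).
    by apply: eq_Rintegral => r _; rewrite /h; ring.
  by rewrite RintegralB// E subrr.
split; first exact: measurable_funTS.
have [_ fin] := L2_circle_int rho mK iK iK2.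
have cc : (0 <= ((l%:R * @circle_len R) ^- 2)%:E)%E by rewrite lee_fin invr_ge0 sqr_ge0.
have : (((l%:R * @circle_len R) ^- 2)%:E * \int[lebesgue1]_(r in I) (circle_int K r ^+ 2 * r^-1)%:E < +oo)%E.
  by rewrite lte_mul_pinfty.
rewrite -ge0_integralZl//; last 2 first.
- apply/measurable_EFinP; apply: measurable_funTS; apply: measurable_funM.
    exact: measurable_funX.
  by apply: measurable_funV; exact: measurable_id.
- move=> r; rewrite /= in_itv/= => /andP[r0 _].
  by rewrite lee_fin mulr_ge0 ?sqr_ge0// invr_ge0 ltW.
apply: le_lt_trans; rewrite le_eqVlt; apply/orP; left; apply/eqP.
apply: ae_eq_integral => //.
- apply/measurable_EFinP; apply: measurable_funTS; apply: measurable_funM.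
    exact: measurable_funX.
  by apply: measurable_funV; exact: measurable_id.
- apply: emeasurable_funM => //; apply/measurable_EFinP; apply: measurable_funTS; apply: measurable_funM.
    exact: measurable_funX.
  by apply: measurable_funV; exact: measurable_id.
have FF := ae_filter_ringOfSetsType mu; apply: filterS h0 => r Hr rI.
have := Hr rI; move: rI; rewrite /= in_itv/= => /andP[r0 _].
rewrite /h => /eqP; rewrite subr_eq0 => /eqP E; rewrite -EFinM; congr EFin.
have -> : circle_int K r = l%:R * circle_len * w r.
  by apply: (mulIf (lt0r_neq0 r0)); rewrite -E; ring.
by field; rewrite !gt_eqF.
Qed.

End multipole.

(** * Symmetric tensors *)

Section polar_angle.
Context {R : realType}.

Lemma polar_angle (c s : R) : c ^+ 2 + s ^+ 2 = 1 ->
  exists2 psi, 0 <= psi < 2 * pi & c = cos psi /\ s = sin psi.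
Proof.
move=> cs; have c11 : -1 <= c <= 1.
  rewrite -ler_norml -(@expr_le1 _ 2)// -normrX ger0_norm ?sqr_ge0// -cs lerDl.
  exact: sqr_ge0.
have sq : Num.sqrt (1 - c ^+ 2) = `|s| by rewrite -cs addrC addKr sqrtr_sqr.
have p0 := @pi_gt0 R.
have [s0|s0] := leP 0 s.
  exists (acos c); last by rewrite acosK// sin_acos// sq ger0_norm.
  by rewrite acos_ge0//= (le_lt_trans (acos_lepi c11))//; lra.
exists (2 * pi - acos c).
  (* The angle must stay below [2 * pi]; [acos c = 0] would force [c = 1] and [s = 0]. *)
  have a0 : 0 < acos c.
    rewrite lt_def acos_ge0// andbT; apply/eqP => a0.
    have c1 : c = 1 by rewrite -(acosK c11) a0 cos0.
    move: cs; rewrite c1 expr1n => /eqP; rewrite -subr_eq0 addrAC subrr add0r sqrf_eq0 => /eqP s00.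
    by rewrite s00 ltxx in s0.
  by have := acos_lepi c11; lra.
have e2 : 2 * pi - acos c = - acos c + pi + pi by ring.
rewrite e2 !cosDpi !sinDpi !opprK cosN sinN acosK// sin_acos// sq ltr0_norm//.
by rewrite opprK.
Qed.

Lemma polar_coord (x : R * R) : enorm x != 0 ->
  exists2 phi, 0 <= phi < 2 * pi & x = (enorm x * cos phi, enorm x * sin phi).
Proof.
move=> x0; have [|phi p0 [c s]] := @polar_angle (x.1 / enorm x) (x.2 / enorm x).
  by rewrite !expr_div_n -mulrDl -enorm_sqr divff// expf_neq0.
exists phi => //; rewrite -c -s !mulrA ![enorm x * _]mulrC !mulfK//.
by case: x {x0 c s}.
Qed.

Lemma cpow_rot2 l (psi : R) x :
  reP l (rot2 (cos psi) (sin psi) x) = cos (l%:R * psi) * reP l x - sin (l%:R * psi) * imP l x /\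
  imP l (rot2 (cos psi) (sin psi) x) = sin (l%:R * psi) * reP l x + cos (l%:R * psi) * imP l x.
Proof.
elim: l => [|l []].
  by rewrite mul0r cos0 sin0 /reP /imP /=; split; ring.
rewrite -natr1 mulrDl mul1r cosD sinD /reP /imP /= => -> ->.
by split; ring.
Qed.

Lemma cpow_refl2 l (x : R * R) : reP l (refl2 x) = reP l x /\ imP l (refl2 x) = - imP l x.
Proof.
elim: l => [|l []]; rewrite /reP /imP /=; first by rewrite oppr0.
by move=> -> ->; split; ring.
Qed.

Lemma cpow_real l (r : R) : reP l (r, 0) = r ^+ l /\ imP l (r, 0) = 0.
Proof.
elim: l => [|l [IHr IHi]] //; move: IHr IHi; rewrite /reP /imP /= => -> ->.
by rewrite !mul0r mulr0 subr0 addr0 exprS.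
Qed.

Lemma cpow_polar l (r phi : R) :
  reP l (r * cos phi, r * sin phi) = r ^+ l * cos (l%:R * phi) /\
  imP l (r * cos phi, r * sin phi) = r ^+ l * sin (l%:R * phi).
Proof.
have -> : (r * cos phi, r * sin phi) = rot2 (cos phi) (sin phi) (r, 0).
  by rewrite /rot2 /= !mulr0 subr0 addr0 ![r * _]mulrC.
have [-> ->] := cpow_rot2 l phi (r, 0); have [-> ->] := cpow_real l r.
by rewrite !mulr0 subr0 addr0 ![r ^+ l * _]mulrC.
Qed.

(** [E1] is quadratic in [n], so its entries have twice the frequency of [n]. *)
Lemma cpow_double l (x : R * R) :
  reP (l + l) x = reP l x ^+ 2 - imP l x ^+ 2 /\ imP (l + l) x = 2 * reP l x * imP l x.
Proof.
suff H n : reP (l + n) x = reP l x * reP n x - imP l x * imP n x /\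
    imP (l + n) x = reP l x * imP n x + imP l x * reP n x.
  by have [-> ->] := H l; split; ring.
elim: l => [|l [IHr IHi]].
  by rewrite /reP /imP /= !mul1r !mul0r subr0 addr0.
by rewrite addSn; move: IHr IHi; rewrite /reP /imP /= => -> ->; split; ring.
Qed.

Lemma enorm_polar (r phi : R) : 0 <= r -> enorm (r * cos phi, r * sin phi) = r.
Proof.
move=> r0; rewrite /enorm /= !exprMn -mulrDr cos2Dsin2 mulr1 sqrtr_sqr ger0_norm//.
Qed.

End polar_angle.

(** * Algebra of the tensors [E0], [E1], [E3] *)

Section tensors3.
Context {R : realType}.
Implicit Types (M A B : 'M[R]_3) (c s : R).

Lemma ord3P (P : 'I_3 -> Prop) : P 0 -> P 1 -> P 2 -> forall i, P i.
Proof.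
move=> P0 P1 P2 i; case: i => [[|[|[|//]]] i3].
- by rewrite (_ : Ordinal i3 = 0)//; exact: val_inj.
- by rewrite (_ : Ordinal i3 = 1)//; exact: val_inj.
- by rewrite (_ : Ordinal i3 = 2)//; exact: val_inj.
Qed.

Lemma sum3E (F : 'I_3 -> R) : \sum_i F i = F 0 + F 1 + F 2.
Proof.
rewrite !big_ord_recl big_ord0 addr0 addrA.
by congr (F _ + F _ + F _); exact: val_inj.
Qed.

(** [rot_e3] with free cosine and sine, which are later quotients of polynomials by powers of
    [|x|]. *)
Definition rotm c s : 'M[R]_3 :=
  \matrix_(i < 3, j < 3)
    (nth [::] [:: [:: c; - s; 0]; [:: s; c; 0]; [:: 0; 0; 1]] i)`_j.

(* [w0 E0 + w1 E1 + w3 E3] with [n = (c, s, 0)]. *)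
Definition rep (w0 w1 w3 c s : R) : 'M[R]_3 :=
  w0 *: E0 +
  w1 *: (Num.sqrt 2 *: (tens (vec3 c s 0) (vec3 c s 0) - (1 / 2) *: I2)) +
  w3 *: ((1 / Num.sqrt 2) *: (tens (vec3 c s 0) e3 + tens e3 (vec3 c s 0))).

Lemma tens_conj M (u v : 'cV[R]_3) : M^T *m tens u v *m M = tens (M^T *m u) (M^T *m v).
Proof. by rewrite /tens trmx_mul trmxK !mulmxA. Qed.

(** [rep] is built from the identity, [e3] and [n] alone; conjugation by an orthogonal matrix that
    fixes [e3] therefore only moves [n]. *)
Lemma rep_conj M w0 w1 w3 c s c' s' : M^T *m M = 1%:M -> M^T *m e3 = e3 ->
  M *m vec3 c s 0 = vec3 c' s' 0 ->
  M^T *m rep w0 w1 w3 c' s' *m M = rep w0 w1 w3 c s.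
Proof.
move=> MM Me Mn.
have Mn' : M^T *m vec3 c' s' 0 = vec3 c s 0 by rewrite -Mn mulmxA MM mul1mx.
have lin (a : R) A : M^T *m (a *: A) *m M = a *: (M^T *m A *m M).
  by rewrite -scalemxAr -scalemxAl.
have linD A B : M^T *m (A + B) *m M = M^T *m A *m M + M^T *m B *m M.
  by rewrite mulmxDr mulmxDl.
have linN A : M^T *m (- A) *m M = - (M^T *m A *m M) by rewrite mulmxN mulNmx.
rewrite /rep /E0 /I2 !(lin, linD, linN) !tens_conj Me Mn'.
by rewrite mulmx1 MM.
Qed.

Lemma rotm_mul c s c' s' :
  rotm c s *m rotm c' s' = rotm (c * c' - s * s') (s * c' + c * s').
Proof.
apply/matrixP; apply: ord3P; apply: ord3P; rewrite !mxE sum3E !mxE /=; ring.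
Qed.

Lemma rotm_tr c s : (rotm c s)^T = rotm c (- s).
Proof.
apply/matrixP; apply: ord3P; apply: ord3P; rewrite !mxE /=; ring.
Qed.

Lemma rotm_orth c s : c ^+ 2 + s ^+ 2 = 1 -> (rotm c s)^T *m rotm c s = 1%:M.
Proof.
move=> cs; rewrite rotm_tr rotm_mul; apply/matrixP; apply: ord3P; apply: ord3P;
  rewrite !mxE /= ?mulNr ?opprK -?expr2 ?cs; ring.
Qed.

Lemma rotm_e3 c s : rotm c s *m e3 = e3.
Proof.
apply/matrixP; apply: ord3P => j; rewrite !mxE sum3E !mxE /=; ring.
Qed.

Lemma rotm_vec3 c s a b :
  rotm c s *m vec3 a b 0 = vec3 (c * a - s * b) (s * a + c * b) 0.
Proof.
apply/matrixP; apply: ord3P => j; rewrite !mxE sum3E !mxE /=; ring.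
Qed.

Lemma Lmx_mul A i j : (Lmx *m A) i j = (if i == 1 then - A i j else A i j).
Proof.
rewrite /Lmx mul_diag_mx !mxE; move: i; apply: ord3P => /=; ring.
Qed.

Lemma mul_Lmx A i j : (A *m Lmx) i j = (if j == 1 then - A i j else A i j).
Proof.
rewrite /Lmx mul_mx_diag !mxE; move: j; apply: ord3P => /=; ring.
Qed.

Lemma LmxT : (@Lmx R)^T = Lmx. Proof. exact: tr_diag_mx. Qed.

Lemma Lmx_sqr : (@Lmx R) *m Lmx = 1%:M.
Proof.
apply/matrixP; apply: ord3P; apply: ord3P; rewrite Lmx_mul !mxE /=; ring.
Qed.

Lemma Lmx_e3 : (@Lmx R) *m e3 = e3.
Proof.
apply/matrixP; apply: ord3P => j; rewrite !mxE sum3E !mxE /=; ring.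
Qed.

Lemma Lmx_vec3 (a b : R) : Lmx *m vec3 a b 0 = vec3 a (- b) 0.
Proof.
apply/matrixP; apply: ord3P => j; rewrite !mxE sum3E !mxE /=; ring.
Qed.

Lemma rotm_Lmx c s : Lmx *m rotm c s *m Lmx = rotm c (- s).
Proof.
apply/matrixP; apply: ord3P; apply: ord3P; rewrite mul_Lmx Lmx_mul !mxE /=; ring.
Qed.

(** This entry and the combinations below isolate one profile each: [w0] without angular factor,
    [w3] with that of [n], [w1] with the doubled angle. *)
Lemma rep22 w0 w1 w3 c s : rep w0 w1 w3 c s 2 2 = Num.sqrt (3 / 2) * (2 / 3) * w0.
Proof. rewrite /rep /E0 /I2 /tens !mxE !big_ord1 !mxE /=; field.
by rewrite gt_eqF// sqrtr_gt0. Qed.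

Lemma rep02 w0 w1 w3 c s : rep w0 w1 w3 c s 0 2 = w3 * c / Num.sqrt 2.
Proof. rewrite /rep /E0 /I2 /tens !mxE !big_ord1 !mxE /=; ring. Qed.

Lemma rep12 w0 w1 w3 c s : rep w0 w1 w3 c s 1 2 = w3 * s / Num.sqrt 2.
Proof. rewrite /rep /E0 /I2 /tens !mxE !big_ord1 !mxE /=; ring. Qed.

Lemma rep01 w0 w1 w3 c s : rep w0 w1 w3 c s 0 1 = Num.sqrt 2 * w1 * c * s.
Proof. rewrite /rep /E0 /I2 /tens !mxE !big_ord1 !mxE /=; ring. Qed.

Lemma rep00B11 w0 w1 w3 c s : rep w0 w1 w3 c s 0 0 - rep w0 w1 w3 c s 1 1 =
  Num.sqrt 2 * w1 * (c ^+ 2 - s ^+ 2).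
Proof. rewrite /rep /E0 /I2 /tens !mxE !big_ord1 !mxE /=; ring. Qed.

Lemma sqrt2_gt0 : 0 < Num.sqrt (2 : R). Proof. by rewrite sqrtr_gt0. Qed.

Lemma sqrt32_gt0 : 0 < Num.sqrt (3 / 2 : R).
Proof. by rewrite sqrtr_gt0 divr_gt0. Qed.

(** Conjugation by [Lmx] changes the sign of the entries [0 1] and [1 2], so both vanish. The three
    remaining dimensions of symmetric traceless matrices are spanned by the tensors with
    [n = (1, 0, 0)]. *)
Lemma rep_fixed A : A = A^T -> \tr A = 0 -> A = Lmx *m A *m Lmx ->
  A = rep (Num.sqrt (3 / 2) * A 2 2) ((A 0 0 - A 1 1) / Num.sqrt 2)
    (Num.sqrt 2 * A 0 2) 1 0.
Proof.
move=> AT trA AL.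
have sym i j : A i j = A j i by rewrite {1}AT mxE.
have z01 : A 0 1 = 0.
  by have := congr1 (fun B : 'M[R]_3 => B 0 1) AL; rewrite /= mul_Lmx /= Lmx_mul /=; lra.
have z12 : A 1 2 = 0.
  by have := congr1 (fun B : 'M[R]_3 => B 1 2) AL; rewrite /= mul_Lmx /= Lmx_mul /=; lra.
have tr0 : A 0 0 + A 1 1 + A 2 2 = 0 by rewrite -trA /mxtrace sum3E.
have s2 := sqrt2_gt0; have s32 := sqrt32_gt0.
have q2 : Num.sqrt (2 : R) ^+ 2 = 2 by rewrite sqr_sqrtr.
have q32 : Num.sqrt (3 / 2 : R) ^+ 2 = 3 / 2 by rewrite sqr_sqrtr// divr_ge0.
have a00 : A 0 0 = - A 2 2 / 2 + (A 0 0 - A 1 1) / 2 by lra.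
have a11 : A 1 1 = - A 2 2 / 2 - (A 0 0 - A 1 1) / 2 by lra.
apply/matrixP; apply: ord3P; apply: ord3P; rewrite /rep /E0 /I2 /tens !mxE !big_ord1 !mxE /= ?(sym 1 0) ?(sym 2 0) ?(sym 2 1) ?z01 ?z12.
- transitivity (- (Num.sqrt (3 / 2) ^+ 2 * A 2 2 / 3) + (A 0 0 - A 1 1) / 2).
    by rewrite q32; lra.
  by field; rewrite gt_eqF.
- by field; rewrite gt_eqF.
- by field; rewrite gt_eqF.
- by field; rewrite gt_eqF.
- transitivity (- (Num.sqrt (3 / 2) ^+ 2 * A 2 2 / 3) - (A 0 0 - A 1 1) / 2).
    by rewrite q32; lra.
  by field; rewrite gt_eqF.
- by field; rewrite gt_eqF.
- by field; rewrite gt_eqF.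
- by field; rewrite gt_eqF.
- transitivity (Num.sqrt (3 / 2) ^+ 2 * A 2 2 * 2 / 3); first by rewrite q32; field.
  by field; rewrite gt_eqF.
Qed.

End tensors3.

(** The sign of [k] is split off so that complex powers have a natural exponent [l]; it enters the
    frame only through the sine. *)
Lemma even_int_half {R : realType} (k : int) : (2 %| k)%Z -> k != 0 ->
  exists (l : nat) (sg : R), [/\ (0 < l)%N, sg = 1 \/ sg = -1 & k%:~R / 2 = sg * l%:R].
Proof.
move=> /dvdzP[m ->] k0; have m0 : m != 0 by move: k0; rewrite mulf_eq0 negb_or => /andP[].
exists `|m|%N, (sgz m)%:~R; split; first by rewrite absz_gt0.
  by have [] := sgzP m; [move=> m0'; rewrite m0' in m0|left|right].
rewrite {1}[m]intEsg !rmorphM /= -pmulrn mulfK//.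
Qed.

(** * The rotating frame and the symmetry of tensors of the stated form *)

Section symmetry.
Context {R : realType}.
Local Notation MR := (measurableTypeR R).
Local Notation lam := (@lebesgue2 R).
Variables (rho : R) (k : int) (l : nat) (sg : R).
Hypotheses (sgP : sg = 1 \/ sg = -1) (kl : k%:~R / 2 = sg * l%:R).

(* [cos (k phi / 2)] and [sin (k phi / 2)] at the polar angle [phi] of [x]. *)
Definition cosk x : R := reP l x / enorm x ^+ l.
Definition sink x : R := sg * (imP l x / enorm x ^+ l).

Let sg2 : sg ^+ 2 = 1. Proof. by case: sgP => ->; rewrite ?sqrrN expr1n. Qed.

Lemma cosk2Dsink2 x : enorm x != 0 -> cosk x ^+ 2 + sink x ^+ 2 = 1.
Proof.
move=> x0; rewrite /cosk /sink [(sg * _) ^+ 2]exprMn sg2 mul1r !expr_div_n -mulrDl reImP_sqr.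
by rewrite divff// expf_neq0// expf_neq0.
Qed.

Lemma cosk_angle (psi : R) : cos (k%:~R / 2 * psi) = cos (l%:R * psi) /\
  sin (k%:~R / 2 * psi) = sg * sin (l%:R * psi).
Proof.
rewrite kl; case: sgP => ->; first by rewrite !mul1r.
by rewrite !mulN1r mulNr cosN sinN.
Qed.

Lemma cosk_polar (r phi : R) : 0 < r ->
  cosk (r * cos phi, r * sin phi) = cos (k%:~R * phi / 2) /\
  sink (r * cos phi, r * sin phi) = sin (k%:~R * phi / 2).
Proof.
move=> r0; rewrite mulrAC /cosk /sink enorm_polar ?ltW//.
have [-> ->] := cosk_angle phi; have [-> ->] := cpow_polar l r phi.
by split; field; rewrite expf_neq0// gt_eqF.
Qed.

Lemma cosk_rot2 (psi : R) x : let c := cos (k%:~R / 2 * psi) in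
  let s := sin (k%:~R / 2 * psi) in
  cosk (rot2 (cos psi) (sin psi) x) = c * cosk x - s * sink x /\
  sink (rot2 (cos psi) (sin psi) x) = s * cosk x + c * sink x.
Proof.
rewrite /cosk /sink /=; have [-> ->] := cosk_angle psi; have [-> ->] := cpow_rot2 l psi x.
rewrite enorm_rot2 ?cos2Dsin2//; split; last by ring.
rewrite mulrBl; congr (_ - _); first by ring.
transitivity (sg ^+ 2 * (sin (l%:R * psi) * imP l x / enorm x ^+ l)); last by ring.
by rewrite sg2 mul1r.
Qed.

Lemma cosk_refl2 x : cosk (refl2 x) = cosk x /\ sink (refl2 x) = - sink x.
Proof.
rewrite /cosk /sink enorm_refl2; have [-> ->] := cpow_refl2 l x.
by split=> //; ring.
Qed.

Lemma Rk_rotm (j : int) (psi : R) :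
  Rk j psi = rotm (cos (j%:~R / 2 * psi)) (sin (j%:~R / 2 * psi)).
Proof. by []. Qed.

Lemma Rk2_lift3 (psi : R) x : P2 (Rk 2 psi *m lift3 x) = rot2 (cos psi) (sin psi) x.
Proof. by rewrite Rk_rotm divff// mul1r rotm_vec3 /P2 !mxE. Qed.

Lemma Qact_rot (psi : R) Q x : Qact k 0 psi Q x =
  (Rk k psi)^T *m Q (rot2 (cos psi) (sin psi) x) *m Rk k psi.
Proof. by rewrite /Qact expr0 mulmx1 mulmx1 mul1mx Rk2_lift3. Qed.

Lemma Qact_rot_refl (psi : R) Q x : Qact k 1 psi Q x =
  (Rk k psi *m Lmx)^T *m Q (rot2 (cos psi) (sin psi) (refl2 x)) *m (Rk k psi *m Lmx).
Proof.
rewrite /Qact expr1; have -> : Rk 2 psi *m Lmx *m lift3 x = Rk 2 psi *m lift3 (refl2 x).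
  by rewrite -mulmxA Lmx_vec3.
rewrite Rk2_lift3.
by rewrite trmx_mul LmxT !mulmxA.
Qed.

(** Almost every point and its image both satisfy the formula, as isometries preserve null sets. The
    matrix of [Qact] carries the frame vector [n] at the point to the one at its image, so
    [rep_conj] applies. *)
Lemma rep_O2_symmetric (Q : R * R -> 'M[R]_3) (w0 w1 w3 : R -> R) :
  {ae lam, forall x : R * R, disk rho x ->
    forall r phi : R, 0 < r -> 0 <= phi < 2 * pi -> x = (r * cos phi, r * sin phi) ->
    Q x = w0 r *: E0 + w1 r *: E1 k phi + w3 r *: E3 k phi} ->
  O2_symmetric rho k Q.
Proof.
move=> HQ alpha psi _.
pose Rep x := disk rho x -> enorm x != 0 ->
  Q x = rep (w0 (enorm x)) (w1 (enorm x)) (w3 (enorm x)) (cosk x) (sink x).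
have aeRep : {ae lam, forall x, Rep x}.
  apply: filterS HQ => x H Dx x0; have [phi p0 xE] := polar_coord x0.
  have e0 : 0 < enorm x by rewrite lt_def x0 enorm_ge0.
  rewrite (H Dx _ phi e0 p0 xE).
  have [cE sE] := cosk_polar phi e0; rewrite -xE in cE sE.
  by rewrite cE sE.
have cs := cos2Dsin2 psi.
have cs' := cos2Dsin2 (k%:~R / 2 * psi).
have aeRot := ae_rot2 cs aeRep.
case: alpha => [[|[|//]] i2].
- rewrite (_ : Ordinal i2 = 0); last exact: val_inj.
  apply: filterS3 (@ae_enorm_neq0 R) aeRep aeRot => x x0 Hx Hy Dx.
  have eE : enorm (rot2 (cos psi) (sin psi) x) = enorm x by rewrite enorm_rot2.
  rewrite Qact_rot (Hx Dx x0) Hy ?enorm_disk ?eE//.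
  apply/esym/rep_conj; rewrite Rk_rotm ?rotm_orth// ?rotm_tr ?rotm_e3// rotm_vec3.
  by have [-> ->] := cosk_rot2 psi x.
- rewrite (_ : Ordinal i2 = 1); last exact: val_inj.
  have aeRR := ae_refl2 aeRot.
  apply: filterS3 (@ae_enorm_neq0 R) aeRep aeRR => x x0 Hx Hy Dx.
  have eE : enorm (rot2 (cos psi) (sin psi) (refl2 x)) = enorm x.
    by rewrite enorm_rot2// enorm_refl2.
  rewrite Qact_rot_refl (Hx Dx x0) Hy ?enorm_disk ?eE//.
  apply/esym/rep_conj.
  - rewrite trmx_mul LmxT Rk_rotm mulmxA -(mulmxA Lmx) rotm_orth//.
    by rewrite mulmx1 Lmx_sqr.
  - by rewrite trmx_mul LmxT Rk_rotm rotm_tr -mulmxA rotm_e3 Lmx_e3.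
  - rewrite -mulmxA Lmx_vec3 Rk_rotm rotm_vec3.
    have [-> ->] := cosk_rot2 psi (refl2 x); have [-> ->] := cosk_refl2 x.
    by [].
Qed.

End symmetry.

(** * Linear combinations of Sobolev entries *)

Section sobolev_combinations.
Context {R : realType}.
Local Notation MR := (measurableTypeR R).
Local Notation lam := (@lebesgue2 R).
Variable rho : R.

Lemma L2_plane_weighted (f : R * R -> R) : L2_plane (ext rho f) ->
  L2_weighted lam (disk rho) (fun=> 1) f.
Proof.
move=> [me _ /integrableP[_ fin]]; have mD := @measurable_disk R rho.
split; first exact/(measurable_restrictT _ mD).
move: fin; apply: le_lt_trans; rewrite le_eqVlt; apply/orP; left; apply/eqP.
rewrite [LHS]integral_mkcond; apply: eq_integral => x _; rewrite patchE /= /ext patchE.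
by case: ifP => _; rewrite /= ?mulr1 ?expr0n ger0_norm// sqr_ge0.
Qed.

Lemma L2_planeZ (a : R) (h : MR * MR -> MR) : L2_plane h -> L2_plane (fun x => a * h x).
Proof.
move=> [mh ih ih2]; have mah : measurable_fun setT (fun x => a * h x : MR).
  exact: (measurable_funM (measurable_cst a) mh).
split => //; first exact: (integrableZl measurableT a ih).
have -> : (fun x => (a * h x) ^+ 2) = (fun x => a ^+ 2 * h x ^+ 2).
  by apply/funext => x; rewrite exprMn.
exact: (integrableZl measurableT (a ^+ 2) ih2).
Qed.

Lemma L2_weighted_comb (a b : R) (f g : R * R -> R) :
  L2_weighted lam (disk rho) (fun=> 1) f -> L2_weighted lam (disk rho) (fun=> 1) g ->
  L2_weighted lam (disk rho) (fun=> 1) (fun x => a * f x + b * g x).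
Proof.
move=> /L2_ext Lf /L2_ext Lg; apply: L2_plane_weighted.
rewrite (_ : ext _ _ = (fun x => a * ext rho f x + b * ext rho g x)).
  by apply: L2_planeD; exact: L2_planeZ.
apply/funext => x; rewrite /ext !patchE; case: ifP => _ //.
by rewrite !mulr0 addr0.
Qed.

(** [H1] with the weak derivatives tested on the radial span only, where integrability of the
    pairings makes linear combinations legitimate. *)
Definition H1_rad (f : R * R -> R) : Prop :=
  let L2 := L2_weighted lam (disk rho) (fun=> 1) in
  [/\ L2 f, exists2 g, L2 g & weak_derivative_rad rho (1, 0) f g &
      exists2 g, L2 g & weak_derivative_rad rho (0, 1) f g].

Lemma H1_H1_rad f : H1 (disk rho) f -> H1_rad f.
Proof.
move=> [L2f [g1 [L2g1 fg1]] [g2 [L2g2 fg2]]]; split => //.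
- by exists g1 => //; exact: weak_derivative2_rad.
- by exists g2 => //; exact: weak_derivative2_rad.
Qed.

Lemma H1_rad_comb (a b : R) f g : H1_rad f -> H1_rad g ->
  H1_rad (fun x => a * f x + b * g x).
Proof.
move=> [Lf [f1 Lf1 ff1] [f2 Lf2 ff2]] [Lg [g1 Lg1 gg1] [g2 Lg2 gg2]]; split.
- exact: L2_weighted_comb.
- exists (fun x => a * f1 x + b * g1 x); first exact: L2_weighted_comb.
  exact: weak_derivative_radD.
- exists (fun x => a * f2 x + b * g2 x); first exact: L2_weighted_comb.
  exact: weak_derivative_radD.
Qed.

Lemma multipole_profile (l : nat) (w : MR -> MR) (f1 f2 : R * R -> R) :
  measurable_fun setT w -> H1_rad f1 -> H1_rad f2 ->
  {ae lam, forall x : R * R, disk rho x ->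
    f1 x = w (enorm x) * (reP l x / enorm x ^+ l) /\
    f2 x = w (enorm x) * (imP l x / enorm x ^+ l)} ->
  H1_weighted `]0, rho[ id w /\
  ((0 < l)%N -> L2_weighted (@lebesgue1 R) `]0, rho[ (fun r => r^-1) w).
Proof.
move=> mw [Lf1 [g11 L11 d11] [g12 L12 d12]] [Lf2 [g21 L21 d21] [g22 L22 d22]] fw.
split; first exact: (multipole_H1 mw Lf1 L11 L12 d11 d12 Lf2 L21 L22 d21 d22 fw).
by move=> l0; exact: (multipole_inv_L2 mw Lf1 L11 L12 d11 d12 Lf2 L21 L22 d21 d22 fw l0).
Qed.

End sobolev_combinations.

(** * From symmetry to the profiles *)

Section symmetric_profile.
Context {R : realType}.
Local Notation MR := (measurableTypeR R).
Local Notation lam := (@lebesgue2 R).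
Variables (rho : R) (k : int) (l : nat) (sg : R).
Hypotheses (sgP : sg = 1 \/ sg = -1) (kl : k%:~R / 2 = sg * l%:R).
Variable Q : R * R -> 'M[R]_3.
Hypotheses (HQ : H1_S0 (disk rho) Q) (HS : O2_symmetric rho k Q).

Local Notation cosk := (cosk l).
Local Notation sink := (sink l sg).

(** Extended by 0, since [radial_profile] asks for invariance on the whole plane. *)
Let Qe (x : R * R) : 'M[R]_3 := \matrix_(i, j) ext rho (fun y => Q y i j) x.
Let U (x : R * R) : 'M[R]_3 := rotm (cosk x) (sink x).
Let G (x : R * R) : 'M[R]_3 := (U x)^T *m Qe x *m U x.

Let Qe_in x : disk rho x -> Qe x = Q x.
Proof. by move=> Dx; apply/matrixP => i j; rewrite mxE ext_in. Qed.

Let Qe_out x : ~ disk rho x -> Qe x = 0.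
Proof. by move=> Dx; apply/matrixP => i j; rewrite !mxE ext_out. Qed.

Let mU i j : measurable_fun setT (fun x => U x i j : MR).
Proof.
have [mr mi] := @measurable_reImP R l.
have me : measurable_fun setT (fun x => (enorm x ^+ l)^-1 : MR).
  by apply: measurable_funV; apply: measurable_funX; exact: measurable_enorm.
have mc : measurable_fun setT (cosk : MR * MR -> MR) by exact: measurable_funM.
have ms : measurable_fun setT (sink : MR * MR -> MR).
  by apply: (measurable_funM (measurable_cst sg)); exact: measurable_funM.
have E : (fun x => U x i j) = (fun x => (nth [::] [:: [:: cosk x; - sink x; 0];
    [:: sink x; cosk x; 0]; [:: 0; 0; 1]] i)`_j) by apply/funext => x; rewrite mxE.
rewrite E; move: i j {E}; apply: ord3P; apply: ord3P => //=; exact: measurable_funN.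
Qed.

Let mG i j : measurable_fun setT (fun x => G x i j : MR).
Proof.
have mQ a b : measurable_fun setT (fun x => Qe x a b : MR).
  rewrite (_ : (fun x => _) = ext rho (fun y => Q y a b)); last by apply/funext => x; rewrite mxE.
  by have [L2 _ _] := HQ.1 a b; have [] := L2_ext L2.
have E : (fun x => G x i j) = (fun x => \sum_b (\sum_a U x a i * Qe x a b) * U x b j).
  apply/funext => x; rewrite !mxE; apply: eq_bigr => b _; rewrite !mxE; congr (_ * _).
  by apply: eq_bigr => a _; rewrite !mxE.
rewrite E; apply: measurable_sum => b; apply: (measurable_funM _ (mU b j)).
by apply: measurable_sum => a; exact: (measurable_funM (mU a i) (mQ a b)).
Qed.

(** The frame turns with the point, [U (rot2 c s x) = Rk k psi *m U x], and this factor absorbs the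
    rotation in [Qact]. *)
Let G_rot c s : c ^+ 2 + s ^+ 2 = 1 -> {ae lam, forall x : R * R, G (rot2 c s x) = G x}.
Proof.
move=> cs; have [psi psi02 [cE sE]] := polar_angle cs.
have Hae := HS 0 psi02; apply: filterS Hae => x Hx.
have eE : enorm (rot2 c s x) = enorm x by rewrite enorm_rot2.
have UE : U (rot2 c s x) = Rk k psi *m U x.
  rewrite /U cE sE Rk_rotm rotm_mul.
  by have [-> ->] := cosk_rot2 sgP kl psi x.
rewrite /G UE; have [Dx|nDx] := pselect (disk rho x); last first.
  by rewrite !Qe_out ?enorm_disk ?eE// !mulmx0 !mul0mx.
rewrite (Qe_in Dx) Qe_in ?enorm_disk ?eE// (Hx Dx) Qact_rot -cE -sE.
by rewrite trmx_mul !mulmxA.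
Qed.

Let G_refl : {ae lam, forall x : R * R, G (refl2 x) = Lmx *m G x *m Lmx}.
Proof.
have psi02 : 0 <= (0 : R) < 2 * pi by rewrite lexx mulr_gt0// pi_gt0.
have Hae := HS 1 psi02; apply: filterS Hae => x Hx.
have eE : enorm (refl2 x) = enorm x by rewrite enorm_refl2.
have UE : U (refl2 x) = Lmx *m U x *m Lmx.
  by rewrite /U rotm_Lmx; have [-> ->] := cosk_refl2 l sg x.
rewrite /G UE; have [Dx|nDx] := pselect (disk rho x); last first.
  by rewrite !Qe_out ?enorm_disk ?eE// !(mulmx0, mul0mx).
rewrite (Qe_in Dx) Qe_in ?enorm_disk ?eE// (Hx Dx) Qact_rot_refl.
have -> : rot2 (cos 0) (sin 0) (refl2 x) = refl2 x.
  by rewrite cos0 sin0 /rot2 /refl2 /=; congr pair; ring.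
have -> : Rk k 0 = 1%:M :> 'M[R]_3.
  rewrite Rk_rotm mulr0 cos0 sin0; apply/matrixP; apply: ord3P; apply: ord3P;
    by rewrite !mxE /= ?oppr0.
by rewrite mul1mx !trmx_mul !LmxT !mulmxA.
Qed.

Let U_orth x : enorm x != 0 -> (U x)^T *m U x = 1%:M.
Proof. by move=> x0; apply: rotm_orth; exact: cosk2Dsink2. Qed.

Let G_sym x : Q x \in S0 -> disk rho x -> enorm x != 0 ->
  G x = (G x)^T /\ \tr (G x) = 0.
Proof.
rewrite inE => -[QT trQ] Dx x0; rewrite /G (Qe_in Dx); split.
  by rewrite !trmx_mul trmxK -QT mulmxA.
by rewrite mxtrace_mulC mulmxA (mulmx1C (U_orth x0)) mul1mx.
Qed.

Lemma symmetric_rep : exists A : 'I_3 * 'I_3 -> MR -> MR,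
  (forall ij, measurable_fun setT (A ij)) /\
  {ae lam, forall x : R * R, disk rho x -> enorm x != 0 ->
    Q x = rep (Num.sqrt (3 / 2) * A (2, 2) (enorm x))
      ((A (0, 0) (enorm x) - A (1, 1) (enorm x)) / Num.sqrt 2)
      (Num.sqrt 2 * A (0, 2) (enorm x)) (cosk x) (sink x)}.
Proof.
have H (ij : 'I_3 * 'I_3) : exists w : MR -> MR, measurable_fun setT w /\
    {ae lam, forall x : R * R, G x ij.1 ij.2 = w (enorm x)}.
  apply: radial_profile; first exact: mG.
  by move=> c s cs; apply: filterS (G_rot cs) => x ->.
have [A HA] := choice H; exists A; split; first by move=> ij; have [] := HA ij.
have aeA : {ae lam, forall x : R * R, forall ij, G x ij.1 ij.2 = A ij (enorm x)}.
  by apply: filter_forall => ij; have [] := HA ij.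
have aeAr := ae_refl2 aeA.
have aeS := HQ.2.
apply: filterS2 (filterI aeA aeAr) (filterI G_refl aeS) => x [HG HGr] [Hr HSx] Dx x0.
have [GT trG] := G_sym (HSx Dx) Dx x0.
(* The entries of [G] agree at [x] and at its mirror image because they depend on [|x|] only; the
   reflection relation becomes a condition on the single matrix [G x]. *)
have GL : G x = Lmx *m G x *m Lmx.
  rewrite -Hr; apply/matrixP => i j.
  by rewrite (HG (i, j)) (HGr (i, j)) enorm_refl2.
have /= e22 := HG (2, 2); have /= e00 := HG (0, 0); have /= e11 := HG (1, 1).
have /= e02 := HG (0, 2).
rewrite -e22 -e00 -e11 -e02; have repG := rep_fixed GT trG GL.
have UU := mulmx1C (U_orth x0).
(* Leaving the frame: [U x] sends [(1, 0, 0)] to [n]. *)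
rewrite -(@rep_conj _ (U x)^T _ _ _ (cosk x) (sink x) 1 0).
- rewrite -repG /G (Qe_in Dx) trmxK -!mulmxA UU mulmx1 !mulmxA UU mul1mx//.
- by rewrite trmxK.
- by rewrite trmxK rotm_e3.
- rewrite rotm_tr rotm_vec3; congr vec3; last by ring.
  by rewrite mulNr opprK -!expr2 cosk2Dsink2.
Qed.

End symmetric_profile.

Lemma symmetric_profiles (R : realType) (rho : R) (k : int) (l : nat) (sg : R)
    (Q : R * R -> 'M[R]_3) :
  (0 < l)%N -> sg = 1 \/ sg = -1 -> k%:~R / 2 = sg * l%:R ->
  H1_S0 (disk rho) Q -> O2_symmetric rho k Q ->
  exists w0 w1 w3 : R -> R,
    [/\ H1_weighted `]0, rho[ id w0,
        H1_weighted `]0, rho[ id w1 /\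
          L2_weighted lebesgue1 `]0, rho[ (fun r => r^-1) w1,
        H1_weighted `]0, rho[ id w3 /\
          L2_weighted lebesgue1 `]0, rho[ (fun r => r^-1) w3 &
        {ae lebesgue2, forall x : R * R, disk rho x -> enorm x != 0 ->
          Q x = rep (w0 (enorm x)) (w1 (enorm x)) (w3 (enorm x)) (cosk l x) (sink l sg x)}].
Proof.
move=> l0 sgP kl HQ HS; have [A [mA aeQ]] := symmetric_rep sgP kl HQ HS.
set w0 := fun r => Num.sqrt (3 / 2) * A (2, 2) r.
set w1 := fun r => (A (0, 0) r - A (1, 1) r) / Num.sqrt 2.
set w3 := fun r => Num.sqrt 2 * A (0, 2) r.
have mw0 : measurable_fun setT (w0 : measurableTypeR R -> measurableTypeR R).
  exact: (measurable_funM (measurable_cst _) (mA _)).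
have mw1 : measurable_fun setT (w1 : measurableTypeR R -> measurableTypeR R).
  exact: (measurable_funM (measurable_funB (mA _) (mA _)) (measurable_cst _)).
have mw3 : measurable_fun setT (w3 : measurableTypeR R -> measurableTypeR R).
  exact: (measurable_funM (measurable_cst _) (mA _)).
have HQr i j := H1_H1_rad (HQ.1 i j).
have sg2 : sg ^+ 2 = 1 by case: sgP => ->; rewrite ?sqrrN expr1n.
have q2 : Num.sqrt (2 : R) ^+ 2 = 2 by rewrite sqr_sqrtr.
have q32 : Num.sqrt (3 / 2 : R) ^+ 2 = 3 / 2 by rewrite sqr_sqrtr// divr_ge0.
have s2 := @sqrt2_gt0 R; have s2n : Num.sqrt (2 : R) != 0 by rewrite gt_eqF.
(* Frequency 0: the imaginary part is zero, and the terms with coefficient 0 give both functions the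
   shape of [H1_rad_comb]. *)
have [|H0 _] := @multipole_profile R rho 0 w0
  (fun x => Num.sqrt (3 / 2) * Q x 2 2 + 0 * Q x 2 2) (fun x => 0 * Q x 2 2 + 0 * Q x 2 2)
  mw0 (H1_rad_comb _ _ (HQr 2 2) (HQr 2 2)) (H1_rad_comb _ _ (HQr 2 2) (HQr 2 2)).
  apply: filterS2 aeQ (@ae_enorm_neq0 R) => x Hx x0 Dx; rewrite (Hx Dx x0) rep22.
  rewrite /reP /imP /= !mul0r !addr0 mulr0 invr1 !mulr1; split => //.
  transitivity (Num.sqrt (3 / 2) ^+ 2 * (2 / 3) * w0 (enorm x)); first by rewrite /w0; ring.
  by rewrite q32; field.
(* Frequency [2 l]. The factor [sg] undoes the sign carried by [sink], here and for [w3]. *)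
have [|H1 L1] := @multipole_profile R rho (l + l) w1
  (fun x => (Num.sqrt 2)^-1 * Q x 0 0 + - (Num.sqrt 2)^-1 * Q x 1 1)
  (fun x => sg * Num.sqrt 2 * Q x 0 1 + 0 * Q x 0 1)
  mw1 (H1_rad_comb _ _ (HQr 0 0) (HQr 1 1)) (H1_rad_comb _ _ (HQr 0 1) (HQr 0 1)).
  apply: filterS2 aeQ (@ae_enorm_neq0 R) => x Hx x0 Dx; have [-> ->] := cpow_double l x.
  rewrite mulNr -mulrBr (Hx Dx x0) rep00B11 rep01 mul0r addr0 exprD /cosk /sink.
  split.
    transitivity (w1 (enorm x) * (reP l x ^+ 2 - sg ^+ 2 * imP l x ^+ 2) / (enorm x ^+ l * enorm x ^+ l)).
      by rewrite /w1; field; rewrite s2n expf_neq0.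
    by rewrite sg2 mul1r mulrA.
  transitivity (Num.sqrt 2 ^+ 2 * sg ^+ 2 * w1 (enorm x) * (reP l x * imP l x) / (enorm x ^+ l * enorm x ^+ l)).
    by rewrite /w1; field; rewrite s2n expf_neq0.
  by rewrite sg2 q2; field; rewrite expf_neq0.
have [|H3 L3] := @multipole_profile R rho l w3
  (fun x => Num.sqrt 2 * Q x 0 2 + 0 * Q x 0 2)
  (fun x => sg * Num.sqrt 2 * Q x 1 2 + 0 * Q x 1 2)
  mw3 (H1_rad_comb _ _ (HQr 0 2) (HQr 0 2)) (H1_rad_comb _ _ (HQr 1 2) (HQr 1 2)).
  apply: filterS2 aeQ (@ae_enorm_neq0 R) => x Hx x0 Dx.
  rewrite (Hx Dx x0) rep02 rep12 !mul0r !addr0 /cosk /sink.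
  split; first by rewrite /w3; field; rewrite s2n expf_neq0.
  transitivity (sg ^+ 2 * w3 (enorm x) * imP l x / enorm x ^+ l).
    by rewrite /w3; field; rewrite s2n expf_neq0.
  by rewrite sg2 mul1r mulrA.
exists w0, w1, w3; split => //.
- by split => //; apply: L1; rewrite addn_gt0 l0.
- by split => //; apply: L3.
Qed.


Theorem proposition1p2 (R : realType) (rho : R) (k : int)
    (rho_gt0 : 0 < rho) (k_even : (2 %| k)%Z) (k_neq0 : k != 0)
    (Q : R * R -> 'M[R]_3) (HQ : H1_S0 (disk rho) Q) :
  O2_symmetric rho k Q <->
  exists w0 w1 w3 : R -> R,
    [/\ H1_weighted `]0, rho[ id w0,
        H1_weighted `]0, rho[ id w1 /\
          L2_weighted lebesgue1 `]0, rho[ (fun r => r^-1) w1,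
        H1_weighted `]0, rho[ id w3 /\
          L2_weighted lebesgue1 `]0, rho[ (fun r => r^-1) w3 &
        {ae lebesgue2, forall x : R * R, disk rho x ->
          forall r phi : R, 0 < r -> 0 <= phi < 2 * pi ->
            x = (r * cos phi, r * sin phi) ->
            Q x = w0 r *: E0 + w1 r *: E1 k phi + w3 r *: E3 k phi}].
Proof.
have [l [sg [l0 sgP kl]]] := @even_int_half R k k_even k_neq0.
split; last by move=> [w0 [w1 [w3 [_ _ _ H]]]]; exact: (rep_O2_symmetric sgP kl H).
move=> HS; have [w0 [w1 [w3 [H0 H1 H3 aeQ]]]] := symmetric_profiles l0 sgP kl HQ HS.
exists w0, w1, w3; split => //.
apply: filterS aeQ => x H Dx r phi r0 _ xE.
have e : enorm x = r by rewrite xE enorm_polar ?ltW.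
rewrite (H Dx) e ?gt_eqF// xE.
by have [-> ->] := cosk_polar sgP kl phi r0.
Qed.
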